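(* Let $\upsilon\in L^1_{\rm loc}(\mathbb{R})$ be nonnegative, $k\in\mathbb{N}$, $p\in[1,\infty)$, and let $q\in(0,\infty)$ satisfy $1-\frac1q<k$. Then the following three statements are mutually equivalent. (i) $\upsilon\in A_p(\mathbb{R})$. (ii) There exist $\gamma\in\Gamma_{p,q}$ and $C\in(0,\infty)$ such that, for any $f\in\dot W^{k,p}_\upsilon(\mathbb{R})$, $$\sup_{\lambda\in(0,\infty)}\lambda^p\int_{\mathbb{R}}\left[\int_{\mathbb{R}}\mathbf 1_{E_{\lambda,\frac\gamma q,k}[f]}(x,h)|h|^{\gamma-1}\,dh\right]^{\frac pq}\upsilon(x)\,dx\le C\int_{\mathbb{R}}|\nabla^kf(x)|^p\upsilon(x)\,dx.$$ (iii) There exist $\beta\in(-\infty,0)\cup(1,\infty)$ when $p=1$, or $\beta\in\mathbb{R}\setminus\{1\}$ when $p\in(1,\infty)$, and $C\in(0,\infty)$ such that, for any $\alpha\in\{0,\frac13,\frac23\}$ and $f\in\dot W^{k,p}_\upsilon(\mathbb{R})$, $$\sup_{\lambda\in(0,\infty)}\lambda^p\sum_{Q\in\mathcal{D}^\alpha_{\lambda,\beta,k}[f]}|Q|^{p(\beta-1)}\upsilon(Q)\le C\int_{\mathbb{R}}|\nabla^kf(x)|^p\upsilon(x)\,dx.$$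
   Context: Here the dimension is $n=1$, so $|\nabla^kf|=|f^{(k)}|$ (weak derivative). For $p\in(1,\infty)$, $\upsilon\in A_p(\mathbb{R})$ means $[\upsilon]_{A_p}:=\sup_Q[\frac1{|Q|}\int_Q\upsilon]\{\frac1{|Q|}\int_Q\upsilon^{1-p'}\}^{p-1}<\infty$ with $\frac1p+\frac1{p'}=1$; for $p=1$, $[\upsilon]_{A_1}:=\sup_Q[\frac1{|Q|}\int_Q\upsilon]\|\upsilon^{-1}\|_{L^\infty(Q)}<\infty$; suprema over all bounded intervals $Q$. $\upsilon(Q):=\int_Q\upsilon$. $\dot W^{k,p}_\upsilon(\mathbb{R})$ is the set of all $f\in L^1_{\rm loc}(\mathbb{R})$ (with weak $k$th derivative) with $\int|f^{(k)}|^p\upsilon<\infty$. $\Gamma_{p,q}:=(-\infty,-q)\cup(0,\infty)$ if $p=1$, and $\Gamma_{p,q}:=\mathbb{R}\setminus\{0\}$ if $p\in(1,\infty)$. $\Delta_h^kf(x):=\sum_{j=0}^k(-1)^{k-j}\binom kjf(x+jh)$ and $E_{\lambda,b,k}[f]:=\{(x,h)\in\mathbb{R}\times(\mathbb{R}\setminus\{0\}):|\Delta^k_hf(x)|>\lambda|h|^{k+b}\}$. For an interval $Q$, $P^{(k-1)}_Q(f)$ is the unique polynomial of degree at most $k-1$ with $\int_Q[f-P_Q^{(k-1)}(f)]x^j\,dx=0$ for $0\le j\le k-1$, and $E_k(f,Q):=\|f-P_Q^{(k-1)}(f)\|_{L^1(Q)}$. $\mathcal{D}^\alpha:=\{2^j[m+[0,1)+(-1)^j\alpha]:j,m\in\mathbb{Z}\}$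 and $\mathcal{D}^\alpha_{\lambda,\beta,k}[f]:=\{Q\in\mathcal{D}^\alpha:E_k(f,Q)>\lambda|Q|^{\beta+k}\}$. *)

(* Defs.v *)
From mathcomp Require Export all_boot all_order all_algebra.
From mathcomp Require Export all_classical all_reals all_analysis.
From mathcomp Require Export ess_sup_inf.
Export Order.TTheory GRing.Theory Num.Theory numFieldNormedType.Exports.

Set Implicit Arguments.
Unset Strict Implicit.
Unset Printing Implicit Defensive.

Local Open Scope classical_set_scope.
Local Open Scope ring_scope.
Local Open Scope ereal_scope.

Definition test_function (R : realType) (phi : R -> R) : Prop :=
  (forall n (x : R), derivable (derive1n n phi) x 1%R) /\
  compact (closure [set x | phi x != 0%R]).

(* The weak derivative is determined only up to a null set; it is handled as a
   relation so that g ranges over all its representatives. *)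
Definition is_weak_derivative (R : realType) (k : nat) (f g : R -> R) : Prop :=
  locally_integrable setT g /\
  forall phi : R -> R, test_function phi ->
    \int[lebesgue_measure]_x (f x * derive1n k phi x)%:E =
    ((-1) ^+ k)%:E * \int[lebesgue_measure]_x (g x * phi x)%:E.

Definition energy (R : realType) (p : R) (v g : R -> R) : \bar R :=
  \int[lebesgue_measure]_x ((`|g x| `^ p)%R * v x)%:E.

Definition homogeneous_sobolev (R : realType) (k : nat) (p : R) (v : R -> R) :
    set (R -> R) :=
  [set f | locally_integrable setT f /\
    exists g, is_weak_derivative k f g /\ energy p v g < +oo].

(* Nondegenerate bounded intervals, each endpoint being included or not. *)
Definition bounded_intervals (R : realType) : set (set R) :=
  [set Q | exists (s t : bool) (a b : R),
    (a < b)%R /\ Q = [set` Interval (BSide s a) (BSide t b)]].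

Definition len (R : realType) (Q : set R) : R := fine (lebesgue_measure Q).

Definition wmeas (R : realType) (v : R -> R) (Q : set R) : \bar R :=
  \int[lebesgue_measure]_(x in Q) (v x)%:E.

Definition average (R : realType) (Q : set R) (w : R -> \bar R) : \bar R :=
  ((len Q)^-1)%R%:E * \int[lebesgue_measure]_(x in Q) w x.

(* Inverses of the weight are taken in \bar R, where 0^-1 = +oo (in R it would
   be 0); thus v^(1-p') is written (v^-1)^(p'-1).  Products of extended reals
   use 0 * +oo = 0, which here matters only on intervals where v = 0 a.e. *)
Definition Ap_constant (R : realType) (p : R) (v : R -> R) : \bar R :=
  let p' := fine (hoelder_conjugate p%:E) in
  ereal_sup [set average Q (EFin \o v) *
    (if p == 1%R then
       ess_sup lebesgue_measure ((fun x => (v x)%:E^-1) \_ Q)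
     else
       average Q (fun x => (v x)%:E^-1 `^ (p' - 1)%R) `^ (p - 1)%R)
    | Q in @bounded_intervals R].

Definition muckenhoupt (R : realType) (p : R) (v : R -> R) : Prop :=
  Ap_constant p v < +oo.

Definition Gamma (R : realType) (p q : R) : set R :=
  if p == 1%R then `]-oo, (- q)%R[ `|` `]0%R, +oo[ else [set~ 0%R].

Definition forward_difference (R : realType) (k : nat) (h : R) (f : R -> R)
    (x : R) : R :=
  (\sum_(j < k.+1) (-1) ^+ (k - j) * 'C(k, j)%:R * f (x + j%:R * h))%R.

Definition E_set (R : realType) (lambda b : R) (k : nat) (f : R -> R) :
    set (R * R) :=
  [set xh | xh.2 != 0%R /\
    (`|forward_difference k xh.2 f xh.1| > lambda * `|xh.2| `^ (k%:R + b))%R].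

Definition is_poly_projection (R : realType) (k : nat) (Q : set R)
    (f : R -> R) (P : {poly R}) : Prop :=
  (size P <= k)%N /\
  forall j, (j < k)%N ->
    \int[lebesgue_measure]_(x in Q) ((f x - P.[x]) * x ^+ j)%:E = 0.

(* P_Q^(k-1)(f).  For f locally integrable and Q a nondegenerate bounded
   interval, exactly one polynomial satisfies the predicate, so the default
   value of xget is not used. *)
Definition poly_projection (R : realType) (k : nat) (Q : set R) (f : R -> R) :
    {poly R} :=
  xget 0%R [set P | is_poly_projection k Q f P].

Definition poly_error (R : realType) (k : nat) (f : R -> R) (Q : set R) :
    \bar R :=
  \int[lebesgue_measure]_(x in Q) `|f x - (poly_projection k Q f).[x]|%:E.

Definition dyadic (R : realType) (alpha : R) : set (set R) :=
  [set Q | exists j m : int,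
    Q = [set (2 ^ j * (m%:~R + t + (-1) ^ j * alpha))%R | t in `[0%R, 1%R[]].

Definition dyadic_sel (R : realType) (alpha lambda beta : R) (k : nat)
    (f : R -> R) : set (set R) :=
  [set Q | dyadic alpha Q /\
    poly_error k f Q > (lambda * len Q `^ (beta + k%:R))%:E].

Definition difference_functional (R : realType) (p q gamma : R) (k : nat)
    (v f : R -> R) : \bar R :=
  ereal_sup [set (lambda `^ p)%:E *
    \int[lebesgue_measure]_x
      ((\int[lebesgue_measure]_h
          ((\1_(E_set lambda (gamma / q) k f) (x, h))
             * `|h| `^ (gamma - 1))%:E) `^ (p / q)%R * (v x)%:E)
    | lambda in `]0%R, +oo[ ].

Definition dyadic_functional (R : realType) (p beta alpha : R) (k : nat)
    (v f : R -> R) : \bar R :=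
  ereal_sup [set (lambda `^ p)%:E *
    \esum_(Q in dyadic_sel alpha lambda beta k f)
      ((len Q `^ (p * (beta - 1)))%:E * wmeas v Q)
    | lambda in `]0%R, +oo[ ].

(* Main.v *)
From mathcomp Require Import ring lra zify measurable_realfun.
Require Import Defs.

Set Implicit Arguments.
Unset Strict Implicit.
Unset Printing Implicit Defensive.

Local Open Scope classical_set_scope.
Local Open Scope ring_scope.

(** Every functional below is compared with averages of the k-th weak derivative
over intervals, and A_p is exactly the condition under which such averages are
controlled by the weighted energy: for every interval Q of length l,

  (\int_Q |g|)^p v(Q) <= C l^p \int_Q |g|^p v

([muckenhoupt_average], by Hoelder; conversely [testing_muckenhoupt], where it
is enough to know the inequality for bounded g supported in Q: take g to be a
truncation of v^(1-p'), or the indicator of a sublevel set of v if p = 1).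

From A_p to the functionals.  Integration by parts and the lemma of du
Bois-Reymond show that a function f with k-th weak derivative g differs from a
polynomial of degree at most k-1 by at most |Q|^(k-1) \int_Q |g| almost
everywhere on Q ([weak_derivative_taylor]).  Therefore a dyadic interval that
is selected by the threshold lambda has \int_Q |g| >= c lambda |Q|^(1+s) with
some s > 0, and the averaging inequality bounds lambda^p |Q|^(ps) v(Q) by the
energy of g on Q.  These local bounds can be added although the selected
intervals overlap: the maximal ones are disjoint, and all those inside a maximal
one contribute at most a constant times the contribution of the latter, because
the sums of |Q|^(ps) over nested intervals are geometric series with a positive
exponent ([packing]).  One value of the parameter suffices for each functional:
beta = 2 for the dyadic one ([muckenhoupt_dyadic]) and
gamma = 1 for the one with differences ([muckenhoupt_difference]).  In the latter
case the points x, x + h, ..., x + kh lie in a dyadic interval of length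
comparable to |h| that belongs to one of two shifted grids ([dyadic_cover]); if
the k-th difference is large, this interval is selected, whence |h|^(p/q) is at
most the sum of |Q|^(p/q) over the selected intervals that contain x, for almost
every h such that (x, h) lies in the level set.

From the functionals to A_p.  Given a bounded g >= 0 supported in [a, b], its
k-fold primitive f from the right vanishes to the right of b and is a polynomial
of degree at most k-1 to the left of a, of size at least (b-a)^(k-1) \int g /
(k-1)! at distance b-a from [a, b].  A k-th difference with all its points but
one in the region where f vanishes, or all but one in the region where f is a
polynomial and can be subtracted, is therefore bounded below
([norm_difference_left], [norm_difference_right]).  Testing a single level lambda
on such an f gives the averaging inequality: with v measured on a single dyadic
interval that contains [a, b] for the dyadic functional ([dyadic_testing]), and
with v measured on a translate of [a, b] for the other one
([difference_testing]), where translating first to the left and then back to the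
right removes the shift ([shifted_testing_testing]). *)

(** * Smooth functions and a bump function *)

Section smooth.
Variable R : realType.
Implicit Types f g : R -> R.

Definition smooth f := forall n x, derivable (derive1n n f) x 1.

Lemma derive1nSr n f : derive1n n.+1 f = derive1n n (derive1 f).
Proof. exact: iterSr. Qed.

(** Iterated derivatives are awkward to compute; it is enough to exhibit a class
of functions that is stable under one derivation. *)
Lemma smooth_coind (P : (R -> R) -> Prop) :
  (forall f, P f -> (forall x, derivable f x 1) /\ P (derive1 f)) ->
  forall f, P f -> smooth f.
Proof.
move=> step f Pf n.
suff: P (derive1n n f) by move/step => [].
elim: n f Pf => [//|n IH] f /step[_ Pf'].
by rewrite derive1nSr; exact: IH.
Qed.

Lemma smooth_derive1 f : smooth f -> smooth (derive1 f).
Proof. by move=> sf n x; rewrite -derive1nSr; exact: sf. Qed.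

(** The functions x^(-n) exp(-1/x), extended by 0: the linear span of this family
is stable under derivation, which makes exp(-1/x) smooth at 0. *)
Definition flat (n : nat) (x : R) : R :=
  if 0 < x then x^-1 ^+ n * expR (- x^-1) else 0.

(** This bound makes the difference quotient at 0 tend to 0. *)
Lemma flat_sq n x : `|flat n x| <= (n.+2)`!%:R * x ^+ 2.
Proof.
rewrite /flat; case: ifPn => [x0|_]; last first.
  by rewrite normr0 mulr_ge0// sqr_ge0.
rewrite ger0_norm ?mulr_ge0 ?exprn_ge0 ?invr_ge0 ?(ltW x0) ?expR_ge0//.
rewrite expRN ler_pdivrMr ?expR_gt0//.
have xV : 0 <= x^-1 by rewrite invr_ge0 ltW.
have := expR_ge1Dxn n.+1 xV; set y := x^-1 => h.
have h' : y ^+ n.+2 / (n.+2)`!%:R <= expR y by apply: le_trans h; rewrite lerDr.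
apply: (@le_trans _ _ ((n.+2)`!%:R * x ^+ 2 * (y ^+ n.+2 / (n.+2)`!%:R))).
  have nf : (n.+2)`!%:R != 0 :> R by rewrite pnatr_eq0 -lt0n fact_gt0.
  suff -> : (n.+2)`!%:R * x ^+ 2 * (y ^+ n.+2 / (n.+2)`!%:R) = y ^+ n by [].
  have xy : x ^+ 2 * y ^+ 2 = 1 by rewrite -exprMn mulfV ?expr1n// gt_eqF.
  have -> : y ^+ n.+2 = y ^+ n * y ^+ 2 by rewrite -addn2 exprD.
  transitivity (y ^+ n * (x ^+ 2 * y ^+ 2) * ((n.+2)`!%:R / (n.+2)`!%:R)); last first.
    by rewrite xy mulfV// !mulr1.
  ring.
by rewrite ler_pM2l// mulr_gt0 ?ltr0n ?fact_gt0// exprn_gt0.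
Qed.

Lemma is_derive_flat n x :
  is_derive x (1:R) (flat n) (flat n.+2 x - n%:R * flat n.+1 x).
Proof.
have [x0|x0|->] := ltgtP x 0.
- rewrite /flat ltNge (ltW x0)/= mulr0 subr0.
  apply: (@near_eq_is_derive _ _ _ (cst 0)) => //.
  near=> y; rewrite ltNge ifF//; apply/negbF/ltW.
  by near: y; exact: lt_nbhsl.
- rewrite /flat x0.
  apply: (@near_eq_is_derive _ R^o R^o (fun x : R => x^-1 ^+ n * expR (- x^-1) : R)).
    near=> y; rewrite ifT//.
    by near: y; exact: lt_nbhsr.
  have dV : is_derive x (1:R) (fun x => x^-1) (- x ^- 2 *: 1).
    by apply: (@is_deriveV _ id); rewrite gt_eqF.
  have dE := @is_derive1_comp R expR (fun x => - x^-1) x _ _ (is_derive_expR _) (is_deriveN dV).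
  have dP := is_deriveX n dV.
  have := is_deriveM dP dE; rewrite exprfctE => dM; apply: (is_derive_eq dM).
  rewrite /= /GRing.scale /= !mulr1; case: n {dP dM} => [|n].
    rewrite expr0 !expr2 invfM; ring.
  rewrite succnK (exprS _ n.+2) (exprS _ n.+1) (exprS _ n) exprVn -!exprVn expr2.
  by ring.
- have -> : flat n.+2 0 - n%:R * flat n.+1 0 = 0 by rewrite /flat ltxx mulr0 subr0.
  have f0 : flat n 0 = 0 by rewrite /flat ltxx.
  have cv : h^-1 *: ((flat n \o shift 0) (h *: 1) - flat n 0) @[h --> 0^'] --> (0:R).
    apply/cvgrPdist_le => e e0; near=> h.
    rewrite sub0r normrN f0 subr0 /= /GRing.scale /= addr0 mulr1 normrM normfV.
    have h0 : h != 0 by near: h; exact: nbhs_dnbhs_neq.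
    rewrite ler_pdivrMl ?normr_gt0//; apply: le_trans (flat_sq _ _) _.
    rewrite -real_normK ?num_real// expr2 mulrA mulrC ler_pM2l ?normr_gt0//.
    rewrite -ler_pdivlMl ?ltr0n ?fact_gt0//.
    near: h; apply: dnbhs0_le; rewrite mulr_gt0// invr_gt0 ltr0n fact_gt0//.
  apply: DeriveDef; first by apply/cvg_ex; exists 0.
  exact/cvg_lim.
Unshelve. all: by end_near. Qed.

(** The class fed to [smooth_coind]: the derivative of an element is again an
element by the rules for sums and products and by [is_derive_flat].  The
constructor for smooth functions lets the same class prove that sums and
products of smooth functions are smooth. *)
Inductive smooth_expr : (R -> R) -> Prop :=
| se_smooth f : smooth f -> smooth_expr f
| se_cst c : smooth_expr (cst c)
| se_flat n a b : smooth_expr (fun x => flat n (a * x + b))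
| se_add f g : smooth_expr f -> smooth_expr g -> smooth_expr (f \+ g)
| se_mul f g : smooth_expr f -> smooth_expr g -> smooth_expr (f \* g).

Lemma smooth_exprW f : smooth_expr f -> smooth f.
Proof.
apply: smooth_coind => {}f.
suff: smooth_expr f -> exists2 f', smooth_expr f' & forall x, is_derive x (1:R) f (f' x).
  move=> h /h[f' sf' df]; split=> [x|]; first exact: ex_derive.
  suff -> : derive1 f = f' by [].
  by apply/funext => x; rewrite derive1E (@derive_val _ _ _ _ _ _ _ (df x)).
elim=> {f} [f sf|c|n a b|f g _ [f' sf' df] _ [g' sg' dg]|f g sf [f' sf' df] sg [g' sg' dg]].
- exists (derive1 f); first by apply: se_smooth; exact: smooth_derive1.
  by move=> x; rewrite derive1E; apply: DeriveDef => //; exact: (sf 0%N).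
- by exists (cst 0) => [|x]; [exact: se_cst|exact: is_derive_cst].
- exists (((fun x => flat n.+2 (a * x + b)) \* cst a) \+
     ((fun x => flat n.+1 (a * x + b)) \* cst (- n%:R * a))).
    by repeat constructor.
  move=> x.
  have dA : is_derive x (1:R) (fun x => a * x + b) (a * 1 + 0).
    by apply: is_deriveD; exact: (is_deriveZ (f := id)).
  apply: is_derive_eq.
    exact: (@is_derive1_comp R (flat n) _ x _ _ (is_derive_flat n _) dA).
  rewrite /=; ring.
- exists (f' \+ g'); first exact: se_add.
  by move=> x; exact: is_deriveD.
- exists ((f \* g') \+ (g \* f')).
    by apply: se_add; apply: se_mul.
  by move=> x; exact: is_deriveM.
Qed.

Lemma smoothD f g : smooth f -> smooth g -> smooth (f \+ g).
Proof. by move=> sf sg; apply/smooth_exprW/se_add; exact: se_smooth. Qed.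

Lemma smoothZ c f : smooth f -> smooth (fun x => c * f x).
Proof.
move=> sf; apply: smooth_exprW; apply: (@se_mul (cst c) f).
  exact: se_cst.
exact: se_smooth.
Qed.

Lemma smooth_continuous f n : smooth f -> continuous (derive1n n f).
Proof.
by move=> sf x; apply: differentiable_continuous; apply/derivable1_diffP; exact: sf.
Qed.

Lemma smooth_cts f : smooth f -> continuous f.
Proof. exact: (@smooth_continuous f 0). Qed.

Lemma derive1nD n f g : smooth f -> smooth g ->
  derive1n n (f \+ g) = derive1n n f \+ derive1n n g.
Proof.
move=> sf sg; elim: n => [//|n IH]; rewrite !derive1nS IH.
apply/funext => x; rewrite derive1E (@deriveD _ _ _ (derive1n n f)).
- by rewrite /= !derive1E.
- exact: sf.
- exact: sg.
Qed.

Lemma derive1nZ n c f : smooth f ->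
  derive1n n (fun x => c * f x) = (fun x => c * derive1n n f x).
Proof.
move=> sf; elim: n => [//|n IH]; rewrite !derive1nS IH.
apply/funext => x; rewrite !derive1E.
by rewrite (@deriveZ _ _ _ (derive1n n f))//; exact: sf.
Qed.

End smooth.

(** * Test functions supported in an interval *)

Section test_on.
Variable R : realType.
Implicit Types (a b : R) (f phi psi : R -> R).
Notation mu := (@lebesgue_measure R).

(** Test functions with a prescribed support: it is the interval that matters
when the equation for the weak derivative is used locally. *)
Definition test_on a b phi :=
  smooth phi /\ forall x, ~~ (a < x < b) -> phi x = 0.

Lemma test_on_sub a b c d phi : c <= a -> b <= d ->
  test_on a b phi -> test_on c d phi.
Proof.
move=> ca bd [sp p0]; split=> // x; move=> h; apply: p0; apply: contra h.
by case/andP => ax xb; rewrite (le_lt_trans ca ax) (lt_le_trans xb bd).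
Qed.

Lemma test_onD a b phi psi : test_on a b phi -> test_on a b psi ->
  test_on a b (phi \+ psi).
Proof.
move=> [sp p0] [sq q0]; split; first exact: smoothD.
by move=> x xab /=; rewrite p0// q0// addr0.
Qed.

Lemma test_onZ c a b phi : test_on a b phi -> test_on a b (fun x => c * phi x).
Proof.
move=> [sp p0]; split; first exact: smoothZ.
by move=> x xab /=; rewrite p0// mulr0.
Qed.

(** At the endpoints the derivative vanishes by continuity, being zero on the
outside. *)
Lemma test_on_derive1 a b phi : test_on a b phi -> test_on a b (derive1 phi).
Proof.
move=> [sp p0]; split; first exact: smooth_derive1.
have cp : continuous (derive1 phi).
  by rewrite -derive1n1; apply: smooth_continuous.
have out x : x < a \/ b < x -> derive1 phi x = 0.
  case=> xab; rewrite derive1E (@near_eq_derive _ _ _ _ (cst 0)) ?derive_cst//.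
    near=> y; apply: p0; rewrite negb_and -!leNgt; apply/orP; left; apply/ltW.
    by near: y; exact: lt_nbhsl.
  near=> y; apply: p0; rewrite negb_and -!leNgt; apply/orP; right; apply/ltW.
  by near: y; exact: lt_nbhsr.
move=> x; rewrite negb_and -!leNgt => /orP[|]; rewrite le_eqVlt => /orP[/eqP|xab].
- move=> ->; apply: (@cvg_unique _ (@Rhausdorff R) (derive1 phi y @[y --> a^'-])) => //.
    by apply: cvg_at_left_filter; exact: cp.
  apply: cvg_near_cst; near=> y; apply: out; left.
  by near: y; exact: nbhs_left_lt.
- by apply: out; left.
- move=> <-; apply: (@cvg_unique _ (@Rhausdorff R) (derive1 phi y @[y --> b^'+])) => //.
    by apply: cvg_at_right_filter; exact: cp.
  apply: cvg_near_cst; near=> y; apply: out; right.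
  by near: y; exact: nbhs_right_gt.
- by apply: out; right.
Unshelve. all: by end_near. Qed.

Lemma test_on_derive1n n a b phi :
  test_on a b phi -> test_on a b (derive1n n phi).
Proof.
by elim: n => [//|n IH] tp; rewrite derive1nS; apply: test_on_derive1; exact: IH.
Qed.

Lemma test_on_bounded a b phi : test_on a b phi ->
  exists2 M, 0 <= M & forall x, `|phi x| <= M.
Proof.
move=> [sp p0].
have [ba|ab] := leP b a.
  exists 0 => // x; rewrite p0 ?normr0// negb_and -!leNgt.
  by have [//|ax] := leP x a; rewrite (le_trans ba (ltW ax)).
have cp : {within `[a, b], continuous (fun x => `|phi x|)}.
  apply: continuous_subspaceT => x; apply: continuous_comp.
    exact: (smooth_cts sp).
  exact: norm_continuous.
have [c cab cM] := EVT_max (ltW ab) cp.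
exists `|phi c| => // x.
have [/andP[ax xb]|/p0->] := boolP (a < x < b); last by rewrite normr0.
by apply: cM; rewrite in_itv/= !ltW.
Qed.

Lemma test_on_measurable a b phi : test_on a b phi -> measurable_fun setT phi.
Proof. by move=> [sp _]; apply: continuous_measurable_fun; exact: (smooth_cts sp). Qed.

Lemma test_on_integrable a b phi : test_on a b phi ->
  mu.-integrable setT (EFin \o phi).
Proof.
move=> tp; have [sp p0] := tp.
have -> : EFin \o phi = (EFin \o phi) \_ `[a, b].
  apply/funext => x; rewrite patchE; case: ifPn => //.
  rewrite notin_setE/= in_itv/= => xab /=; rewrite p0//.
  by apply/negP => /andP[ax xb]; apply: xab; rewrite !ltW.
apply/integrable_restrict => //=; rewrite setTI.
apply: continuous_compact_integrable; first exact: segment_compact.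
by apply: continuous_subspaceT; exact: (smooth_cts sp).
Qed.

(** The primitive that vanishes to the left of a vanishes to the right of b
precisely because the integral of psi is 0. *)
Lemma test_on_primitive a b psi : test_on a b psi ->
  \int[mu]_x psi x = 0 -> exists2 phi, test_on a b phi & derive1 phi = psi.
Proof.
move=> tp; have [sp p0] := tp => int0.
pose phi x := \int[mu]_(t in `]-oo, x]) psi t.
have dphi x : derivable phi x 1 /\ derive1 phi x = psi x.
  apply: (@continuous_FTC1 R psi _ x (x + 1)) => //.
  - by rewrite ltrDl.
  - by apply: integrableS (test_on_integrable tp).
  - by rewrite ltNyr.
  - exact: (smooth_cts sp).
have ep : derive1 phi = psi by apply/funext => x; case: (dphi x).
exists phi => //; split.
  case=> [|n] x; first by case: (dphi x).
  by rewrite derive1nSr ep; exact: sp.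
move=> x; rewrite negb_and -!leNgt => /orP[xa|bx].
  rewrite /phi (@eq_Rintegral _ _ _ _ _ (cst 0)) ?Rintegral_cst ?mul0r//.
  move=> t; rewrite inE/= in_itv/= => tx; apply: p0.
  by rewrite negb_and -leNgt (le_trans tx xa).
rewrite /phi Rintegral_mkcond -[RHS]int0; apply: eq_Rintegral => t _.
rewrite patchE; case: ifPn => //; rewrite notin_setE/= in_itv/= => tx.
rewrite p0// negb_and -!leNgt (le_trans bx) ?orbT// ltW// ltNge; exact/negP.
Qed.

Lemma test_on_test_function a b phi : test_on a b phi -> test_function phi.
Proof.
move=> [sp p0]; split; first exact: sp.
apply: (@subclosed_compact _ _ `[a, b]).
- exact: closed_closure.
- exact: segment_compact.
rewrite closureE; apply: smallest_sub => //; first exact: interval_closed.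
move=> x /=; rewrite in_itv/=; case: (boolP (a < x < b)).
  by move=> /andP[ax xb]; rewrite !ltW.
by move=> /p0 ->; rewrite eqxx.
Qed.

Lemma test_function_test_on phi : test_function phi ->
  exists2 M, 0 < M & test_on (- M) M phi.
Proof.
move=> [sp /compact_bounded].
rewrite /bounded_set/= => -[M [_ hM]].
(* The summand 1 makes the bound strict and positive. *)
exists (`|M| + 1) => //; split=> // x xM.
apply: contraNeq xM => px.
rewrite -ltr_norml (@le_lt_trans _ _ (`|M| + 2^-1))//.
  by apply: hM; [rewrite (le_lt_trans (ler_norm M))// ltrDl|apply: subset_closure].
by rewrite ltrD2l invf_lt1 ?ltr1n.
Qed.

(** As n tends to infinity these increase to the indicator of the open interval. *)
Lemma test_on_bump a b n : test_on a b (fun x => flat 0 (n.+1%:R * (x - a)) * flat 0 (n.+1%:R * (b - x))).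
Proof.
split; last first.
  move=> x; rewrite negb_and -!leNgt /flat => /orP[xa|bx].
    by rewrite pmulr_rgt0// subr_gt0 ltNge xa mul0r.
  by rewrite pmulr_rgt0// [in X in _ * X]pmulr_rgt0// !subr_gt0 (ltNge x) bx mulr0.
rewrite (_ : (fun x => _) = (fun x => flat 0 (n.+1%:R * x + - (n.+1%:R * a))) \*
  (fun x => flat 0 (- n.+1%:R * x + (n.+1%:R * b)))); last first.
  by apply/funext => x /=; congr (flat _ _ * flat _ _); ring.
by apply: smooth_exprW; apply: se_mul; exact: se_flat.
Qed.

End test_on.

(** * The lemma of du Bois-Reymond *)

Section dubois_reymond.
Variable R : realType.
Implicit Types (a b : R) (f u phi psi : R -> R).
Notation mu := (@lebesgue_measure R).

Lemma ae_imp (P Q : R -> Prop) : (forall x, P x -> Q x) ->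
  {ae mu, forall x, P x} -> {ae mu, forall x, Q x}.
Proof. exact: (@filterS _ _ (ae_filter_ringOfSetsType mu)). Qed.

Lemma integrable_mul (D : set R) f (h : R -> R) (M : R) : measurable D ->
  mu.-integrable D (EFin \o f) -> measurable_fun D h ->
  (forall x, D x -> `|h x| <= M) ->
  mu.-integrable D (EFin \o (fun x => f x * h x)).
Proof.
move=> mD intf mh hM.
have := @integrableMl _ _ _ mu _ mD (EFin \o f) h intf mh; apply.
exists M; split; first exact: num_real.
by move=> N MN x Dx /=; rewrite (le_trans (hM _ Dx))// ltW.
Qed.

Lemma integrable_mul_test (D : set R) a b f phi : measurable D ->
  mu.-integrable D (EFin \o f) -> test_on a b phi ->
  mu.-integrable D (EFin \o (fun x => f x * phi x)).
Proof.
move=> mD intf tp; have [M _ hM] := test_on_bounded tp.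
apply: (@integrable_mul _ _ _ M) => //.
by apply: measurable_funS (test_on_measurable tp).
Qed.

Lemma integrable_horner a b (P : {poly R}) :
  mu.-integrable `[a, b] (EFin \o horner P).
Proof.
apply: continuous_compact_integrable; first exact: segment_compact.
by apply: continuous_subspaceT; exact: continuous_horner.
Qed.

Lemma horner_by_parts a b (P : {poly R}) phi : a < b -> smooth phi ->
  \int[mu]_(x in `[a, b]) (P.[x] * derive1 phi x) =
  P.[b] * phi b - P.[a] * phi a - \int[mu]_(x in `[a, b]) (P^`().[x] * phi x).
Proof.
move=> ab sp.
have cv (f : R -> R) : continuous f -> f x @[x --> a^'+] --> f a /\ f x @[x --> b^'-] --> f b.
  by move=> cf; split; [apply: cvg_at_right_filter|apply: cvg_at_left_filter]; exact: cf.
apply: Rintegration_by_parts => //.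
- by apply: continuous_subspaceT; exact: continuous_horner.
- by have [ca cb] := cv _ (@continuous_horner R P); split=> // x _; exact: derivable_horner.
- by move=> x _; rewrite derivE.
- by apply: continuous_subspaceT; rewrite -derive1n1; apply: smooth_continuous.
- by have [ca cb] := cv _ (smooth_cts sp); split=> // x _; exact: (sp 0%N).
Qed.

Lemma horner_by_parts_test a b n (P : {poly R}) phi : a < b -> test_on a b phi ->
  \int[mu]_(x in `[a, b]) (P.[x] * derive1n n phi x) =
  (-1) ^+ n * \int[mu]_(x in `[a, b]) ((P^`(n)%R).[x] * phi x).
Proof.
move=> ab; elim: n P => [|n IH] P tp; first by rewrite expr0 mul1r.
have tn := test_on_derive1n n tp.
rewrite derive1nS (horner_by_parts _ ab (proj1 tn)).
rewrite !(proj2 tn) ?ltxx ?andbF// !mulr0 subrr sub0r IH//.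
by rewrite exprS mulN1r mulNr -derivSn.
Qed.

Lemma Rintegral_test a b phi (f : R -> R) : test_on a b phi ->
  \int[mu]_x (f x * phi x) = \int[mu]_(x in `[a, b]) (f x * phi x).
Proof.
move=> [_ p0]; rewrite [RHS]Rintegral_mkcond; apply: eq_Rintegral => x _.
rewrite patchE; case: ifPn => //; rewrite notin_setE/= in_itv/= => xab.
by rewrite p0 ?mulr0//; apply/negP => /andP[? ?]; apply: xab; rewrite !ltW.
Qed.

Lemma flat0_le1 (x : R) : 0 <= flat 0 x <= 1.
Proof.
rewrite /flat; case: ifP => x0; last by rewrite lexx ler01.
by rewrite expr0 mul1r expR_ge0/= -expR0 ler_expR lerNl oppr0 invr_ge0 ltW.
Qed.

Lemma cvg_flat (t : R) : flat 0 (n.+1%:R * t) @[n --> \oo] --> ((0 < t)%R%:R : R).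
Proof.
have [t0|t0] := ltP 0 t; last first.
  rewrite (_ : (fun n : nat => _) = cst 0); first exact: cvg_cst.
  apply/funext => n; rewrite /flat ifF//; apply/negbTE.
  by rewrite -leNgt mulr_ge0_le0.
rewrite (_ : (fun n : nat => _) = (fun n : nat => expR (- (t^-1 * harmonic n)))); last first.
  apply/funext => n; rewrite /flat mulr_gt0// expr0 mul1r invfM mulrC//.
rewrite (_ : true%:R = expR 0 :> R); last by rewrite expR0.
apply: continuous_cvg; first exact: continuous_expR.
rewrite -oppr0; apply: cvgN; rewrite -(mulr0 t^-1).
by apply: cvgMr; exact: cvg_harmonic.
Qed.

(** Letting the bumps tend to the indicator of a subinterval shows that the
primitive of u vanishes identically; by Lebesgue's differentiation theorem so
does u. *)
Lemma ae0_of_test a b u : a < b -> mu.-integrable `[a, b] (EFin \o u) ->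
  (forall phi, test_on a b phi -> \int[mu]_(x in `[a, b]) (u x * phi x) = 0) ->
  {ae mu, forall x, a < x < b -> u x = 0}.
Proof.
move=> ab intu u0.
have sub c d : a <= c -> d <= b -> \int[mu]_(x in `]c, d[) u x = 0.
  move=> ac db.
  pose F (n : nat) x := flat 0 (n.+1%:R * (x - c)) * flat 0 (n.+1%:R * (d - x)).
  have tF n : test_on a b (F n) by apply: test_on_sub (test_on_bump c d n).
  have lF n x : `|F n x| <= 1.
    rewrite normrM; apply: mulr_ile1 => //.
      by case/andP: (flat0_le1 (n.+1%:R * (x - c))) => *; rewrite ger0_norm.
    by case/andP: (flat0_le1 (n.+1%:R * (d - x))) => *; rewrite ger0_norm.
  have mu_u : measurable_fun `[a, b] u.
    by have /integrableP[/measurable_EFinP] := intu.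
  have [] := @dominated_convergence _ _ _ mu `[a, b]%classic (measurable_itv _)
    (fun n x => (u x * F n x)%:E) (EFin \o (fun x => u x * \1_(`]c, d[) x))
    (abse \o (EFin \o u)).
  - move=> n; apply/measurable_EFinP/measurable_funM => //.
    by apply: measurable_funS (test_on_measurable (tF n)).
  - apply/measurable_EFinP/measurable_funM => //.
  - apply: aeW => x xab; apply: cvg_EFin; first by near=> n.
    apply: cvgMr; rewrite indicE mem_setE in_itv/= -(subr_gt0 c) -(subr_gt0 x).
    by rewrite -mulnb natrM; apply: cvgM; exact: cvg_flat.
  - exact: integrable_abse.
  - apply: aeW => x n xab /=; rewrite lee_fin normrM ler_piMr//.
  move=> iu _ cu; rewrite /Rintegral.
  have -> : (\int[mu]_(x in `]c, d[) (u x)%:E = \int[mu]_(x in `[a, b]) (u x * \1_(`]c, d[) x)%:E)%E.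
    rewrite [LHS]integral_mkcond [RHS]integral_mkcond; apply: eq_integral => x _.
    rewrite !patchE indicE; case: ifPn => xcd.
      rewrite mulr1 ifT//; move: xcd; rewrite !inE/= !in_itv/= => /andP[cx xd].
      by rewrite (le_trans ac (ltW cx)) (le_trans (ltW xd) db).
    by case: ifPn => //; rewrite mulr0.
  move/cvg_lim : cu => <-//.
  rewrite (_ : (fun n => _) = cst 0%E) ?lim_cst//.
  apply/funext => n /=.
  have := u0 _ (tF n); rewrite /Rintegral => h.
  rewrite -[LHS]fineK ?h//; apply: integrable_fin_num => //.
  exact: (integrable_mul_test _ intu (tF n)).
pose w := u \_ `[a, b].
have intw : mu.-integrable setT (EFin \o w).
  by rewrite /w -restrict_EFin; apply/integrable_restrict => //; rewrite setTI.
have locw : locally_integrable setT w.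
  by apply: open_integrable_locally => //; exact: openT.
have iw y : mu.-integrable `]a, y] (EFin \o w) by apply: integrableS intw.
have := @FTC1 R w (BRight a) iw locw.
apply: ae_imp => x hx /andP[ax xb].
have [|_] := hx; first by rewrite lte_fin.
rewrite /w patchE mem_set/=; last by rewrite in_itv/= !ltW.
move=> <-; rewrite derive1E (@near_eq_derive _ _ _ _ (cst 0)) ?derive_cst//.
near=> y; rewrite -(sub a y)//; last first.
  by apply: ltW; near: y; exact: lt_nbhsl.
rewrite Rintegral_itv_bndo_bndc; last first.
  by apply: integrableS intu => //; apply: subset_itv; rewrite bnd_simp//; apply: ltW; near: y; exact: lt_nbhsl.
apply: eq_Rintegral => t; rewrite inE/= in_itv/= => /andP[ta ty].
rewrite patchE mem_set//= in_itv/= (ltW ta) (le_trans ty)//.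
by apply: ltW; near: y; exact: lt_nbhsl.
Unshelve. all: by end_near. Qed.

(** Otherwise the constant 1 would be orthogonal to all test functions, hence 0
almost everywhere. *)
Lemma test_on_unit_mass a b : a < b ->
  exists2 eta, test_on a b eta & \int[mu]_(x in `[a, b]) eta x = 1.
Proof.
move=> ab; apply: contrapT => none.
have i1 : mu.-integrable `[a, b] (EFin \o (cst 1 : R -> R)).
  by apply: eq_integrable (integrable_horner a b 1%:P) => // x _ /=; rewrite hornerC.
have [phi tp|N [mN N0 sub]] := ae0_of_test ab i1.
  apply: contrapT => /eqP I0; apply: none.
  set I := (X in X != 0) in I0.
  exists (fun x => I^-1 * phi x); first exact: test_onZ.
  rewrite RintegralZl//; last by apply: integrableS (test_on_integrable tp).
  rewrite -(mulVf I0) /I; congr (_ * _).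
  by apply: eq_Rintegral => x _; rewrite mul1r.
have abN : `]a, b[ `<=` N.
  move=> x /= xab; apply: sub => /= h.
  by move: xab; rewrite in_itv/= => /h /eqP; rewrite oner_eq0.
have ab0 : mu `]a, b[ = 0%E by apply: (@subset_measure0 _ _ _ mu _ N).
by move/eqP: ab0; rewrite lebesgue_measure_itv/= lte_fin ab -EFinB eqe subr_eq0 gt_eqF.
Qed.

(** Induction on k: after subtraction of a multiple of x^k, u is orthogonal to
the derivatives of order k of all test functions and not only to those of
order k+1, since a test function psi minus (\int psi) eta has a primitive that is
a test function. *)
Lemma dubois_reymond k a b u : a < b -> mu.-integrable `[a, b] (EFin \o u) ->
  (forall phi, test_on a b phi ->
     \int[mu]_(x in `[a, b]) (u x * derive1n k phi x) = 0) ->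
  exists2 P : {poly R}, (size P <= k)%N & {ae mu, forall x, a < x < b -> u x = P.[x]}.
Proof.
move=> ab; elim: k u => [|k IH] u intu u0.
  exists 0; first by rewrite size_poly0.
  have := ae0_of_test ab intu u0.
  by apply: ae_imp => x h /h ->; rewrite horner0.
have [eta teta eta1] := test_on_unit_mass ab.
pose c := \int[mu]_(x in `[a, b]) (u x * derive1n k eta x).
(* The derivative of order k of w is the constant (-1)^k c. *)
pose w : {poly R} := (c * (-1) ^+ k / k`!%:R) *: 'X^k.
have intw : mu.-integrable `[a, b] (EFin \o horner w) by exact: integrable_horner.
have [||P sP uP] := IH (fun x => u x - w.[x]).
- by apply: eq_integrable (integrableB _ intu intw).
- move=> psi tpsi.
  have tk := test_on_derive1n k tpsi.
  under eq_Rintegral do rewrite mulrBl.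
  rewrite RintegralB//; [|exact: (integrable_mul_test _ intu tk)|exact: (integrable_mul_test _ intw tk)].
  pose J := \int[mu]_(x in `[a, b]) psi x.
  pose psi0 x := psi x + - J * eta x.
  have tpsi0 : test_on a b psi0 by apply: (test_onD tpsi); exact: test_onZ.
  have int0 : \int[mu]_x psi0 x = 0.
    have := Rintegral_test (cst 1) tpsi0.
    under eq_Rintegral do rewrite mul1r.
    move=> ->; under eq_Rintegral do rewrite mul1r.
    rewrite RintegralD//.
    + by rewrite RintegralZl ?eta1 ?mulr1 ?subrr//; apply: integrableS (test_on_integrable teta).
    + by apply: integrableS (test_on_integrable tpsi).
    + by apply: integrableS (test_on_integrable (test_onZ (- J) teta)).
  have [phi tphi ephi] := test_on_primitive tpsi0 int0.
  have := u0 _ tphi; rewrite derive1nSr ephi.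
  have -> : derive1n k psi0 = (fun x => derive1n k psi x + - J * derive1n k eta x).
    have [spsi _] := tpsi; have [seta _] := teta.
    have -> := derive1nD k spsi (smoothZ (c := - J) seta).
    by rewrite derive1nZ.
  under eq_Rintegral do rewrite mulrDr mulrCA.
  have teta_k := test_on_derive1n k teta.
  have iue := integrable_mul_test (measurable_itv _) intu teta_k.
  rewrite RintegralD//; [|exact: (integrable_mul_test _ intu tk)|]; last first.
    exact: (@integrableZl _ _ _ mu _ (measurable_itv _) (- J) _ iue).
  rewrite RintegralZl// -/c horner_by_parts_test// => h.
  apply/eqP; rewrite subr_eq0; apply/eqP; move: h => /eqP.
  rewrite mulNr subr_eq0 => /eqP ->.
  under eq_Rintegral.
    move=> x _; rewrite /w derivnZ derivnXn subnn ffactnn expr0 hornerZ hornerMn hornerC.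
    over.
  rewrite RintegralZl//; last by apply: integrableS (test_on_integrable tpsi).
  rewrite -/J mulrA mulrC; congr (_ * _).
  have fk : k`!%:R != 0 :> R by rewrite pnatr_eq0 -lt0n fact_gt0.
  have sg : (-1) ^+ k * (-1) ^+ k = 1 :> R by rewrite -expr2 sqrr_sign.
  transitivity (c * ((-1) ^+ k * (-1) ^+ k)); first by rewrite sg mulr1.
  by field.
- exists (P + w).
    rewrite (leq_trans (size_polyD _ _))// geq_max (leq_trans sP)//=.
    by rewrite (leq_trans (size_scale_leq _ _))// size_polyXn.
  apply: ae_imp uP => x h /h; rewrite hornerD => <-; by rewrite subrK.
Qed.

End dubois_reymond.

(** * Iterated primitives *)

Section antider.
Variable R : realType.
Implicit Types (a b : R) (f g u phi psi : R -> R).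
Notation mu := (@lebesgue_measure R).

Definition tail_power k (t y : R) : R :=
  if y < t then (t - y) ^+ k / k`!%:R else 0.

(** The (k+1)-fold primitive of g restricted to [a, b] that vanishes to the right
of b, up to the sign (-1)^(k+1). *)
Definition tail_primitive k a b g (y : R) : R :=
  \int[mu]_(t in `[a, b]) (g t * tail_power k t y).

Lemma tail_power_ge0 k t y : 0 <= tail_power k t y.
Proof.
rewrite /tail_power; case: ifPn => // yt.
by rewrite divr_ge0// exprn_ge0// subr_ge0 ltW.
Qed.

Lemma tail_power_le k t y (M : R) : `|t - y| <= M -> tail_power k t y <= M ^+ k.
Proof.
rewrite /tail_power => tyM; case: ifPn => yt; last first.
  by rewrite exprn_ge0// (le_trans _ tyM).
rewrite ler_pdivrMr ?ltr0n ?fact_gt0//; apply: (@le_trans _ _ (M ^+ k)).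
  by rewrite lerXn2r ?nnegrE ?(le_trans _ tyM)// ?subr_ge0 ?(ltW yt)// (le_trans (ler_norm _)).
by rewrite ler_peMr ?exprn_ge0 ?(le_trans _ tyM)// ler1n fact_gt0.
Qed.

Lemma measurable_tail_power k :
  measurable_fun setT (fun z : R * R => tail_power k z.2 z.1).
Proof.
apply: measurable_fun_ifT => /=.
- exact: measurable_fun_ltr.
- apply: measurable_funM; last exact: measurable_cst.
  by apply: measurable_funX; apply: measurable_funB.
- exact: measurable_cst.
Qed.

Lemma measurable_tail_power_t k D y : measurable_fun D (tail_power k ^~ y).
Proof.
apply: measurable_funTS.
exact: (measurableT_comp (measurable_tail_power k) (measurable_pair1 y)).
Qed.

Lemma measurable_tail_power_y k D t : measurable_fun D (tail_power k t).
Proof.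
apply: measurable_funTS.
exact: (measurableT_comp (measurable_tail_power k) (measurable_pair2 t)).
Qed.

Lemma ler_dist_itv a b t y : a <= t <= b ->
  `|t - y| <= Num.max `|a - y| `|b - y|.
Proof.
move=> /andP[at_ tb].
have h1 : `|a - y| <= Num.max `|a - y| `|b - y| by rewrite le_max lexx.
have h2 : `|b - y| <= Num.max `|a - y| `|b - y| by rewrite le_max lexx orbT.
have := ler_norm (b - y); have := ler_norm (- (a - y)); rewrite normrN ler_norml.
lra.
Qed.

Section fixed.
Variables (k : nat) (a b : R) (g : R -> R).
Hypothesis ab : a < b.
Hypothesis intg : mu.-integrable `[a, b] (EFin \o g).

Let I := \int[mu]_(t in `[a, b]) `|g t|.

Lemma integrable_tail y :
  mu.-integrable `[a, b] (EFin \o (fun t => g t * tail_power k t y)).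
Proof.
apply: (@integrable_mul _ _ _ _ ((Num.max `|a - y| `|b - y|) ^+ k)) => //.
  exact: measurable_tail_power_t.
move=> t; rewrite /= in_itv/= => tab.
by rewrite ger0_norm ?tail_power_ge0// tail_power_le// ler_dist_itv.
Qed.

Lemma tail_primitive_bound y (M : R) : (forall t, a <= t <= b -> `|t - y| <= M) ->
  `|tail_primitive k a b g y| <= M ^+ k * I.
Proof.
move=> hM; rewrite /tail_primitive (le_trans (le_normr_Rintegral _ (integrable_tail y)))//.
rewrite -RintegralZl//; last exact: integrable_norm.
apply: le_Rintegral => //.
- exact: integrable_norm (integrable_tail y).
- by apply: (@integrableZl _ _ _ mu _ (measurable_itv _) (M ^+ k) (EFin \o (fun t => `|g t|))); exact: integrable_norm.
- move=> t; rewrite /= in_itv/= => tab.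
  rewrite normrM mulrC ler_wpM2r// ger0_norm ?tail_power_ge0// tail_power_le//.
  exact: hM.
Qed.

Lemma tail_primitive_bound_in y : a <= y <= b ->
  `|tail_primitive k a b g y| <= (b - a) ^+ k * I.
Proof.
move=> /andP[ay yb]; apply: tail_primitive_bound => t /andP[at_ tb].
by rewrite ler_norml opprB !lerB.
Qed.

Lemma tail_primitive_right y : b <= y -> tail_primitive k a b g y = 0.
Proof.
move=> by_; rewrite /tail_primitive (@eq_Rintegral _ _ _ _ _ (cst 0)).
  by rewrite Rintegral_cst// mul0r.
move=> t; rewrite inE/= in_itv/= => /andP[_ tb].
by rewrite /tail_power ltNge (le_trans tb by_)/= mulr0.
Qed.

Lemma tail_primitive_left_ge y (l : R) : (forall t, 0 <= g t) -> 0 < l -> y <= a - l ->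
  l ^+ k / k`!%:R * \int[mu]_(t in `[a, b]) g t <= tail_primitive k a b g y.
Proof.
move=> g0 l0 yal; rewrite -RintegralZl//.
apply: le_Rintegral => //.
- exact: (@integrableZl _ _ _ mu _ (measurable_itv _) _ (EFin \o g)).
- exact: integrable_tail.
move=> t; rewrite /= in_itv/= => /andP[at_ tb].
have lty : l <= t - y by lra.
rewrite mulrC ler_wpM2l// /tail_power ifT; last by lra.
by rewrite ler_wpM2r ?invr_ge0// lerXn2r ?nnegrE ?(ltW l0)// (le_trans _ lty)// ltW.
Qed.

Lemma measurable_tail_primitive D : measurable_fun D (tail_primitive k a b g).
Proof.
apply: measurable_funTS.
pose h (z : R * R) := ((g \_ `[a, b]) z.2 * tail_power k z.2 z.1)%:E.
have mg : measurable_fun setT (g \_ `[a, b]).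
  have [+ _] := integrableP _ _ _ intg; move=> /measurable_EFinP mg.
  exact: (iffLR (measurable_restrictT _ (measurable_itv _)) mg).
have mh : measurable_fun setT h.
  apply/measurable_EFinP/measurable_funM; last exact: measurable_tail_power.
  exact: measurableT_comp mg measurable_snd.
have -> : tail_primitive k a b g = fun y => fine ((\int[mu]_t h^\+%E (y, t)) - (\int[mu]_t h^\-%E (y, t)))%E.
  apply/funext => y; rewrite /tail_primitive /Rintegral integral_mkcond integralE.
  congr (fine (_ - _)%E).
    apply: eq_integral => t _; rewrite !funeposE /h/= !patchE.
    by case: ifPn => //; rewrite mul0r.
  apply: eq_integral => t _; rewrite !funenegE /h/= !patchE.
  by case: ifPn => //; rewrite mul0r.
apply: (measurableT_comp (fine_measurable measurableT)) => //.
apply: emeasurable_funB.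
  apply: (@measurable_fun_fubini_tonelli_F _ _ _ _ R mu h^\+%E) => //.
  exact: measurable_funepos.
apply: (@measurable_fun_fubini_tonelli_F _ _ _ _ R mu h^\-%E) => //.
exact: measurable_funeneg.
Qed.

Lemma locally_integrable_tail_primitive : locally_integrable setT (tail_primitive k a b g).
Proof.
split; [exact: measurable_tail_primitive|exact: openT|].
move=> K _ cK; have := compact_bounded cK.
rewrite /bounded_set/= => -[N [_ hN]].
pose M := (`|N| + 1) + Num.max `|a| `|b|.
apply: (@le_lt_trans _ _ (\int[mu]_(x in K) (M ^+ k * I)%:E)%E).
  apply: ge0_le_integral => //.
  - exact: compact_measurable.
  - by apply/measurable_EFinP/measurableT_comp => //; exact: measurable_tail_primitive.
  move=> x Kx; rewrite lee_fin; apply: tail_primitive_bound => t /andP[at_ tb].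
  apply: (le_trans (ler_normB _ _)); rewrite /M addrC lerD//.
    by apply: hN => //; rewrite (le_lt_trans (ler_norm N))// ltrDl.
  by have := @ler_dist_itv a b t 0; rewrite !subr0 at_ tb; exact.
rewrite integral_cst//; last exact: compact_measurable.
rewrite lte_mul_pinfty//; last exact: compact_finite_measure.
rewrite lee_fin mulr_ge0 ?exprn_ge0// /M ?addr_ge0// ?le_max ?normr_ge0//.
by apply: Rintegral_ge0.
Qed.

End fixed.

(** The formula that defines the primitive to the left of a is polynomial there;
it is used on the whole line as the polynomial that finite differences
annihilate. *)
Lemma tail_poly k a b g : a < b -> mu.-integrable `[a, b] (EFin \o g) ->
  exists2 P : {poly R}, (size P <= k.+1)%N &
    forall y, P.[y] = \int[mu]_(t in `[a, b]) (g t * ((t - y) ^+ k / k`!%:R)).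
Proof.
move=> ab intg.
have hpoly (h : R -> R) : mu.-integrable `[a, b] (EFin \o h) ->
    exists2 P : {poly R}, (size P <= k.+1)%N &
    forall y, \int[mu]_(t in `[a, b]) (h t * (t - y) ^+ k) = P.[y].
  elim: k h => [|n IH] h inth.
    exists (\int[mu]_(t in `[a, b]) h t)%:P; first by rewrite size_polyC leq_b1.
    by move=> y; rewrite hornerC; apply: eq_Rintegral => t _; rewrite expr0 mulr1.
  have inth1 : mu.-integrable `[a, b] (EFin \o (fun t => h t * t)).
    apply: (@integrable_mul _ _ _ _ (Num.max `|a| `|b|)) => //.
    move=> t; rewrite /= in_itv/= => tab.
    by have := @ler_dist_itv a b t 0; rewrite !subr0; exact.
  have [P sP hP] := IH _ inth; have [Q sQ hQ] := IH _ inth1.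
  exists (Q - 'X * P).
    rewrite (leq_trans (size_polyD _ _))// geq_max (leq_trans sQ)//= size_polyN.
    by have [->|P0] := eqVneq P 0; rewrite ?mulr0 ?size_poly0// mulrC size_mulX.
  move=> y; rewrite hornerD hornerN hornerM hornerX -hP -hQ.
  have ip (h' : R -> R) : mu.-integrable `[a, b] (EFin \o h') ->
      mu.-integrable `[a, b] (EFin \o (fun t => h' t * (t - y) ^+ n)).
    move=> ih'; apply: (@integrable_mul _ _ _ _ ((Num.max `|a - y| `|b - y|) ^+ n)) => //.
      by apply: measurable_funX; apply: measurable_funB.
    move=> t; rewrite /= in_itv/= => tab.
    by rewrite normrX lerXn2r ?nnegrE ?le_max ?normr_ge0// -le_max ler_dist_itv.
  rewrite -RintegralZl//; last exact: ip.
  rewrite -RintegralB//; [|exact: ip|]; last first.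
    by apply: (@integrableZl _ _ _ mu _ (measurable_itv _) y (EFin \o (fun t => h t * (t - y) ^+ n))); exact: ip.
  by apply: eq_Rintegral => t _; rewrite exprS; ring.
have intgk : mu.-integrable `[a, b] (EFin \o (fun t => g t / k`!%:R)).
  have := @integrableZl _ _ _ mu _ (measurable_itv _) (k`!%:R^-1) _ intg.
  by apply: eq_integrable => // t _ /=; rewrite EFinM muleC.
have [P sP hP] := hpoly _ intgk.
exists P => // y; rewrite -hP; apply: eq_Rintegral => t _; ring.
Qed.

Definition taylor_poly k (t : R) : {poly R} := k`!%:R^-1 *: (t%:P - 'X) ^+ k.

Lemma deriv_taylor_poly k t : (taylor_poly k.+1 t)^`()%R = - taylor_poly k t.
Proof.
rewrite /taylor_poly derivZ deriv_exp derivB derivC derivX sub0r mulN1r mulNrn succnK.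
rewrite -[(_ ^+ k) *+ k.+1]scaler_nat scalerN scalerA; congr (- (_ *: _)).
by rewrite factS natrM invfM -mulrA mulrC -mulrA mulfV ?mulr1// pnatr_eq0.
Qed.

(** Taylor's formula with integral remainder at t, for a function that vanishes
to order k at c: repeated integration by parts. *)
Lemma taylor_poly_test k (c t : R) phi : c < t -> smooth phi ->
  (forall j, (j <= k)%N -> derive1n j phi c = 0) ->
  \int[mu]_(y in `[c, t]) ((taylor_poly k t).[y] * derive1n k.+1 phi y) = phi t.
Proof.
move=> ct sp; have sj n : smooth (derive1n n phi).
  by elim: n => [//|n]; rewrite derive1nS; exact: smooth_derive1.
elim: k => [|k IH] p0.
  rewrite derive1nS horner_by_parts// /taylor_poly expr0 fact0 invr1 scale1r.
  rewrite derivC !hornerC !mul1r (p0 0%N)// subr0 (@eq_Rintegral _ _ _ _ _ (cst 0)).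
    by rewrite Rintegral_cst// mul0r subr0.
  by move=> x _; rewrite horner0 mul0r.
rewrite derive1nS horner_by_parts// deriv_taylor_poly.
rewrite {1}/taylor_poly hornerZ horner_exp !hornerE subrr expr0n/= mulr0 mul0r sub0r.
rewrite -derive1nS p0// mulr0 oppr0 sub0r -IH; last by move=> j jk; rewrite p0// leqW.
transitivity (- \int[mu]_(y in `[c, t]) (-1 * ((taylor_poly k t).[y] * derive1n k.+1 phi y))).
  by congr (- _); apply: eq_Rintegral => y _; rewrite hornerN; ring.
rewrite RintegralZl// ?mulN1r ?opprK//.
apply: continuous_compact_integrable; first exact: segment_compact.
apply: continuous_subspaceT => y; apply: continuousM; first exact: continuous_horner.
exact: (smooth_cts (sj k.+1)).
Qed.

Lemma integrable_tail_test k t c d psi : test_on c d psi ->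
  mu.-integrable setT (EFin \o (fun y => tail_power k t y * psi y)).
Proof.
move=> tp; pose L := Num.max `|c - t| `|d - t|.
have iL : mu.-integrable setT (EFin \o (fun y => L ^+ k * psi y)).
  exact: (@integrableZl _ _ _ mu _ measurableT (L ^+ k) _ (test_on_integrable tp)).
apply: le_integrable iL => //.
  apply/measurable_EFinP/measurable_funM; last exact: test_on_measurable tp.
  exact: measurable_tail_power_y.
move=> y _; rewrite /= lee_fin !normrM.
have [/andP[cy yd]|/(proj2 tp)->] := boolP (c < y < d); last by rewrite normr0 !mulr0.
rewrite ler_wpM2r// ger0_norm ?tail_power_ge0// ger0_norm ?exprn_ge0 ?le_max ?normr_ge0//.
by apply: tail_power_le; rewrite distrC ler_dist_itv// !ltW.
Qed.

(** The function y |-> (t-y)_+^k / k! is the fundamental solution of (-d/dy)^(k+1)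
with pole at t that vanishes to the right of t. *)
Lemma tail_power_test k t M phi : test_on (- M) M phi ->
  (\int[mu]_y (tail_power k t y * derive1n k.+1 phi y)%:E = (phi t)%:E)%E.
Proof.
move=> tp; have tk := test_on_derive1n k.+1 tp.
pose c := Num.min (- M) t - 1.
have cM : c < - M by rewrite ltrBlDr gt_min ltrDl ltr01.
have ct : c < t by rewrite ltrBlDr gt_min ltrDl ltr01 orbT.
have p0 j : derive1n j phi c = 0.
  by apply: (proj2 (test_on_derive1n j tp)); rewrite negb_and -leNgt (ltW cM).
rewrite -(@taylor_poly_test k _ _ _ ct (proj1 tp) (fun j _ => p0 j)).
have ip : mu.-integrable `[c, t] (EFin \o (fun y => (taylor_poly k t).[y] * derive1n k.+1 phi y)).
  exact: (integrable_mul_test _ (integrable_horner _ _ _) tk).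
rewrite /Rintegral fineK; last exact: integrable_fin_num.
rewrite -integral_itv_bndo_bndc; last first.
  by apply/measurable_EFinP; apply: measurable_funM; [exact: measurable_poly|apply: measurable_funS (test_on_measurable tk)].
rewrite [RHS]integral_mkcond; apply: eq_integral => y _; rewrite patchE.
case: ifPn; rewrite ?inE ?notin_setE/= in_itv/=.
  move=> /andP[cy yt]; rewrite /tail_power yt /taylor_poly hornerZ horner_exp !hornerE.
  by rewrite (mulrC _^-1).
move=> /negP; rewrite negb_and -ltNge -leNgt => /orP[yc|ty].
  by rewrite -derive1nS (proj2 tk) ?mulr0// negb_and -leNgt (le_trans (ltW yc) (ltW cM)).
by rewrite /tail_power ltNge ty mul0r.
Qed.

(** Fubini's theorem and [tail_power_test]. *)
Lemma tail_primitive_weak k a b g M phi : a < b ->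
  mu.-integrable `[a, b] (EFin \o g) -> test_on (- M) M phi ->
  (\int[mu]_y (tail_primitive k a b g y * derive1n k.+1 phi y)%:E =
   \int[mu]_(t in `[a, b]) (g t * phi t)%:E)%E.
Proof.
move=> ab intg tp; have := test_on_derive1n k.+1 tp; set psi := derive1n k.+1 phi => tk.
pose G := g \_ `[a, b].
have intG : mu.-integrable setT (EFin \o G).
  by rewrite /G -restrict_EFin; apply/integrable_restrict => //; rewrite setTI.
have mG : measurable_fun setT G by have /integrableP[/measurable_EFinP] := intG.
pose F (z : R * R) := (G z.2 * (tail_power k z.2 z.1 * psi z.1))%:E.
have mF : measurable_fun setT F.
  apply/measurable_EFinP/measurable_funM; first exact: measurableT_comp mG measurable_snd.
  apply: measurable_funM; first exact: measurable_tail_power.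
  exact: measurableT_comp (test_on_measurable tk) measurable_fst.
have iF : (mu \x mu)%E.-integrable setT F.
  apply/integrable21ltyP => //.
  pose L := Num.max `|a| `|b| + `|M|.
  have L0 : 0 <= L by rewrite addr_ge0// le_max normr_ge0.
  have [N0 Nfin] : (0 <= \int[mu]_y `|(psi y)%:E| /\ \int[mu]_y `|(psi y)%:E| < +oo)%E.
    by split; [exact: integral_ge0|have /integrableP[] := test_on_integrable tk].
  set N := (\int[mu]_y `|(psi y)%:E|)%E in N0 Nfin.
  have mabs : measurable_fun setT (fun t => (`|(G t)%:E| * (L ^+ k)%:E)%E).
    by apply: emeasurable_funM => //; apply: measurableT_comp => //; exact/measurable_EFinP.
  apply: (@le_lt_trans _ _ (\int[mu]_t ((`|(G t)%:E| * (L ^+ k)%:E) * N))%E).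
    apply: ge0_le_integral => //.
    - by move=> t _; exact: integral_ge0.
    - apply: (@measurable_fun_fubini_tonelli_G _ _ _ _ R mu (abse \o F)) => //.
      exact: measurableT_comp.
    - by move=> z; exact: abse_ge0.
    - by apply: emeasurable_funM.
    move=> t _; rewrite /N -ge0_integralZl//; last 2 first.
    - by apply: measurableT_comp => //; apply/measurable_EFinP; exact: test_on_measurable tk.
    - by rewrite mule_ge0// lee_fin exprn_ge0.
    apply: ge0_le_integral => //.
    - by apply: measurableT_comp => //; exact: measurableT_comp mF (measurable_pair2 t).
    - apply: emeasurable_funM => //.
      by apply: measurableT_comp => //; apply/measurable_EFinP; exact: test_on_measurable tk.
    move=> y _; rewrite /F /= -!EFinM lee_fin !normrM -mulrA.
    rewrite /G patchE; case: ifPn => [|_]; last by rewrite normr0 !mul0r.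
    rewrite inE/= in_itv/= => tab; rewrite ler_wpM2l//.
    have [/andP[My yM]|/(proj2 tk)->] := boolP (- M < y < M); last by rewrite normr0 !mulr0.
    rewrite ler_wpM2r// ger0_norm ?tail_power_ge0//; apply: tail_power_le.
    rewrite (le_trans (ler_normB _ _))// lerD//.
      by have := @ler_dist_itv a b t 0; rewrite !subr0; exact.
    by rewrite ler_norml (ler_normr _ M) (ltW yM) andbT lerNl (le_trans _ (ler_norm M))// lerNl ltW.
  rewrite ge0_integralZr//; last by move=> t _; rewrite mule_ge0// lee_fin exprn_ge0.
  rewrite lte_mul_pinfty//.
  - by apply: integral_ge0 => t _; rewrite mule_ge0// lee_fin exprn_ge0.
  - have /integrableP[_ Gfin] := intG.
    rewrite ge0_integralZr//; last first.
    + by rewrite lee_fin exprn_ge0.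
    + by apply: measurableT_comp => //; exact/measurable_EFinP.
    by rewrite fin_numM// ge0_fin_numE// integral_ge0.
transitivity (\int[mu]_y \int[mu]_t F (y, t))%E.
  apply: eq_integral => y _; rewrite /tail_primitive /Rintegral EFinM fineK; last first.
    by apply: integrable_fin_num => //; exact: integrable_tail.
  rewrite -integralZr//; last exact: integrable_tail.
  rewrite integral_mkcond; apply: eq_integral => t _; rewrite /F/= /G !patchE.
  by case: ifPn => _; rewrite ?mul0r// -EFinM mulrA.
rewrite Fubini// [RHS]integral_mkcond; apply: eq_integral => t _.
rewrite /F/=; under eq_integral do rewrite EFinM.
rewrite integralZl//; last exact: (integrable_tail_test _ _ tk).
rewrite (tail_power_test _ _ tp) /G !patchE; case: ifPn => //.
by rewrite mul0e.
Qed.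

End antider.

(** * Local Taylor polynomials of weakly differentiable functions *)

Section local_taylor.
Variable R : realType.
Implicit Types (a b : R) (f g u phi psi : R -> R).
Notation mu := (@lebesgue_measure R).

Lemma locally_integrable_itv f a b : locally_integrable setT f ->
  mu.-integrable `[a, b] (EFin \o f).
Proof.
move=> [mf _ fK]; apply/integrableP; split.
  by apply/measurable_EFinP; apply: measurable_funS mf.
by apply: fK => //; exact: segment_compact.
Qed.

Lemma weak_derivative_tail_primitive k a b g : a < b ->
  mu.-integrable `[a, b] (EFin \o g) ->
  is_weak_derivative k.+1 (tail_primitive k a b g)
    (fun x => (-1) ^+ k.+1 * (g \_ `[a, b]) x).
Proof.
move=> ab intg; pose G := g \_ `[a, b].
have intG : mu.-integrable setT (EFin \o G).
  by rewrite /G -restrict_EFin; apply/integrable_restrict => //; rewrite setTI.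
split.
  apply: open_integrable_locally; first exact: openT.
  exact: (@integrableZl _ _ _ mu _ measurableT _ _ intG).
move=> phi tphi; have [M M0 tp] := test_function_test_on tphi.
rewrite (tail_primitive_weak k ab intg tp).
under [in RHS]eq_integral do rewrite -mulrA EFinM.
rewrite integralZl//; last exact: (integrable_mul_test _ intG tp).
rewrite muleA -EFinM -expr2 sqrr_sign mul1e [LHS]integral_mkcond.
apply: eq_integral => t _; rewrite !patchE; case: ifPn => //.
by rewrite mul0r.
Qed.

Lemma Rintegral_EFin (D : set R) f : measurable D ->
  mu.-integrable D (EFin \o f) ->
  (\int[mu]_(x in D) (f x)%:E = (\int[mu]_(x in D) f x)%:E)%E.
Proof. by move=> mD intf; rewrite /Rintegral fineK//; exact: integrable_fin_num. Qed.

Lemma integral_test a b phi f : test_on a b phi ->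
  (\int[mu]_x (f x * phi x)%:E = \int[mu]_(x in `[a, b]) (f x * phi x)%:E)%E.
Proof.
move=> [_ p0]; rewrite [RHS]integral_mkcond; apply: eq_integral => x _.
rewrite patchE; case: ifPn => //; rewrite notin_setE/= in_itv/= => xab.
by rewrite p0 ?mulr0//; apply/negP => /andP[? ?]; apply: xab; rewrite !ltW.
Qed.

(** The primitive J of g has the same weak derivative as f up to the sign, so by
[dubois_reymond] their difference is a polynomial; and J is bounded on [a, b]
by (b-a)^k \int |g|. *)
Lemma weak_derivative_taylor k f g a b : a < b ->
  locally_integrable setT f -> is_weak_derivative k.+1 f g ->
  exists2 P : {poly R}, (size P <= k.+1)%N &
    {ae mu, forall x, a < x < b ->
      `|f x - P.[x]| <= (b - a) ^+ k * \int[mu]_(t in `[a, b]) `|g t|}.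
Proof.
move=> ab lf [lg wg].
have intf := locally_integrable_itv a b lf.
have intg := locally_integrable_itv a b lg.
pose J := tail_primitive k a b g; pose s : R := (-1) ^+ k.+1.
have intJ : mu.-integrable `[a, b] (EFin \o J).
  by apply: locally_integrable_itv; exact: locally_integrable_tail_primitive.
have intsJ : mu.-integrable `[a, b] (EFin \o (fun x => s * J x)).
  exact: (@integrableZl _ _ _ mu _ (measurable_itv _) s _ intJ).
have [||P sP hP] := @dubois_reymond R k.+1 a b (fun x => f x - s * J x) ab.
- exact: (@integrableB _ _ _ mu _ (measurable_itv _) _ _ intf intsJ).
- move=> phi tp; have tphi := test_on_test_function tp.
  have tk := test_on_derive1n k.+1 tp.
  have [M M0 tpM] := test_function_test_on tphi.
  have h1 := wg _ tphi; rewrite (integral_test _ tk) (integral_test _ tp) in h1.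
  have h2 := tail_primitive_weak k ab intg tpM; rewrite (integral_test _ tk) in h2.
  rewrite -h2 in h1.
  under eq_Rintegral do rewrite mulrBl -mulrA.
  have iJ := integrable_mul_test (measurable_itv _) intJ tk.
  rewrite RintegralB//; last 2 first.
  + exact: (integrable_mul_test _ intf tk).
  + exact: (@integrableZl _ _ _ mu _ (measurable_itv _) s _ iJ).
  rewrite RintegralZl//; apply/eqP; rewrite subr_eq0; apply/eqP.
  move: h1; rewrite !Rintegral_EFin//; last exact: (integrable_mul_test _ intf tk).
  by rewrite -EFinM => -[].
exists P => //; apply: ae_imp hP => x hx xab; rewrite -hx// opprB addrC subrK.
rewrite normrM normrX normrN1 expr1n mul1r; apply: tail_primitive_bound_in => //.
by case/andP: xab => ax xb; rewrite !ltW.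
Qed.

End local_taylor.

(** * Near-optimality of the moment projection *)

Section hilbert.
Variable R : realFieldType.

(** The Gram matrix of 1, x, ..., x^(k-1) in L^2(0, 1); its invertibility gives
existence of the moment projection and a bound on it. *)
Definition hilbert_mx k : 'M[R]_k := \matrix_(i, j) (i + j).+1%N%:R^-1.

(** If v is in the kernel, the rational function \sum_i v_i / (x + i + 1) vanishes
at x = 0, ..., k-1.  Its numerator N has degree less than k, so N = 0, and
evaluating N at -(i+1) isolates v_i. *)
Lemma hilbert_mx_unit k : hilbert_mx k \in unitmx.
Proof.
rewrite -row_free_unit -kermx_eq0; apply/rowV0P => v /sub_kermxP vH.
have vj (j : 'I_k) : \sum_(i < k) v 0 i / (i + j).+1%N%:R = 0.
  have := congr1 (fun M : 'rV_k => M 0 j) vH; rewrite !mxE => e; rewrite -[RHS]e.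
  by apply: eq_bigr => i _; rewrite mxE.
(* The numerator of the rational function, over the common denominator. *)
pose c (i : 'I_k) : {poly R} := \prod_(l < k | l != i) ('X + l.+1%:R%:P).
pose N : {poly R} := \sum_(i < k) v 0 i *: c i.
have sc i : (size (c i) <= k)%N.
  rewrite /c size_prod; last by move=> l _; rewrite -size_poly_eq0 size_XaddC.
  rewrite (eq_bigr (fun=> 2)); last by move=> l _; rewrite size_XaddC.
  rewrite sum_nat_const cardC1 card_ord muln2 -addnn -addSn addnK.
  by rewrite prednK// (leq_ltn_trans _ (ltn_ord i)).
have N0 : N = 0.
  apply: (@roots_geq_poly_eq0 R N [seq (nat_of_ord j)%:R | j <- enum 'I_k]).
  - apply/allP => _ /mapP[j _ ->]; rewrite /root /N horner_sum.
    transitivity ((\prod_(l < k) ((j : nat)%:R + l.+1%:R : R)) * \sum_(i < k) v 0 i / (i + j).+1%N%:R == 0); last first.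
      by rewrite vj mulr0 eqxx.
    congr (_ == _); rewrite mulr_sumr; apply: eq_bigr => i _.
    rewrite hornerZ /c horner_prod [in RHS](bigD1 i)//=.
    rewrite (_ : (i + j).+1%N%:R = (j : nat)%:R + i.+1%:R); last by rewrite -natrD addnS addnC.
    have ij0 : (j : nat)%:R + i.+1%:R != 0 :> R by rewrite -natrD addnS pnatr_eq0.
    rewrite mulrCA [X in _ = _ * X]mulrAC mulfV// mul1r; congr (_ * _).
    by apply: eq_bigr => l _; rewrite hornerD hornerX hornerC.
  - rewrite map_inj_uniq ?enum_uniq// => x y /eqP; rewrite eqr_nat => /eqP xy.
    exact: val_inj.
  - rewrite size_map size_enum_ord (leq_trans (size_sum _ _ _))//.
    by apply/bigmax_leqP => i _; rewrite (leq_trans (size_scale_leq _ _)).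
apply/rowP => i; rewrite mxE.
have := congr1 (fun p : {poly R} => p.[- i.+1%:R]) N0.
rewrite horner0 /N horner_sum (bigD1 i)//= big1 => [|l li]; last first.
  rewrite hornerZ /c horner_prod (bigD1 i)//=; last by rewrite eq_sym.
  by rewrite hornerD hornerX hornerC addNr mul0r mulr0.
rewrite addr0 hornerZ => /eqP; rewrite mulf_eq0 => /orP[/eqP//|].
rewrite /c horner_prod prodf_seq_eq0 => /hasP[l _ /andP[li]].
rewrite hornerD hornerX hornerC addrC subr_eq0 eqr_nat eqSS => /eqP il.
by move: li; rewrite -val_eqE/= il eqxx.
Qed.

End hilbert.

Section projection.
Variable R : realType.
Implicit Types (c l : R) (e f : R -> R).
Notation mu := (@lebesgue_measure R).

Lemma integrable_mul_horner (D : set R) c d e (P : {poly R}) :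
  measurable D -> D `<=` `[c, d] -> mu.-integrable D (EFin \o e) ->
  mu.-integrable D (EFin \o (fun x => e x * P.[x])).
Proof.
move=> mD Dcd inte; have [dc|cd] := ltP d c.
  suff -> : D = set0 by exact: integrable_set0.
  apply/seteqP; split=> // x /Dcd /=; rewrite in_itv/= => /andP[cx xd].
  by move: (lt_le_trans dc cx); rewrite ltNge xd.
have cP : {within `[c, d], continuous (fun x => `|P.[x]|)}.
  apply: continuous_subspaceT => x; apply: continuous_comp; first exact: continuous_horner.
  exact: norm_continuous.
have [z _ zM] := EVT_max cd cP.
apply: (@integrable_mul _ _ _ _ `|P.[z]|) => //; first exact: measurable_poly.
by move=> x Dx; apply: zM; exact: Dcd.
Qed.

Lemma Rintegral_lincomb (D : set R) c d e k (t : nat -> R) (B : nat -> {poly R}) :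
  measurable D -> D `<=` `[c, d] -> mu.-integrable D (EFin \o e) ->
  \int[mu]_(x in D) (e x * (\sum_(i < k) t i *: B i).[x]) =
  \sum_(i < k) t i * \int[mu]_(x in D) (e x * (B i).[x]).
Proof.
move=> mD Dcd inte; elim: k => [|k IH].
  rewrite !big_ord0 (@eq_Rintegral _ _ _ _ _ (cst 0)).
    by rewrite Rintegral_cst// mul0r.
  by move=> x _; rewrite horner0 mulr0.
have iB P := integrable_mul_horner P mD Dcd inte.
rewrite !big_ord_recr/= -IH -RintegralZl//.
rewrite -RintegralD//; last exact: (@integrableZl _ _ _ mu _ mD (t k) _ (iB (B k))).
by apply: eq_Rintegral => x _; rewrite hornerD hornerZ mulrDr mulrCA.
Qed.

(** The affine coordinate that maps [c, c+l[ onto [0, 1[: moments in it do not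
depend on the interval. *)
Definition local_coord c l : {poly R} := l^-1 *: ('X - c%:P).

Lemma local_coordE c l x : (local_coord c l).[x] = (x - c) / l.
Proof. by rewrite hornerZ !hornerE mulrC. Qed.

Lemma poly_local_coord c l k (T : {poly R}) : l != 0 -> (size T <= k)%N ->
  T = \sum_(i < k) (T \Po (l *: 'X + c%:P))`_i *: local_coord c l ^+ i.
Proof.
move=> l0 sT; set S := _ + c%:P.
have sTS : (size (T \Po S) <= k)%N.
  have [->|T0] := eqVneq T 0; first by rewrite comp_poly0 size_poly0.
  apply: leq_trans sT; apply: leq_trans (size_comp_poly_leq _ _) _.
  have : (size S <= 2)%N.
    rewrite (leq_trans (size_polyD _ _))// geq_max (leq_trans (size_scale_leq _ _)) ?size_polyX//=.
    by rewrite size_polyC (leq_trans (leq_b1 _)).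
  have sT0 : (0 < size T)%N by rewrite lt0n size_poly_eq0.
  move: (size S) => [|[|[|n]]]//= _; last by rewrite muln1 prednK.
  - by rewrite muln0.
  - by rewrite muln0.
have <- : (T \Po S) \Po local_coord c l = T.
  rewrite -comp_polyA /S comp_polyD comp_polyZ comp_polyX comp_polyC.
  by rewrite /local_coord scalerA mulfV// scale1r subrK comp_polyXr.
have e : ((T \Po S) \Po local_coord c l) \Po S = T \Po S.
  rewrite -comp_polyA /local_coord comp_polyZ comp_polyB comp_polyX comp_polyC /S.
  by rewrite addrK scalerA mulVf// scale1r comp_polyXr.
rewrite e [LHS]comp_polyE.
rewrite (big_ord_widen k (fun i => (T \Po S)`_i *: local_coord c l ^+ i) sTS).
rewrite big_mkcond/=; apply: eq_bigr => i _; case: ifPn => //.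
by rewrite -leqNgt => /(nth_default 0)->; rewrite scale0r.
Qed.

Lemma local_coord_moment c l n : 0 < l ->
  \int[mu]_(x in `[c, c + l[) (local_coord c l ^+ n).[x] = l / n.+1%:R.
Proof.
move=> l0; have cl : c < c + l by rewrite ltrDl.
have ip : mu.-integrable `[c, c + l] (EFin \o horner (local_coord c l ^+ n)).
  exact: integrable_horner.
rewrite Rintegral_itv_bndo_bndc; last first.
  by apply: integrableS ip => //; apply: subset_itv_co_cc.
pose A : {poly R} := (l / n.+1%:R) *: local_coord c l ^+ n.+1.
have dA : A^`()%R = local_coord c l ^+ n.
  rewrite /A derivZ deriv_exp /local_coord derivZ derivB derivX derivC subr0 succnK.
  rewrite -scalerAl mul1r -[(_ *: _) *+ n.+1]scaler_nat !scalerA -[RHS]scale1r.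
  congr (_ *: _).
  have l1 : l != 0 by rewrite gt_eqF.
  have : n.+1%:R != 0 :> R by rewrite pnatr_eq0.
  by move: (n.+1%:R : R) => N N0; field; rewrite l1 N0.
rewrite /Rintegral (@continuous_FTC2 R _ (horner A))//.
- by rewrite /= /A !hornerZ !horner_exp !local_coordE subrr mul0r expr0n/= mulr0 subr0 addrC addKr mulfV ?gt_eqF// expr1n mulr1.
- by apply: continuous_subspaceT; exact: continuous_horner.
- split.
  + by move=> x _; exact: derivable_horner.
  + by apply: cvg_at_right_filter; exact: continuous_horner.
  + by apply: cvg_at_left_filter; exact: continuous_horner.
- by move=> x _; rewrite -derivE dA.
Qed.

Lemma ae_and (P Q : R -> Prop) : {ae mu, forall x, P x} ->
  {ae mu, forall x, Q x} -> {ae mu, forall x, P x /\ Q x}.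
Proof. exact: (@filterI _ _ (ae_filter_ringOfSetsType mu)). Qed.

Lemma ae_neq (c : R) : {ae mu, forall x : R, x != c}.
Proof.
exists [set c]; split; [exact: measurable_set1|exact: lebesgue_measure_set1|].
by move=> x /= /negP; rewrite negbK => /eqP.
Qed.

Lemma ae_co c d (P : R -> Prop) : {ae mu, forall x, c < x < d -> P x} ->
  {ae mu, forall x, `[c, d[%classic x -> P x}.
Proof.
move=> h; apply: ae_imp (ae_and h (ae_neq c)) => x [hx xc] /=.
rewrite in_itv/= => /andP[cx xd]; apply: hx.
by rewrite lt_neqAle eq_sym xc cx.
Qed.

Lemma integral_ae_bound c l (e : R -> R) A : 0 < l -> 0 <= A ->
  measurable_fun `[c, c + l[ e ->
  {ae mu, forall x, `[c, c + l[%classic x -> `|e x| <= A} ->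
  (\int[mu]_(x in `[c, (c + l)%R[) `|(e x)%:E| <= (A * l)%:E)%E.
Proof.
move=> l0 A0 me eA.
apply: (@le_trans _ _ (\int[mu]_(x in `[c, (c + l)%R[) A%:E)%E).
  apply: ae_ge0_le_integral => //.
  by apply: measurableT_comp => //; exact/measurable_EFinP.
rewrite integral_cst//= EFinM lebesgue_measure_itv/= lte_fin ltrDl l0.
by rewrite -EFinB addrAC subrr add0r.
Qed.

Lemma Rintegral_ae_bound c l e A : 0 < l -> 0 <= A ->
  mu.-integrable `[c, c + l[ (EFin \o e) ->
  {ae mu, forall x, `[c, c + l[%classic x -> `|e x| <= A} ->
  `|\int[mu]_(x in `[c, c + l[) e x| <= A * l.
Proof.
move=> l0 A0 ie eA; apply: le_trans (le_normr_Rintegral _ ie) _ => //.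
rewrite -lee_fin -Rintegral_EFin//; last exact: integrable_norm.
apply: le_trans (integral_ae_bound l0 A0 _ eA) => //.
by have /integrableP[/measurable_EFinP] := ie.
Qed.

Lemma local_coord_le1 c l n x : 0 < l -> `[c, c + l[%classic x ->
  `|(local_coord c l ^+ n).[x]| <= 1.
Proof.
move=> l0; rewrite /= in_itv/= => /andP[cx xl].
rewrite horner_exp local_coordE normrX exprn_ile1// ger0_norm ?divr_ge0 ?(ltW l0) ?subr_ge0//.
by rewrite ler_pdivrMr// mul1r lerBlDl ltW.
Qed.

Lemma moment_lincomb c l k (t : nat -> R) j : 0 < l ->
  \int[mu]_(x in `[c, c + l[) ((\sum_(i < k) t i *: local_coord c l ^+ i).[x] * (local_coord c l ^+ j).[x]) =
  l * \sum_(i < k) t i / (i + j).+1%N%:R.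
Proof.
move=> l0.
have i1 : mu.-integrable `[c, c + l[ (EFin \o (cst 1 : R -> R)).
  apply: (@integrableS _ _ _ mu `[c, c + l]%classic) => //; first exact: subset_itv_co_cc.
  by apply: eq_integrable (integrable_horner c (c + l) 1%:P) => // x _ /=; rewrite hornerC.
have := @Rintegral_lincomb _ c (c + l) _ k t (fun i => local_coord c l ^+ (i + j)) (measurable_itv _) (@subset_itv_co_cc _ _ _ _) i1.
rewrite (eq_bigr (fun i : 'I_k => l * (t i / (i + j).+1%N%:R))); last first.
  move=> i _; under eq_Rintegral do rewrite mul1r.
  by rewrite local_coord_moment// mulrCA.
rewrite -mulr_sumr => <-; apply: eq_Rintegral => x _.
rewrite -hornerM mul1r; congr (_.[x]).
by rewrite mulr_suml; apply: eq_bigr => i _; rewrite -scalerAl exprD.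
Qed.

Lemma moment_span c l k (e : R -> R) (B : nat -> {poly R}) (T : {poly R}) (t : nat -> R) :
  mu.-integrable `[c, c + l[ (EFin \o e) ->
  (forall j, (j < k)%N -> \int[mu]_(x in `[c, c + l[) (e x * (B j).[x]) = 0) ->
  T = \sum_(i < k) t i *: B i ->
  \int[mu]_(x in `[c, c + l[) (e x * T.[x]) = 0.
Proof.
move=> ie Bj ->; rewrite (Rintegral_lincomb _ _ _ (measurable_itv _) (@subset_itv_co_cc _ _ _ _) ie).
by rewrite big1// => i _; rewrite Bj ?mulr0.
Qed.

Lemma is_poly_projectionP c l k f P : 0 < l -> mu.-integrable `[c, c + l[ (EFin \o f) ->
  is_poly_projection k `[c, c + l[ f P <->
  (size P <= k)%N /\ forall j, (j < k)%N ->
    \int[mu]_(x in `[c, c + l[) ((f x - P.[x]) * (local_coord c l ^+ j).[x]) = 0.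
Proof.
move=> l0 intf.
have intP : mu.-integrable `[c, c + l[ (EFin \o horner P).
  apply: (@integrableS _ _ _ mu `[c, c + l]%classic) => //; first exact: subset_itv_co_cc.
  exact: integrable_horner.
have ie : mu.-integrable `[c, c + l[ (EFin \o (fun x => f x - P.[x])).
  exact: (@integrableB _ _ _ mu _ (measurable_itv _) _ _ intf intP).
have ieT T := integrable_mul_horner T (measurable_itv _) (@subset_itv_co_cc _ _ _ _) ie.
split=> -[sP h]; split=> // j jk.
  apply: (@moment_span _ _ k _ (fun i => 'X^i) _ (fun i => (local_coord c l ^+ j)`_i)) => //.
    move=> i ik; have /= := h i ik.
    under eq_integral do rewrite -[X in _ * X]hornerXn.
    by rewrite (Rintegral_EFin (measurable_itv _) (ieT 'X^i)) => -[].
  have : (size (local_coord c l ^+ j) <= k)%N.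
    rewrite (leq_trans _ jk)// (leq_trans (size_exp_leq _ _))// ltnS.
    rewrite -[leqRHS]mul1n leq_mul2r; apply/orP; right.
    have : (size (local_coord c l) <= 2)%N.
      by rewrite (leq_trans (size_scale_leq _ _))// size_XsubC.
    by case: size.
  move=> sk; rewrite -poly_def; apply/polyP => i; rewrite coef_poly.
  by case: ltnP => // ki; rewrite nth_default// (leq_trans sk).
have -> : (fun x => ((f x - P.[x]) * x ^+ j)%:E) = (fun x => ((f x - P.[x]) * ('X^j).[x])%:E).
  by apply/funext => x; rewrite hornerXn.
rewrite (Rintegral_EFin (measurable_itv _) (ieT 'X^j)); congr EFin.
apply: (moment_span ie h); apply: poly_local_coord; first by rewrite gt_eqF.
by rewrite size_polyXn.
Qed.

Lemma poly_projection_spec c l k f : 0 < l -> mu.-integrable `[c, c + l[ (EFin \o f) ->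
  is_poly_projection k `[c, c + l[ f (poly_projection k `[c, c + l[ f).
Proof.
move=> l0 intf; rewrite /poly_projection; apply: xgetPex.
pose m : 'rV[R]_k := \row_j \int[mu]_(x in `[c, c + l[) (f x * (local_coord c l ^+ j).[x]).
(* The moments m of f determine the coefficients a of the projection. *)
pose a : 'rV[R]_k := l^-1 *: (m *m invmx (hilbert_mx R k)).
pose t (i : nat) : R := if insub i is Some i' then a 0 i' else 0.
have tE (i : 'I_k) : t i = a 0 i by rewrite /t valK.
pose P : {poly R} := \sum_(i < k) t i *: local_coord c l ^+ i.
have sP : (size P <= k)%N.
  rewrite (leq_trans (size_sum _ _ _))//; apply/bigmax_leqP => i _.
  rewrite (leq_trans (size_scale_leq _ _))// (leq_trans (size_exp_leq _ _))//.
  rewrite (leq_ltn_trans _ (ltn_ord i))// -[leqRHS]mul1n leq_mul2r; apply/orP; right.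
  have : (size (local_coord c l) <= 2)%N.
    by rewrite (leq_trans (size_scale_leq _ _))// size_XsubC.
  by case: size.
exists P; apply/is_poly_projectionP => //; split=> // j jk.
have intP : mu.-integrable `[c, c + l[ (EFin \o horner P).
  apply: (@integrableS _ _ _ mu `[c, c + l]%classic) => //; first exact: subset_itv_co_cc.
  exact: integrable_horner.
under eq_Rintegral do rewrite mulrBl.
rewrite RintegralB//; last 2 first.
- exact: (integrable_mul_horner _ (measurable_itv _) (@subset_itv_co_cc _ _ _ _) intf).
- exact: (integrable_mul_horner _ (measurable_itv _) (@subset_itv_co_cc _ _ _ _) intP).
rewrite moment_lincomb//; apply/eqP; rewrite subr_eq0; apply/eqP.
have aH : l *: (a *m hilbert_mx R k) = m.
  by rewrite -scalemxAl scalerA mulfV ?gt_eqF// scale1r mulmxKV// hilbert_mx_unit.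
have aHj : m 0 (Ordinal jk) = l * \sum_i a 0 i * hilbert_mx R k i (Ordinal jk).
  by rewrite -aH [LHS]mxE [X in _ * X]mxE.
transitivity (m 0 (Ordinal jk)); first by rewrite [RHS]mxE.
rewrite aHj; congr (_ * _); apply: eq_bigr => i _; rewrite tE.
by congr (_ * _); rewrite [LHS]mxE.
Qed.

(** The moment projection is a quasi-best approximation in L^1: the coefficients
of P - P0 in the local coordinate are the image under the inverse Hilbert matrix
of the moments of f - P0, so |P - P0| is at most a constant times A with a
constant that does not depend on the interval. *)
Lemma poly_error_le k : exists2 C : R, 0 < C & forall (c l : R) (f : R -> R) (P0 : {poly R}) (A : R), 0 < l -> 0 <= A ->
  mu.-integrable `[c, c + l[ (EFin \o f) -> (size P0 <= k)%N ->
  {ae mu, forall x, c < x < c + l -> `|f x - P0.[x]| <= A} ->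
  (poly_error k f `[c, (c + l)%R[ <= (C * A * l)%:E)%E.
Proof.
pose C0 : R := \sum_(i < k) \sum_(j < k) `|invmx (hilbert_mx R k) j i|.
have C00 : 0 <= C0 by apply: sumr_ge0 => i _; apply: sumr_ge0.
exists (1 + C0); first by rewrite ltr_pwDl.
move=> c l f P0 A l0 A0 intf sP0 fA.
have [sP hP] := iffLR (is_poly_projectionP _ _ l0 intf) (@poly_projection_spec c l k f l0 intf).
move: sP hP; rewrite /poly_error; set P := poly_projection _ _ _ => sP hP.
have iH T : mu.-integrable `[c, c + l[ (EFin \o horner T).
  apply: (@integrableS _ _ _ mu `[c, c + l]%classic) => //; first exact: subset_itv_co_cc.
  exact: integrable_horner.
have iB T : mu.-integrable `[c, c + l[ (EFin \o (fun x => f x - T.[x])).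
  exact: (@integrableB _ _ _ mu _ (measurable_itv _) _ _ intf (iH T)).
have iM e T := @integrable_mul_horner _ c (c + l) e T (measurable_itv _) (@subset_itv_co_cc _ _ _ _).
have fA' := ae_co fA.
pose t := fun i => ((P - P0) \Po (l *: 'X + c%:P))`_i.
have sD : (size (P - P0)%R <= k)%N.
  by rewrite (leq_trans (size_polyD _ _))// geq_max size_polyN sP.
have D_E : P - P0 = \sum_(i < k) t i *: local_coord c l ^+ i.
  by apply: poly_local_coord => //; rewrite gt_eqF.
pose m : 'rV[R]_k := \row_j \int[mu]_(x in `[c, c + l[) ((f x - P0.[x]) * (local_coord c l ^+ j).[x]).
have mE : l *: ((\row_i t i) *m hilbert_mx R k) = m.
  apply/rowP => j; rewrite !mxE.
  transitivity (l * \sum_(i < k) t i / (i + j).+1%N%:R).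
    by congr (_ * _); apply: eq_bigr => i _; rewrite !mxE.
  rewrite -(@moment_lincomb c)// -D_E -[LHS]add0r -(hP _ (ltn_ord j)).
  rewrite -RintegralD//; [|exact: iM|by apply: iM; exact: iH].
  by apply: eq_Rintegral => x _; rewrite !hornerE; ring.
have mj j : `|m 0 j| <= A * l.
  rewrite mxE; apply: Rintegral_ae_bound => //; first exact: iM.
  apply: ae_imp fA' => x h Qx; rewrite normrM -[leRHS]mulr1.
  by rewrite ler_pM//; [exact: h|exact: local_coord_le1].
have tj (i : 'I_k) : `|t i| <= A * \sum_(j < k) `|invmx (hilbert_mx R k) j i|.
  have -> : t i = l^-1 * \sum_(j < k) m 0 j * invmx (hilbert_mx R k) j i.
    have := congr1 (fun M => (l^-1 *: (M *m invmx (hilbert_mx R k))) 0 i) mE.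
    by rewrite -scalemxAl mulmxK ?hilbert_mx_unit// scalerA mulVf ?gt_eqF// scale1r !mxE.
  rewrite normrM gtr0_norm ?invr_gt0// ler_pdivrMl// mulrA [l * A]mulrC mulr_sumr.
  apply: le_trans (ler_norm_sum _ _ _) _; apply: ler_sum => j _.
  by rewrite normrM ler_wpM2r.
have fP : {ae mu, forall x, `[c, c + l[%classic x -> `|f x - P.[x]| <= (1 + C0) * A}.
  apply: ae_imp fA' => x h Qx.
  have -> : f x - P.[x] = (f x - P0.[x]) - (P - P0).[x] by rewrite !hornerE; ring.
  rewrite (le_trans (ler_normB _ _))// mulrDl mul1r lerD ?h//.
  rewrite D_E horner_sum (le_trans (ler_norm_sum _ _ _))// /C0 mulr_suml.
  apply: ler_sum => i _; rewrite hornerZ normrM mulrC -[leRHS]mul1r ler_pM//.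
    exact: local_coord_le1.
  by rewrite mulrC.
apply: integral_ae_bound => //; first by rewrite mulr_ge0// addr_ge0.
by have /integrableP[/measurable_EFinP] := iB P.
Qed.

End projection.

(** * Shifted dyadic intervals *)

Section dyadic_grid.
Variable R : realType.
Implicit Types (alpha : R) (j m n : int).
Notation mu := (@lebesgue_measure R).

Definition grid alpha j m : R := 2 ^ j * (m%:~R + (-1) ^ j * alpha).

Definition dyadic_itv alpha (i : int * int) : set R :=
  `[grid alpha i.1 i.2, grid alpha i.1 (i.2 + 1)[%classic.

Lemma grid_succ alpha j m : grid alpha j (m + 1) = grid alpha j m + 2 ^ j.
Proof. by rewrite /grid intrD; ring. Qed.

Lemma exprz2_gt0 j : 0 < (2 : R) ^ j.
Proof. by rewrite exprz_gt0. Qed.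

Lemma dyadic_itvE alpha j m :
  dyadic_itv alpha (j, m) = `[grid alpha j m, grid alpha j m + 2 ^ j[%classic.
Proof. by rewrite /dyadic_itv/= grid_succ. Qed.

Lemma dyadicP alpha (Q : set R) :
  dyadic alpha Q <-> exists i, Q = dyadic_itv alpha i.
Proof.
have E j m : [set (2 ^ j * (m%:~R + t + (-1) ^ j * alpha))%R | t in `[0%R, 1%R[] =
    dyadic_itv alpha (j, m).
  rewrite dyadic_itvE; apply/seteqP; split=> x /=.
    move=> [t]; rewrite /= !in_itv/= => /andP[t0 t1] <-.
    have u0 := exprz2_gt0 j.
    have ut0 : 0 <= 2 ^ j * t by rewrite mulr_ge0// ltW.
    have ut1 : 2 ^ j * t < 2 ^ j by rewrite gtr_pMr.
    have -> : 2 ^ j * (m%:~R + t + (-1) ^ j * alpha) = grid alpha j m + 2 ^ j * t.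
      by rewrite /grid; ring.
    by rewrite lerDl ltrD2l ut0.
  rewrite in_itv/= => /andP[h1 h2].
  exists ((x - grid alpha j m) / 2 ^ j).
    rewrite /= in_itv/= divr_ge0 ?subr_ge0 ?(ltW (exprz2_gt0 _))//=.
    by rewrite ltr_pdivrMr ?exprz2_gt0// mul1r ltrBlDl.
  have := exprz2_gt0 j; rewrite /grid; move: (2 ^ j : R) ((-1) ^ j : R) => u w u0.
  by field; rewrite gt_eqF.
split=> [[j [m ->]]|[[j m] ->]]; first by exists (j, m).
by exists j, m.
Qed.

Lemma measurable_dyadic_itv alpha i : measurable (dyadic_itv alpha i).
Proof. exact: measurable_itv. Qed.

Lemma len_dyadic_itv alpha i : len (dyadic_itv alpha i) = 2 ^ i.1.
Proof.
case: i => j m; rewrite dyadic_itvE /len lebesgue_measure_itv/= lte_fin ltrDl exprz2_gt0.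
by rewrite -EFinB/= addrAC subrr add0r.
Qed.

(** The alternating sign makes the grids nested: passing from level j+1 to level j
changes the offset by 2^j times 3 alpha, an integer multiple of the step. *)
Lemma grid_coarsen alpha j (d : nat) m : alpha *+ 3 \is a Num.int ->
  exists n, grid alpha (j + d%:Z) m = grid alpha j n.
Proof.
move=> /intrP[z az]; elim: d m => [|d IH] m; first by exists m; rewrite addr0.
suff [n e] : exists n, grid alpha (j + d.+1%:Z) m = grid alpha (j + d%:Z) n.
  by have [n' e'] := IH n; exists n'; rewrite e.
rewrite -[d.+1]addn1 PoszD addrA; move: (j + d%:Z) => i.
exists (2 * m - (-1) ^ i * z); rewrite /grid.
have -> : (2 : R) ^ (i + 1) = 2 ^ i * 2 by rewrite expfzDr ?expr1z// pnatr_eq0.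
have -> : (-1 : R) ^ (i + 1) = - (-1) ^ i by rewrite expfzDr ?expr1z ?mulrN1// oppr_eq0 oner_eq0.
have -> : ((2 * m - (-1) ^ i * z)%:~R : R) = 2 * m%:~R - (-1) ^ i * (alpha *+ 3).
  rewrite az intrB !intrM; congr (_ - _ * _).
  by rewrite -[LHS]/(intr _) rmorphXz/= ?rmorphN1// unitrN1.
by ring.
Qed.

Lemma ler_grid alpha j m n : (grid alpha j m <= grid alpha j n) = (m <= n).
Proof. by rewrite /grid ler_pM2l ?exprz2_gt0// lerD2r ler_int. Qed.

Lemma ltr_grid alpha j m n : (grid alpha j m < grid alpha j n) = (m < n).
Proof. by rewrite /grid ltr_pM2l ?exprz2_gt0// ltrD2r ltr_int. Qed.

Lemma dyadic_itv_sub alpha i i' x : alpha *+ 3 \is a Num.int -> i.1 <= i'.1 ->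
  dyadic_itv alpha i x -> dyadic_itv alpha i' x ->
  dyadic_itv alpha i `<=` dyadic_itv alpha i'.
Proof.
case: i i' => [j m] [j' m'] a3 /= jj'.
have [d jd] : exists d : nat, j' = j + d%:Z.
  by exists `|j' - j|%N; rewrite gez0_abs ?subr_ge0// subrKC.
rewrite jd; have [n en] := grid_coarsen j d m' a3; have [n' en'] := grid_coarsen j d (m' + 1) a3.
rewrite /dyadic_itv /= {}en {}en' !in_itv/= => /andP[mx xm] /andP[nx xn].
have nm : n <= m by rewrite -ltzD1 -(ltr_grid alpha j) (le_lt_trans nx).
have mn : m + 1 <= n' by rewrite lezD1 -(ltr_grid alpha j) (le_lt_trans mx).
move=> y /=; rewrite !in_itv/= => /andP[my ym].
by rewrite (le_trans _ my) ?ler_grid// (lt_le_trans ym) ?ler_grid.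
Qed.

Lemma dyadic_itv_level alpha i i' x : i.1 = i'.1 ->
  dyadic_itv alpha i x -> dyadic_itv alpha i' x -> i = i'.
Proof.
case: i i' => [j m] [_ n] /= <-; rewrite /dyadic_itv/= !in_itv/=.
move=> /andP[mx xm] /andP[nx xn]; congr pair; apply/eqP; rewrite eq_le.
by rewrite -!ltzD1 -!(ltr_grid alpha j) (le_lt_trans mx xn) (le_lt_trans nx xm).
Qed.

Lemma exprz2_floor (x : R) : 0 < x -> exists j : int, 2 ^ j <= x < 2 ^ (j + 1).
Proof.
move=> x0; exists (Num.floor (ln x / ln 2)).
have l2 : 0 < ln (2 : R) by rewrite ln_gt0// ltr1n.
have E (j : int) : (2 : R) ^ j = expR (j%:~R * ln 2).
  by rewrite -powR_intmul// /powR pnatr_eq0.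
have /andP[h1 h2] := floor_itv (ln x / ln 2).
have xE : x = expR (ln x) by rewrite lnK.
by rewrite !E [X in _ <= X < _]xE ler_expR ltr_expR -ler_pdivlMr// -ltr_pdivrMr// h1.
Qed.

Lemma floor_grid alpha j (x : R) :
  exists m, grid alpha j m <= x < grid alpha j (m + 1).
Proof.
exists (Num.floor (x / 2 ^ j - (-1) ^ j * alpha)).
set y := x / 2 ^ j - _.
have -> : x = 2 ^ j * (y + (-1) ^ j * alpha).
  by rewrite /y subrK mulrC divfK// gt_eqF// exprz2_gt0.
rewrite /grid ler_pM2l ?exprz2_gt0// ltr_pM2l ?exprz2_gt0// lerD2r ltrD2r.
by rewrite floor_itv ?num_real.
Qed.

Lemma int_gap (z : int) : 0 < z -> z < 1 -> False.
Proof. lia. Qed.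

(** Two points of the grids of parameters 0 and 1/3 at the same level j are at
distance at least 2^j / 3.  An interval shorter than that cannot contain points
of both, so it lies in a single cell of one of the grids. *)
Lemma dyadic_cover (a b : R) : a < b -> exists alpha (i : int * int),
  [/\ alpha = 0 \/ alpha = 1 / 3, `[a, b] `<=` dyadic_itv alpha i,
      3 * (b - a) < 2 ^ i.1 & 2 ^ i.1 <= 6 * (b - a)].
Proof.
move=> ab; have ba : 0 < 6 * (b - a) by rewrite mulr_gt0// subr_gt0.
have [j /andP[j1 j2]] := exprz2_floor ba.
have j3 : 3 * (b - a) < 2 ^ j.
  by move: j2; rewrite expfzDr ?pnatr_eq0// expr1z; lra.
have sub alpha m : grid alpha j m <= a -> b < grid alpha j (m + 1) ->
    `[a, b] `<=` dyadic_itv alpha (j, m).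
  move=> ha hb x /=; rewrite /dyadic_itv/= !in_itv/= => /andP[ax xb].
  by rewrite (le_trans ha ax) (le_lt_trans xb hb).
have [m /andP[mb bm]] := floor_grid 0 j b.
have [ma|am] := leP (grid 0 j m) a.
  by exists 0, (j, m); split=> //; [left|exact: sub].
have [n /andP[nb bn]] := floor_grid (1 / 3) j b.
have [na|an] := leP (grid (1 / 3) j n) a.
  by exists (1 / 3), (j, n); split=> //; [right|exact: sub].
exfalso.
have u0 := exprz2_gt0 j.
have d1 : `|grid 0 j m - grid (1 / 3) j n| < 2 ^ j / 3.
  by rewrite ltr_norml; lra.
have : (-1 : R) ^ j = 1 \/ (-1 : R) ^ j = -1.
  have : ((-1 : R) ^ j) ^+ 2 = 1 by rewrite expr2 -expfzMl mulN1r opprK exp1rz.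
  by move/eqP; rewrite sqrf_eq1 => /orP[]/eqP; [left|right].
have dE : grid 0 j m - grid (1 / 3) j n = 2 ^ j * ((m - n)%:~R - (-1) ^ j / 3).
  by rewrite /grid intrB; ring.
move: d1; rewrite dE normrM gtr0_norm// ltr_pM2l// ltr_norml => /andP[z1 z2].
move=> [w1|w1]; move: z1 z2; rewrite w1 => z1 z2.
- apply: (@int_gap (m - n)); first by rewrite -(ltr_int R) mulr0z; lra.
  by rewrite -(ltr_int R) mulr1z; lra.
- apply: (@int_gap (n - m)); first by rewrite -(ltr_int R) mulr0z -opprB intrN; lra.
  by rewrite -(ltr_int R) mulr1z -opprB intrN; lra.
Qed.

End dyadic_grid.

(** * A packing estimate for dyadic intervals *)

Section packing.
Variable R : realType.
Implicit Types (alpha r : R) (F : seq (int * int)).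
Notation mu := (@lebesgue_measure R).

Lemma seq_max_level F : F != [::] -> exists2 i0, i0 \in F & forall i, i \in F -> i.1 <= i0.1.
Proof.
elim: F => // i F IH _; have [->|F0] := eqVneq F [::].
  by exists i; rewrite ?mem_head// => i'; rewrite mem_seq1 => /eqP->.
have [i0 i0F i0max] := IH F0.
have [ii0|i0i] := leP i.1 i0.1.
  exists i0; first by rewrite in_cons i0F orbT.
  by move=> i'; rewrite in_cons => /orP[/eqP->//|/i0max].
exists i; first exact: mem_head.
by move=> i'; rewrite in_cons => /orP[/eqP->//|/i0max/le_trans]; apply; exact: ltW.
Qed.

(** The sum of the series 1 + 2^(-r) + 4^(-r) + ... *)
Definition geo_sum r : R := (1 - 2^-1 `^ r)^-1.

Lemma powR_half_lt1 r : 0 < r -> 2^-1 `^ r < 1 :> R.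
Proof.
move=> r0; have := @gt0_ltr_powR R r r0 2^-1 1; rewrite powR1; apply.
- by rewrite nnegrE invr_ge0.
- by rewrite nnegrE.
- by rewrite invf_lt1// ltr1n.
Qed.

Lemma geo_sum_gt0 r : 0 < r -> 0 < geo_sum r.
Proof. by move=> r0; rewrite invr_gt0 subr_gt0 powR_half_lt1. Qed.

Definition size_pow r (i : int * int) : R := (2 ^ i.1) `^ r.

Lemma size_pow_ge0 r i : 0 <= size_pow r i.
Proof. exact: powR_ge0. Qed.

Lemma ler_size_pow r i i' : 0 < r -> i.1 <= i'.1 -> size_pow r i <= size_pow r i'.
Proof.
move=> r0 ii'; rewrite ge0_ler_powR ?nnegrE ?(ltW r0) ?(ltW (exprz2_gt0 _ _))//.
by rewrite ler_weXz2l// ler1n.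
Qed.

(** At most one interval per level contains x, so the sum is a geometric series
dominated by its largest term. *)
Lemma overlap_bound alpha r x F j0 : 0 < r -> uniq F ->
  (forall i, i \in F -> dyadic_itv alpha i x /\ i.1 <= j0) ->
  \sum_(i <- F) size_pow r i <= geo_sum r * (2 ^ j0) `^ r.
Proof.
move=> r0; have [n] := ubnP (size F); elim: n F j0 => // n IH F j0 Fn uF hF.
have [->|F0] := eqVneq F [::].
  by rewrite big_nil mulr_ge0 ?powR_ge0// ltW// geo_sum_gt0.
have [i0 i0F i0max] := seq_max_level F0.
rewrite (big_rem i0)//=.
have Frem : (size (rem i0 F) < n)%N.
  by rewrite size_rem// -ltnS (leq_trans _ Fn)// ltnS prednK// lt0n size_eq0.
have hrem i : i \in rem i0 F -> dyadic_itv alpha i x /\ i.1 <= i0.1 - 1.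
  rewrite mem_rem_uniq// inE => /andP[ii0 iF]; have [xi _] := hF _ iF; split=> //.
  have [xi0 _] := hF _ i0F.
  have ne : i.1 != i0.1 by apply: contra ii0 => /eqP e; rewrite (dyadic_itv_level e xi xi0).
  by rewrite -ltzD1 subrK lt_neqAle ne i0max.
have := IH (rem i0 F) (i0.1 - 1) Frem (rem_uniq _ uF) hrem.
have -> : (2 : R) ^ (i0.1 - 1) = 2 ^ i0.1 * 2^-1 by rewrite expfzDr ?pnatr_eq0.
rewrite powRM ?(ltW (exprz2_gt0 _ _)) ?invr_ge0// => h.
apply: (@le_trans _ _ (geo_sum r * size_pow r i0)); last first.
  rewrite ler_wpM2l ?(ltW (geo_sum_gt0 _))//.
  by apply: (@ler_size_pow r i0 (j0, 0)) => //; exact: (hF _ i0F).2.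
apply: (@le_trans _ _ (size_pow r i0 + geo_sum r * (size_pow r i0 * 2^-1 `^ r))).
  by rewrite lerD2l.
rewrite /geo_sum; have := powR_half_lt1 r0; move: (size_pow r i0) (2^-1 `^ r) => u w w1.
rewrite le_eqVlt; apply/orP; left; apply/eqP; field.
by rewrite subr_eq0 gt_eqF.
Qed.

Lemma measurable_EFin_patch (D : set R) (f : R -> R) : measurable D ->
  measurable_fun setT f -> measurable_fun setT ((fun x => (f x)%:E) \_ D).
Proof.
move=> mD mf; apply: (iffLR (measurable_restrictT _ mD)).
by apply/measurable_EFinP; apply: measurable_funS mf.
Qed.

Lemma measurable_size_pow_indic alpha r i (v : R -> R) : measurable_fun setT v ->
  measurable_fun setT (fun x => (size_pow r i * \1_(dyadic_itv alpha i) x * v x)%:E).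
Proof.
move=> mv; apply/measurable_EFinP/measurable_funM => //.
apply: measurable_funM; first exact: measurable_cst.
by apply: measurable_indic; exact: measurable_dyadic_itv.
Qed.

(** Induction on the number of intervals.  Let Q0 be a largest one.  The intervals
inside Q0 contribute at most a geometric series times the contribution of Q0, by
[overlap_bound] integrated against v; this is charged to the integral of G on
Q0.  The remaining intervals are disjoint from Q0 and fall under the induction
hypothesis on the complement of Q0. *)
Lemma packing alpha r K (v G : R -> R) F (A : set R) : alpha *+ 3 \is a Num.int -> 0 < r -> 0 <= K ->
  (forall x, 0 <= v x) -> (forall x, 0 <= G x) ->
  measurable_fun setT v -> measurable_fun setT G -> measurable A -> uniq F ->
  (forall i, i \in F -> dyadic_itv alpha i `<=` A /\
    ((size_pow r i)%:E * \int[mu]_(x in dyadic_itv alpha i) (v x)%:E <=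
     K%:E * \int[mu]_(x in dyadic_itv alpha i) (G x)%:E)%E) ->
  (\sum_(i <- F) (size_pow r i)%:E * \int[mu]_(x in dyadic_itv alpha i) (v x)%:E <=
   (geo_sum r * K)%:E * \int[mu]_(x in A) (G x)%:E)%E.
Proof.
move=> a3 r0 K0 v0 G0 mv mG; have C0 := geo_sum_gt0 r0.
have mD i := measurable_dyadic_itv alpha i.
have [n] := ubnP (size F); elim: n F A => // n IH F A Fn mA uF hF.
have [->|F0] := eqVneq F [::].
  rewrite big_nil mule_ge0 ?lee_fin ?mulr_ge0 ?(ltW C0)//.
  by apply: integral_ge0 => x _; rewrite lee_fin.
have [i0 i0F i0max] := seq_max_level F0.
pose inside i := `[< dyadic_itv alpha i `<=` dyadic_itv alpha i0 >].
rewrite (bigID inside)/= -[X in (X + _)%E]big_filter -[X in (_ + X)%E]big_filter; set F1 := [seq _ <- F | inside _]; set F2 := [seq _ <- F | _].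
have AE : A = dyadic_itv alpha i0 `|` (A `\` dyadic_itv alpha i0).
  by rewrite setUIr setUv setIT; apply/esym/setUidr; exact: (hF _ i0F).1.
rewrite AE ge0_integral_setU//=; last 5 first.
- exact: mD.
- by apply: measurableD => //; exact: mD.
- by apply/measurable_EFinP; apply: measurable_funS mG.
- by move=> x _; rewrite lee_fin.
- by rewrite disj_set2E setIDA setIC setDE -setIA setICr setI0.
rewrite ge0_muleDr ?integral_ge0//; try by move=> *; rewrite lee_fin.
apply: leeD.
- apply: (@le_trans _ _ ((geo_sum r)%:E * ((size_pow r i0)%:E * \int[mu]_(x in dyadic_itv alpha i0) (v x)%:E))%E); last first.
    rewrite EFinM -muleA lee_pmul2l//; exact: (hF _ i0F).2.
  rewrite muleA -EFinM.
  have vE i : ((size_pow r i)%:E * \int[mu]_(x in dyadic_itv alpha i) (v x)%:E =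
      \int[mu]_x (size_pow r i * \1_(dyadic_itv alpha i) x * v x)%:E)%E.
    rewrite integral_mkcond -ge0_integralZl//.
    + apply: eq_integral => x _; rewrite patchE indicE; case: ifPn => _.
        by rewrite mulr1 EFinM.
      by rewrite mulr0 mul0r mule0.
    + exact: measurable_EFin_patch.
    + by move=> x _; rewrite patchE; case: ifPn; rewrite ?lee_fin.
    + by rewrite lee_fin size_pow_ge0.
  under eq_bigr do rewrite vE.
  rewrite -ge0_integral_sum//; last 2 first.
  + by move=> i; exact: measurable_size_pow_indic.
  + by move=> i x _; rewrite lee_fin !mulr_ge0 ?size_pow_ge0.
  rewrite [X in (_ <= _ * X)%E]integral_mkcond -ge0_integralZl//; last 3 first.
  + exact: measurable_EFin_patch.
  + by move=> x _; rewrite patchE; case: ifPn; rewrite ?lee_fin.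
  + by rewrite lee_fin mulr_ge0 ?size_pow_ge0// ltW.
  apply: ge0_le_integral => //.
  + by move=> x _; apply: sume_ge0 => i _; rewrite lee_fin !mulr_ge0 ?size_pow_ge0.
  + by apply: emeasurable_sum => i; exact: measurable_size_pow_indic.
  + by apply: measurable_funeM; exact: measurable_EFin_patch.
  move=> x _; rewrite sumEFin patchE; case: ifPn => xi0; last first.
    rewrite mule0 big_seq big1// => i; rewrite mem_filter => /andP[/asboolP ii0 _].
    rewrite indicE memNset ?mulr0 ?mul0r// => xi; move: xi0; rewrite notin_setE; apply.
    exact: ii0.
  rewrite -EFinM lee_fin -mulr_suml ler_wpM2r//.
  rewrite (eq_bigr (fun i => if x \in dyadic_itv alpha i then size_pow r i else 0)); last first.
    by move=> i _; rewrite indicE; case: ifP; rewrite ?mulr1 ?mulr0.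
  rewrite -big_mkcond -big_filter; apply: (@overlap_bound alpha _ x) => //.
    by rewrite filter_uniq// filter_uniq.
  by move=> i; rewrite !mem_filter => /and3P[xi _ /i0max ?]; split=> //; exact: set_mem xi.
- apply: IH => //.
  + rewrite -ltnS (leq_trans _ Fn)// ltnS size_filter -(count_predC inside F) -[ltnLHS]add0n ltn_add2r.
    by rewrite -has_count; apply/hasP; exists i0 => //; apply/asboolP.
  + by apply: measurableD => //; exact: mD.
  + exact: filter_uniq.
  move=> i; rewrite mem_filter => /andP[/asboolPn ii0 iF]; have [iA iG] := hF _ iF; split=> //.
  move=> x xi; split; first exact: iA.
  by move=> xi0; apply: ii0; apply: (dyadic_itv_sub a3 (i0max _ iF) xi xi0).
Qed.

End packing.

(** * The averaging inequality of a Muckenhoupt weight *)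

Section Ap_average.
Variable R : realType.
Implicit Types (p c l C : R) (v g : R -> R).
Notation mu := (@lebesgue_measure R).

Lemma measurable_powR_comp (D : set R) (f : R -> R) r :
  measurable_fun D f -> measurable_fun D (fun x => f x `^ r).
Proof. by move=> mf; apply: (measurableT_comp (measurable_powR r)). Qed.

Lemma len_co c l : 0 < l -> len `[c, (c + l)%R[%classic = l.
Proof.
move=> l0; rewrite /len lebesgue_measure_itv/= lte_fin ltrDl l0.
by rewrite -EFinB/= addrAC subrr add0r.
Qed.

Lemma bounded_intervals_co c l : 0 < l -> bounded_intervals `[c, (c + l)%R[%classic.
Proof. by move=> l0; exists true, true, c, (c + l); rewrite ltrDl. Qed.

Lemma wmeas_fin v c l : locally_integrable setT v ->
  wmeas v `[c, (c + l)%R[%classic \is a fin_num.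
Proof.
move=> lv; apply: integrable_fin_num => //.
apply: integrableS (locally_integrable_itv c (c + l) lv) => //.
exact: subset_itv_co_cc.
Qed.

(** The essential supremum of 1/v on Q is a number M with M v(Q)/|Q| <= C, and
|g| <= M |g| v almost everywhere on Q. *)
Lemma muckenhoupt_average1 v : (forall x, 0 <= v x) -> locally_integrable setT v ->
  muckenhoupt 1 v -> exists2 C : R, 0 < C & forall c l g, 0 < l -> measurable_fun setT g ->
  ((\int[mu]_(x in `[c, (c + l)%R[) `|g x|%:E) * wmeas v `[c, (c + l)%R[%classic <=
   (C * l)%:E * \int[mu]_(x in `[c, (c + l)%R[) (`|g x| * v x)%:E)%E.
Proof.
move=> v0 lv mv; have [mfv _ _] := lv.
exists (`|fine (Ap_constant 1 v)| + 1); first by rewrite ltr_wpDl.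
move=> c l g l0 mg; set Q := `[c, (c + l)%R[%classic.
have mQ : measurable Q by exact: measurable_itv.
set C := _ + 1; have C0 : 0 < C by rewrite ltr_wpDl.
have E0 : (0 <= \int[mu]_(x in Q) (`|g x| * v x)%:E)%E.
  by apply: integral_ge0 => x _; rewrite lee_fin mulr_ge0.
have [V|V0] := eqVneq (wmeas v Q) 0%E.
  by rewrite V mule0 mule_ge0// lee_fin mulr_ge0 ?ltW.
have Vpos : (0 < wmeas v Q)%E.
  by rewrite lt_neqAle eq_sym V0/=; apply: integral_ge0 => x _; rewrite lee_fin.
have Vfin : wmeas v Q \is a fin_num by exact: wmeas_fin.
set V := wmeas v Q in V0 Vpos Vfin *.
pose S := ess_sup mu ((fun x => (v x)%:E^-1)%E \_ Q).
have hC : ((l^-1)%:E * V * S <= C%:E)%E.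
  apply: (@le_trans _ _ (Ap_constant 1 v)).
    apply: ereal_sup_ubound; exists Q; first exact: bounded_intervals_co.
    by rewrite eqxx /average len_co.
  move: mv; rewrite /muckenhoupt /C; case: (Ap_constant 1 v) => [r|//|_]; last by rewrite leNye.
  by rewrite /= lee_fin => _; rewrite (le_trans (ler_norm _))// lerDl.
have lV : (0 < (l^-1)%:E * V)%E by rewrite mule_gt0// lte_fin invr_gt0.
have lVfin : ((l^-1)%:E * V)%E \is a fin_num by rewrite fin_numM.
(* M is the essential supremum S when S is a nonnegative real. *)
have [M [M0 SM MC]] : exists M : R, [/\ 0 <= M, (S <= M%:E)%E & ((l^-1)%:E * V * M%:E <= C%:E)%E].
  move: hC; case: S => [s| |] hC.
  - have [s0|s0] := leP 0 s; first by exists s.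
    by exists 0; split=> //; rewrite ?mule0 lee_fin ltW.
  - by move: hC; rewrite gt0_muley.
  - by exists 0; split=> //; rewrite ?leNye// mule0 lee_fin ltW.
have vM : {ae mu, forall x, Q x -> (`|g x| <= M * (`|g x| * v x))}.
  move/ess_supP : SM; apply: ae_imp => x + Qx; rewrite patchE mem_set// inver.
  case: ifPn => [//|vx0]; rewrite lee_fin => h.
  rewrite mulrCA ler_peMr// -ler_pdivrMr ?div1r// lt_neqAle eq_sym vx0 v0//.
have : (\int[mu]_(x in Q) `|g x|%:E <= M%:E * \int[mu]_(x in Q) (`|g x| * v x)%:E)%E.
  have mgv : measurable_fun Q (fun x => `|g x| * v x).
    apply: measurable_funM; last exact: measurable_funTS.
    by apply: measurable_funTS; exact: measurableT_comp.
  rewrite -ge0_integralZl//; last 2 first.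
  - exact/measurable_EFinP.
  - by move=> x _; rewrite lee_fin mulr_ge0.
  apply: ae_ge0_le_integral => //.
  - by apply/measurable_EFinP; apply: measurable_funTS; exact: measurableT_comp.
  - by move=> x _; rewrite lee_fin !mulr_ge0.
  - by apply: measurable_funeM; exact/measurable_EFinP.
move=> h; apply: (@le_trans _ _ (M%:E * \int[mu]_(x in Q) (`|g x| * v x)%:E * V)%E).
  by rewrite lee_pmul2r.
rewrite muleAC lee_wpmul2r//; move: MC.
rewrite -(fineK Vfin) -!EFinM !lee_fin => MC.
rewrite -ler_pdivrMr//; apply: le_trans MC.
by rewrite le_eqVlt; apply/orP; left; apply/eqP; ring.
Qed.

Lemma measurable_inve v : (forall x, 0 <= v x) -> measurable_fun setT v ->
  measurable_fun setT (fun x => (v x)%:E^-1)%E.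
Proof.
move=> v0 mv.
have -> : (fun x => (v x)%:E^-1)%E = (fun x => if v x == 0%R then +oo else (v x `^ (-1))%R%:E)%E.
  by apply/funext => x; rewrite inver powR_inv1.
apply: measurable_fun_ifT => //=.
  by apply: measurable_fun_eqr.
by apply/measurable_EFinP; exact: measurable_powR_comp.
Qed.

(** Hoelder's inequality for the factorization g = (g v^(1/p)) v^(-1/p), which is
legitimate where v does not vanish. *)
Lemma ge0_weighted_hoelder p (Q : set R) v g : 1 < p -> measurable Q ->
  (forall x, 0 <= v x) -> measurable_fun setT v -> measurable_fun setT g ->
  {ae mu, forall x, Q x -> v x != 0} ->
  ((\int[mu]_(x in Q) `|g x|%:E) `^ p <=
   (\int[mu]_(x in Q) (`|g x| `^ p * v x)%:E) *
   (\int[mu]_(x in Q) ((v x)%:E^-1 `^ (p - 1)^-1)) `^ (p - 1))%E.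
Proof.
move=> p1 mQ v0 mv mg vn0.
have p0 : 0 < p by rewrite (lt_trans _ p1).
have pp : 0 < p - 1 by rewrite subr_gt0.
pose q := p / (p - 1).
have q0 : 0 < q by rewrite divr_gt0.
have pq : p^-1 + q^-1 = 1.
  rewrite /q invf_div -{1}[p^-1]mul1r -mulrDl addrC subrK mulfV// gt_eqF//.
pose f1 := (fun x => `|g x| * v x `^ p^-1) \_ Q.
pose h1 := (fun x => v x `^ (- p^-1)) \_ Q.
have mf1 : measurable_fun setT f1.
  apply: (iffLR (measurable_restrictT _ mQ)); apply: measurable_funTS.
  by apply: measurable_funM; [exact: measurableT_comp|exact: measurable_powR_comp].
have mh1 : measurable_fun setT h1.
  apply: (iffLR (measurable_restrictT _ mQ)); apply: measurable_funTS.
  exact: measurable_powR_comp.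
have := hoelder mu mf1 mh1 p0 q0 pq.
have -> : ('N[mu]_1[EFin \o (f1 \* h1)%R] = \int[mu]_(x in Q) `|g x|%:E)%E.
  rewrite Lnorm1 [RHS]integral_mkcond; apply: ge0_ae_eq_integral => //.
  - by apply: measurableT_comp => //; apply/measurable_EFinP; exact: measurable_funM.
  - apply: (iffLR (measurable_restrictT _ mQ)); apply/measurable_EFinP.
    by apply: measurable_funTS; exact: measurableT_comp.
  - by move=> x _; rewrite patchE; case: ifPn.
  apply: ae_imp vn0 => x h _; rewrite /f1 /h1 /= !patchE; case: ifPn => [/set_mem Qx|_].
    rewrite -mulrA -powRD ?subrr ?powRr0 ?mulr1 ?normr_id//.
    by rewrite h// implybT.
  by rewrite mul0r normr0.
have -> : ('N[mu]_p%:E[EFin \o f1] = (\int[mu]_(x in Q) (`|g x| `^ p * v x)%:E) `^ p^-1)%E.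
  rewrite unlock; congr (_ `^ _)%E; rewrite [RHS]integral_mkcond; apply: eq_integral => x _.
  rewrite /f1/= !patchE; case: ifPn => _; last by rewrite normr0 powR0 ?gt_eqF.
  rewrite ger0_norm ?mulr_ge0 ?powR_ge0// powRM ?powR_ge0//.
  by rewrite -powRrM mulVf ?gt_eqF// powRr1.
have -> : ('N[mu]_q%:E[EFin \o h1] = (\int[mu]_(x in Q) ((v x)%:E^-1 `^ (p - 1)^-1)) `^ q^-1)%E.
  rewrite unlock; congr (_ `^ _)%E; rewrite [RHS]integral_mkcond.
  apply: ge0_ae_eq_integral => //.
  - apply: (measurableT_comp (measurable_poweR _)) => //.
    by apply: measurableT_comp => //; exact/measurable_EFinP.
  - apply: (iffLR (measurable_restrictT _ mQ)).
    apply: (measurableT_comp (measurable_poweR _)) => //.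
    by apply: measurable_funTS; exact: measurable_inve.
  - by move=> x _; exact: poweR_ge0.
  - by move=> x _; rewrite patchE; case: ifPn => // _; exact: poweR_ge0.
  apply: ae_imp vn0 => x h _; rewrite /h1/= !patchE; case: ifPn => [/set_mem Qx|_].
    rewrite inver ifF; last by apply/negbTE; exact: h.
    rewrite /= ger0_norm ?powR_ge0// -powRrM -[(v x)^-1]powR_inv1// -powRrM.
    by congr (_ `^ _)%:E; rewrite /q; field; rewrite !gt_eqF.
  by rewrite normr0 powR0 ?gt_eqF.
set X := (\int[mu]_(x in Q) `|g x|%:E)%E.
set E := (\int[mu]_(x in Q) (`|g x| `^ p * v x)%:E)%E.
set W := (\int[mu]_(x in Q) _)%E => h.
have X0 : (0 <= X)%E by exact: integral_ge0.
have E0 : (0 <= E)%E by apply: integral_ge0 => x _; rewrite lee_fin mulr_ge0 ?powR_ge0.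
have W0 : (0 <= W)%E by apply: integral_ge0 => x _; exact: poweR_ge0.
have pW : (W `^ (p - 1) = (W `^ q^-1) `^ p)%E.
  by rewrite -poweRrM; congr (_ `^ _)%E; rewrite /q invf_div mulfVK// gt_eqF.
have pE : (E = (E `^ p^-1) `^ p)%E by rewrite -poweRrM mulVf ?poweRe1// gt_eqF.
rewrite pW {1}pE -poweRM ?poweR_ge0//; apply: gt0_ler_poweR => //; first exact: ltW.
- by rewrite in_itv/= X0 leey.
- by rewrite in_itv/= mule_ge0 ?poweR_ge0//= leey.
Qed.

Lemma hoelder_conjugateE p : 1 < p -> fine (hoelder_conjugate p%:E) - 1 = (p - 1)^-1.
Proof.
move=> p1; have p0 : p != 0 by rewrite gt_eqF// (lt_trans _ p1).
have pp : p - 1 != 0 by rewrite subr_eq0 gt_eqF.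
rewrite /hoelder_conjugate /= eqe (negPf p0) -EFinB inver (negPf pp) -EFinM/=.
by field.
Qed.

Lemma Ap_constant_bound p v : muckenhoupt p v ->
  exists2 C, 0 < C & (Ap_constant p v <= C%:E)%E.
Proof.
rewrite /muckenhoupt => mv; exists (`|fine (Ap_constant p v)| + 1); first by rewrite ltr_wpDl.
move: mv; case: (Ap_constant p v) => [r|//|_]; last by rewrite leNye.
by rewrite /= lee_fin => _; rewrite (le_trans (ler_norm _))// lerDl.
Qed.

(** For p > 1 and g := v^(1-p') this is the A_p condition itself; it is the only form in
which the condition is used for upper bounds. *)
Definition averaging p v C := forall c l g, 0 < l -> measurable_fun setT g ->
  ((\int[mu]_(x in `[c, (c + l)%R[) `|g x|%:E) `^ p * wmeas v `[c, (c + l)%R[%classic <=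
   (C * l `^ p)%:E * \int[mu]_(x in `[c, (c + l)%R[) (`|g x| `^ p * v x)%:E)%E.

(** If p > 1 and v(Q) > 0, finiteness of the A_p constant forces v^(1-p') to be integrable on
Q; in particular v > 0 almost everywhere there and [ge0_weighted_hoelder]
applies. *)
Lemma muckenhoupt_average p v : 1 <= p -> (forall x, 0 <= v x) -> locally_integrable setT v ->
  muckenhoupt p v -> exists2 C : R, 0 < C & averaging p v C.
Proof.
rewrite le_eqVlt => /predU1P[<-|p1] v0 lv mv.
  have [C C0 h] := muckenhoupt_average1 v0 lv mv; exists C => // c l g l0 mg.
  rewrite powRr1 ?(ltW l0)// poweRe1; last by apply: integral_ge0 => x _.
  apply: le_trans (h c l g l0 mg) _; rewrite le_eqVlt; apply/orP; left; apply/eqP.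
  by congr (_ * _)%E; apply: eq_integral => x _; rewrite powRr1.
have [mfv _ _] := lv; have p0 : 0 < p by rewrite (lt_trans _ p1).
have pp : 0 < p - 1 by rewrite subr_gt0.
have [C C0 hA] := Ap_constant_bound mv; exists C => // c l g l0 mg.
set Q := `[c, (c + l)%R[%classic.
have mQ : measurable Q by exact: measurable_itv.
set E := (\int[mu]_(x in Q) (_ * _)%:E)%E.
have E0 : (0 <= E)%E by apply: integral_ge0 => x _; rewrite lee_fin mulr_ge0 ?powR_ge0.
have [V|V0] := eqVneq (wmeas v Q) 0%E.
  by rewrite V mule0 mule_ge0// lee_fin mulr_ge0 ?powR_ge0// ltW.
have Vpos : (0 < wmeas v Q)%E.
  by rewrite lt_neqAle eq_sym V0/=; apply: integral_ge0 => x _; rewrite lee_fin.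
have Vfin : wmeas v Q \is a fin_num by exact: wmeas_fin.
set V := wmeas v Q in V0 Vpos Vfin *.
pose W := (\int[mu]_(x in Q) ((v x)%:E^-1 `^ (p - 1)^-1))%E.
have W0 : (0 <= W)%E by apply: integral_ge0 => x _; exact: poweR_ge0.
have hC : ((l^-1)%:E * V * ((l^-1)%:E * W) `^ (p - 1) <= C%:E)%E.
  apply: le_trans hA; apply: ereal_sup_ubound; exists Q; first exact: bounded_intervals_co.
  by rewrite gt_eqF// /average len_co// hoelder_conjugateE.
have lV : (0 < (l^-1)%:E * V)%E by rewrite mule_gt0// lte_fin invr_gt0.
have Wfin : W \is a fin_num.
  rewrite ge0_fin_numE// ltNge leye_eq; apply/eqP => Wy; move: hC.
  by rewrite Wy gt0_muley ?lte_fin ?invr_gt0// poweRyr ?gt_eqF// gt0_muley.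
have miv : measurable_fun Q (fun x => (v x)%:E^-1 `^ (p - 1)^-1)%E.
  apply: (measurableT_comp (measurable_poweR _)) => //.
  by apply: measurable_funTS; exact: measurable_inve.
have vn0 : {ae mu, forall x, Q x -> v x != 0}.
  have iv : mu.-integrable Q (fun x => (v x)%:E^-1 `^ (p - 1)^-1)%E.
    apply/integrableP; split=> //; rewrite -ge0_fin_numE; last by apply: integral_ge0 => x _; exact: abse_ge0.
    by under eq_integral do rewrite gee0_abs ?poweR_ge0//.
  have := @integrable_ae _ _ _ mu _ mQ _ iv.
  apply: ae_imp => x h Qx; apply: contraTneq (h Qx) => ->.
  by rewrite inve0 poweRyr ?gt_eqF ?invr_gt0.
have := ge0_weighted_hoelder p1 mQ v0 mfv mg vn0; rewrite -/W -/E => hX.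
apply: (@le_trans _ _ (E * W `^ (p - 1) * V)%E); first by rewrite lee_pmul2r.
rewrite -muleA muleC; apply: lee_wpmul2r => //.
move: hC; rewrite -(fineK Vfin) -(fineK Wfin) -!EFinM /= ?lee_fin -?EFinM ?lee_fin.
rewrite powRM ?invr_ge0 ?(ltW l0) ?fine_ge0//.
have -> : l^-1 `^ (p - 1) = l / l `^ p.
  by rewrite -[l^-1]powR_inv1 ?(ltW l0)// -powRrM mulN1r opprB powRB ?powRr1 ?(ltW l0)// (gt_eqF l0) implybT.
have lp : 0 < l `^ p by rewrite powR_gt0.
rewrite -ler_pdivrMr// => hC; apply: le_trans hC.
rewrite le_eqVlt; apply/orP; left; apply/eqP; field.
by rewrite !gt_eqF.
Qed.

End Ap_average.

(** * Testing the averaging inequality on bounded functions *)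

Section testing.
Variable R : realType.
Implicit Types (p a b : R) (v g : R -> R).
Notation mu := (@lebesgue_measure R).

(** Boundedness of g keeps all the integrals finite and makes the k-fold primitive
of g a legitimate competitor. *)
Definition testing p v (C : R) := forall a b g, a < b ->
  measurable_fun setT g -> (forall x, 0 <= g x) -> (exists M, forall x, g x <= M) ->
  (forall x, ~~ (a <= x <= b) -> g x = 0) ->
  (\int[mu]_(x in `[a, b]) g x) `^ p * \int[mu]_(x in `[a, b]) v x <=
  C * (b - a) `^ p * \int[mu]_(x in `[a, b]) (g x `^ p * v x).

Lemma integrable_bounded a b g : measurable_fun setT g -> (forall x, 0 <= g x) ->
  (exists M, forall x, g x <= M) -> mu.-integrable `[a, b] (EFin \o g).
Proof.
move=> mg g0 [M gM]; apply: measurable_bounded_integrable => //.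
- by rewrite /= lebesgue_measure_itv/=; case: ifP => _; rewrite ?ltry// -EFinB ltry.
- exact: measurable_funTS.
- exists M; split; first exact: num_real.
  by move=> N MN x _ /=; rewrite ger0_norm// (le_trans (gM x))// ltW.
Qed.

Lemma Rintegral_eq0_ae a b g : measurable_fun setT g -> (forall x, 0 <= g x) ->
  (exists M, forall x, g x <= M) -> \int[mu]_(x in `[a, b]) g x = 0 ->
  {ae mu, forall x, a <= x <= b -> g x = 0}.
Proof.
move=> mg g0 gM I0; have ig := integrable_bounded a b mg g0 gM.
have h : ae_eq mu `[a, b]%classic (EFin \o g) (cst 0%E).
  apply/ae_eq_integral_abs => //; first by apply/measurable_EFinP; exact: measurable_funTS.
  under eq_integral do rewrite /= ger0_norm//.
  by rewrite Rintegral_EFin// I0.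
by apply: ae_imp h => x h xab; have := h; rewrite /= in_itv/= => /(_ xab) [].
Qed.

Definition gated (P : R -> bool) a b (h : R -> R) x : R :=
  if (a <= x <= b) && P x then h x else 0.

Lemma measurable_gated (P : R -> bool) a b (h : R -> R) : measurable_fun setT P -> measurable_fun setT h ->
  measurable_fun setT (gated P a b h).
Proof.
move=> mP mh; apply: measurable_fun_ifT => //=.
apply: measurable_and => //; apply: measurable_and; exact: measurable_fun_ler.
Qed.

Lemma gated_ge0 (P : R -> bool) a b (h : R -> R) x : (forall x, P x -> 0 <= h x) -> 0 <= gated P a b h x.
Proof. by move=> h0; rewrite /gated; case: ifPn => // /andP[_ /h0]. Qed.

Lemma gated_out (P : R -> bool) a b (h : R -> R) x : ~~ (a <= x <= b) -> gated P a b h x = 0.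
Proof. by rewrite /gated => /negPf->. Qed.

(** Test with the indicator of the set where v is below the threshold s: if it had
positive measure m, the inequality would give m V <= C (b-a) s m = m V / 2. *)
Lemma testing_ae_ge v C a b (s : R) : 0 < C -> (forall x, 0 <= v x) ->
  locally_integrable setT v -> testing 1 v C -> a < b ->
  0 < \int[mu]_(x in `[a, b]) v x ->
  s = (\int[mu]_(x in `[a, b]) v x) / (2 * C * (b - a)) ->
  {ae mu, forall x, a <= x <= b -> s <= v x}.
Proof.
move=> C0 v0 lv tC ab V0 sE; have [mv _ _] := lv.
set V := \int[mu]_(x in _) v x in V0 sE.
have ba : 0 < b - a by rewrite subr_gt0.
have s0 : 0 < s by rewrite sE divr_gt0// !mulr_gt0.
pose g := gated (fun x => v x < s) a b (cst 1).
have mg : measurable_fun setT g by apply: measurable_gated => //; exact: measurable_fun_ltr.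
have g0 x : 0 <= g x by exact: gated_ge0.
have gM : exists M, forall x, g x <= M by exists 1 => x; rewrite /g /gated; case: ifP.
have gout x : ~~ (a <= x <= b) -> g x = 0 by exact: gated_out.
have ig := integrable_bounded a b mg g0 gM.
have iv := locally_integrable_itv a b lv.
have := tC a b g ab mg g0 gM gout; rewrite -/V !powRr1 ?(ltW ba)//; last first.
  by apply: Rintegral_ge0 => x _.
set m := \int[mu]_(x in _) g x => h.
have m0 : 0 <= m by apply: Rintegral_ge0 => x _.
have gv : \int[mu]_(x in `[a, b]) (g x `^ 1 * v x) <= s * m.
  rewrite /m -RintegralZl//; apply: le_Rintegral => //.
  - have [M hM] := gM.
    apply: (@eq_integrable _ _ _ mu _ (measurable_itv _) (EFin \o (fun x => v x * g x))).
      by move=> x _ /=; rewrite powRr1// mulrC.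
    apply: (@integrable_mul _ _ _ _ M) => //; first exact: measurable_funTS.
    by move=> x _; rewrite ger0_norm.
  - exact: (@integrableZl _ _ _ mu _ (measurable_itv _) s _ ig).
  move=> x _; rewrite powRr1// mulrC /g /gated; case: ifPn => [/andP[_ vs]|_].
    by rewrite !mulr1 ltW.
  by rewrite !mulr0.
have {}m0 : m = 0.
  apply/eqP; rewrite eq_le m0 andbT leNgt; apply/negP => m1.
  have : m * V <= C * (b - a) * (s * m).
    by apply: le_trans h _; rewrite ler_wpM2l// mulr_ge0// ltW.
  have -> : C * (b - a) * (s * m) = m * (V / 2).
    by rewrite sE; field; rewrite !gt_eqF.
  by rewrite ler_pM2l//; move: V0; lra.
apply: ae_imp (Rintegral_eq0_ae mg g0 gM m0) => x h1 xab.
rewrite leNgt; apply/negP => vs; have := h1 xab.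
by rewrite /g /gated xab vs/= => /eqP; rewrite oner_eq0.
Qed.

Lemma average_itv (s t : bool) a b (w : R -> \bar R) : a < b -> measurable_fun setT w ->
  average [set` Interval (BSide s a) (BSide t b)] w =
  ((b - a)^-1%:E * \int[mu]_(x in `[a, b]) w x)%E.
Proof.
move=> ab mw; rewrite /average; congr (_^-1%:E * _)%E.
  by rewrite /len lebesgue_measure_itv/= lte_fin ab -EFinB.
by rewrite !integral_itv_bndoo//; exact: measurable_funTS.
Qed.

Lemma testing_muckenhoupt1 v C : 0 < C -> (forall x, 0 <= v x) ->
  locally_integrable setT v -> testing 1 v C -> muckenhoupt 1 v.
Proof.
move=> C0 v0 lv tC; have [mv _ _] := lv.
apply: (@le_lt_trans _ _ (2 * C)%:E); last exact: ltry.
apply: ub_ereal_sup => _ [_ [s [t [a [b [ab ->]]]]] <-].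
rewrite eqxx average_itv//; last exact/measurable_EFinP.
have ba : 0 < b - a by rewrite subr_gt0.
have iv := locally_integrable_itv a b lv.
rewrite (Rintegral_EFin _ iv)//.
set V := \int[mu]_(x in _) v x.
have V0 : 0 <= V by apply: Rintegral_ge0 => x _.
have [->|Vn0] := eqVneq V 0; first by rewrite mule0 mul0e lee_fin mulr_ge0// ltW.
have {}V0 : 0 < V by rewrite lt_neqAle eq_sym Vn0.
pose z := V / (2 * C * (b - a)).
have z0 : 0 < z by rewrite divr_gt0// !mulr_gt0.
have hz := testing_ae_ge C0 v0 lv tC ab V0 (erefl z).
set S := ess_sup _ _.
have Sz : (S <= z^-1%:E)%E.
  apply/ess_supP; apply: ae_imp hz => x hx; rewrite patchE; case: ifPn => [/set_mem /= xQ|_].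
    have xab : a <= x <= b.
      move: xQ; rewrite itv_boundlr => /andP[h1 h2].
      by move: h1 h2; case: (s) (t) => -[] /=; rewrite !bnd_simp => h1 h2; rewrite ?(ltW h1) ?(ltW h2) ?h1 ?h2.
    have vx := hx xab; have vx0 : 0 < v x by exact: lt_le_trans vx.
    by rewrite inver gt_eqF// lee_fin lef_pV2.
  by rewrite lee_fin invr_ge0 ltW.
apply: (@le_trans _ _ (((b - a)^-1 * V)%:E * z^-1%:E)%E).
  by rewrite EFinM lee_pmul2l// mule_gt0// lte_fin// invr_gt0.
rewrite -EFinM lee_fin le_eqVlt; apply/orP; left; apply/eqP; rewrite /z; field.
by rewrite !gt_eqF.
Qed.

(** Test with the indicator of the zero set of v: the right-hand side vanishes. *)
Lemma testing_ae_gt0 p v C a b : 0 < p -> 0 < C -> (forall x, 0 <= v x) ->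
  locally_integrable setT v -> testing p v C -> a < b ->
  0 < \int[mu]_(x in `[a, b]) v x ->
  {ae mu, forall x, a <= x <= b -> v x != 0}.
Proof.
move=> p0 C0 v0 lv tC ab V0; have [mv _ _] := lv.
pose g := gated (fun x => v x == 0) a b (cst 1).
have mg : measurable_fun setT g by apply: measurable_gated => //; exact: measurable_fun_eqr.
have g0 x : 0 <= g x by exact: gated_ge0.
have gM : exists M, forall x, g x <= M by exists 1 => x; rewrite /g /gated; case: ifP.
have gout x : ~~ (a <= x <= b) -> g x = 0 by exact: gated_out.
have := tC a b g ab mg g0 gM gout.
have -> : \int[mu]_(x in `[a, b]) (g x `^ p * v x) = 0.
  rewrite (@eq_Rintegral _ _ _ _ _ (cst 0)); first by rewrite Rintegral_cst// mul0r.
  move=> x _; rewrite /g /gated; case: ifPn => [/andP[_ /eqP->]|_]; first by rewrite mulr0.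
  by rewrite powR0 ?gt_eqF// mul0r.
rewrite mulr0 pmulr_lle0// => h.
have m0 : \int[mu]_(x in `[a, b]) g x = 0.
  apply/eqP; have : (\int[mu]_(x in `[a, b]) g x) `^ p == 0 by rewrite eq_le h powR_ge0.
  by rewrite powR_eq0 => /andP[].
apply: ae_imp (Rintegral_eq0_ae mg g0 gM m0) => x h1 xab.
apply/negP => vs; have := h1 xab.
by rewrite /g /gated xab vs/= => /eqP; rewrite oner_eq0.
Qed.

Lemma gated_powR_le v r n a b x : 0 < r -> (forall x, 0 <= v x) ->
  gated (fun x => n.+1%:R^-1 < v x) a b (fun x => v x `^ (- r)) x <= n.+1%:R `^ r.
Proof.
move=> r0 v0; rewrite /gated; case: ifPn => [/andP[_ vn]|_]; last exact: powR_ge0.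
have vx : 0 < v x by rewrite (lt_trans _ vn)// invr_gt0.
rewrite -mulN1r powRrM powR_inv1// ge0_ler_powR ?nnegrE ?invr_ge0 ?(ltW r0)//.
by rewrite -[leRHS]invrK lef_pV2 ?posrE ?invr_gt0// ltW.
Qed.

(** For g = v^(-1/(p-1)) one has g^p v = g, so the inequality bounds a power of
\int g; the truncation to v > 1/(n+1) makes g bounded. *)
Lemma testing_truncated_bound p v C a b n : 1 < p -> 0 < C -> (forall x, 0 <= v x) ->
  locally_integrable setT v -> testing p v C -> a < b ->
  0 < \int[mu]_(x in `[a, b]) v x ->
  \int[mu]_(x in `[a, b]) gated (fun x => n.+1%:R^-1 < v x) a b (fun x => v x `^ (- (p - 1)^-1)) x <=
  (C * (b - a) `^ p / \int[mu]_(x in `[a, b]) v x) `^ (p - 1)^-1.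
Proof.
move=> p1 C0 v0 lv tC ab V0; have [mv _ _] := lv.
have p0 : 0 < p by rewrite (lt_trans _ p1).
have pp : 0 < p - 1 by rewrite subr_gt0.
set r := (p - 1)^-1; have r0 : 0 < r by rewrite invr_gt0.
pose g := gated (fun x => n.+1%:R^-1 < v x) a b (fun x => v x `^ (- r)).
have mg : measurable_fun setT g.
  by apply: measurable_gated; [exact: measurable_fun_ltr|exact: measurable_powR_comp].
have g0 x : 0 <= g x by apply: gated_ge0 => *; exact: powR_ge0.
have gM : exists M, forall x, g x <= M.
  by exists (n.+1%:R `^ r) => x; exact: gated_powR_le.
have gout x : ~~ (a <= x <= b) -> g x = 0 by exact: gated_out.
have := tC a b g ab mg g0 gM gout.
have -> : \int[mu]_(x in `[a, b]) (g x `^ p * v x) = \int[mu]_(x in `[a, b]) g x.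
  apply: eq_Rintegral => x _; rewrite /g /gated; case: ifPn => [/andP[_ vn]|_]; last first.
    by rewrite powR0 ?gt_eqF// mul0r.
  have vx : 0 < v x by rewrite (lt_trans _ vn)// invr_gt0.
  rewrite -{2}(powRr1 (v0 x)) -powRrM -powRD; last by rewrite (gt_eqF vx) implybT.
  by congr (_ `^ _); rewrite /r; field; rewrite gt_eqF.
set X := \int[mu]_(x in _) g x; set V := \int[mu]_(x in _) v x in V0 *.
have X0 : 0 <= X by apply: Rintegral_ge0 => x _.
rewrite -/g -/X.
have [->|Xn0] := eqVneq X 0; first by rewrite powR_ge0.
have {Xn0}X0' : 0 < X by rewrite lt_neqAle eq_sym Xn0.
rewrite -(mulr_powRB1 X0 p0) -mulrA [leRHS]mulrC ler_pM2l// => h.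
have {h} : X `^ (p - 1) <= C * (b - a) `^ p / V by rewrite ler_pdivlMr.
move/(ge0_ler_powR (ltW r0)); rewrite !nnegrE powR_ge0 => /(_ isT).
rewrite -powRrM mulfV ?gt_eqF// powRr1//; apply.
by rewrite divr_ge0 ?(ltW V0)// mulr_ge0 ?powR_ge0// ltW.
Qed.

(** Monotone convergence in [testing_truncated_bound]; the truncations exhaust the
interval up to the zero set of v, which is negligible. *)
Lemma testing_muckenhouptp p v C : 1 < p -> 0 < C -> (forall x, 0 <= v x) ->
  locally_integrable setT v -> testing p v C -> muckenhoupt p v.
Proof.
move=> p1 C0 v0 lv tC; have [mv _ _] := lv.
have p0 : 0 < p by rewrite (lt_trans _ p1).
have pp : 0 < p - 1 by rewrite subr_gt0.
set r := (p - 1)^-1; have r0 : 0 < r by rewrite invr_gt0.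
apply: (@le_lt_trans _ _ C%:E); last exact: ltry.
apply: ub_ereal_sup => _ [_ [s [t [a [b [ab ->]]]]] <-].
rewrite (gt_eqF p1) hoelder_conjugateE// -/r.
have miv : measurable_fun setT (fun x => (v x)%:E^-1 `^ r)%E.
  by apply: (measurableT_comp (measurable_poweR _)) => //; exact: measurable_inve.
rewrite !average_itv//; last exact/measurable_EFinP.
have ba : 0 < b - a by rewrite subr_gt0.
have iv := locally_integrable_itv a b lv.
rewrite (Rintegral_EFin _ iv)//.
set V := \int[mu]_(x in _) v x.
have V0 : 0 <= V by apply: Rintegral_ge0 => x _.
have [->|Vn0] := eqVneq V 0; first by rewrite mule0 mul0e lee_fin ltW.
have {}V0 : 0 < V by rewrite lt_neqAle eq_sym Vn0.
pose B := (C * (b - a) `^ p / V) `^ r.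
pose F n := `[a, b]%classic `&` [set x | n.+1%:R^-1 < v x].
have mF n : measurable (F n).
  have := @measurable_fun_ltr _ _ _ setT (cst n.+1%:R^-1 : R -> R) v (@measurable_cst _ _ _ _ _ _) mv.
  move=> /(_ measurableT [set true] Logic.I); rewrite setTI => h.
  by apply: measurableI => //; move: h; congr measurable; apply/seteqP; split=> x /=.
have FB n : (\int[mu]_(x in F n) ((v x)%:E^-1 `^ r) <= B%:E)%E.
  pose g := gated (fun x => n.+1%:R^-1 < v x) a b (fun x => v x `^ (- r)).
  have -> : (\int[mu]_(x in F n) ((v x)%:E^-1 `^ r) = \int[mu]_(x in `[a, b]) (g x)%:E)%E.
    rewrite [LHS]integral_mkcond [RHS]integral_mkcond; apply: eq_integral => x _.
    rewrite !patchE /g /gated; case: ifPn => [/set_mem[/= xab vn]|].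
      rewrite mem_set//; move: xab; rewrite in_itv/= => ->; rewrite vn/=.
      have vx : 0 < v x by rewrite (lt_trans _ vn)// invr_gt0.
      by rewrite inver gt_eqF//= -mulN1r powRrM powR_inv1.
    rewrite notin_setE => h; case: ifPn => // /set_mem/= xab; move: (xab); rewrite in_itv/= => ->.
    by case: ifPn => // vn; exfalso; apply: h.
  apply: (@le_trans _ _ (\int[mu]_(x in `[a, b]) g x)%:E); last first.
    by rewrite lee_fin; exact: (testing_truncated_bound n p1 C0 v0 lv tC ab V0).
  rewrite Rintegral_EFin//; apply: integrable_bounded.
  - by apply: measurable_gated; [exact: measurable_fun_ltr|exact: measurable_powR_comp].
  - by move=> x; apply: gated_ge0 => *; exact: powR_ge0.
  - exists (n.+1%:R `^ r) => x; exact: gated_powR_le.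
have vn0 := testing_ae_gt0 p0 C0 v0 lv tC ab V0.
have WE : (\int[mu]_(x in `[a, b]) ((v x)%:E^-1 `^ r) = \int[mu]_(x in \bigcup_n F n) ((v x)%:E^-1 `^ r))%E.
  rewrite [LHS]integral_mkcond [RHS]integral_mkcond; apply: ge0_ae_eq_integral => //.
  - by apply: (iffLR (measurable_restrictT _ (measurable_itv _))); exact: measurable_funTS.
  - apply: (iffLR (measurable_restrictT _ _)); last exact: measurable_funTS.
    by apply: bigcup_measurable => n _; exact: mF.
  - by move=> x _; rewrite patchE; case: ifPn => // _; exact: poweR_ge0.
  - by move=> x _; rewrite patchE; case: ifPn => // _; exact: poweR_ge0.
  apply: ae_imp vn0 => x h _; rewrite !patchE; case: ifPn => [/set_mem/= xab|].
    rewrite ifT//; apply/mem_set; move: (xab); rewrite in_itv/= => /h vx.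
    have {}vx : 0 < v x by rewrite lt_neqAle eq_sym vx v0.
    exists (Num.trunc (v x)^-1) => //; split=> //=.
    by rewrite -[ltRHS]invrK ltf_pV2 ?posrE ?invr_gt0// truncnS_gt.
  rewrite notin_setE => xab; rewrite ifF//; apply/negbTE; rewrite notin_setE => -[n _ [h1 _]].
  exact: xab.
have W : (\int[mu]_(x in `[a, b]) ((v x)%:E^-1 `^ r) <= B%:E)%E.
  have cvF : (\int[mu]_(x in F n) ((v x)%:E^-1 `^ r))%E @[n --> \oo] -->
      (\int[mu]_(x in \bigcup_n F n) ((v x)%:E^-1 `^ r))%E.
    apply: ge0_nondecreasing_set_cvg_integral => //.
    - apply/nondecreasing_seqP => n; rewrite subsetEset => x [xab /= h]; split=> //=.
      by apply: le_lt_trans h; rewrite lef_pV2 ?posrE// ler_nat.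
    - by move=> n; exact: measurable_funTS.
    - by move=> n x _; exact: poweR_ge0.
  rewrite WE; apply: cvge_le cvF.
  by near=> n; exact: FB.
have W0 : (0 <= \int[mu]_(x in `[a, b]) ((v x)%:E^-1 `^ r))%E.
  by apply: integral_ge0 => x _; exact: poweR_ge0.
have B0 : 0 <= B by exact: powR_ge0.
apply: (@le_trans _ _ (((b - a)^-1 * V)%:E * ((b - a)^-1 * B)%:E `^ (p - 1))%E).
  rewrite EFinM lee_wpmul2l//; first by rewrite mule_ge0// lee_fin ?invr_ge0 ltW.
  apply: gt0_ler_poweR; [exact: ltW| | |].
  - by rewrite in_itv/= leey andbT mule_ge0// lee_fin invr_ge0 ltW.
  - by rewrite in_itv/= leey andbT lee_fin mulr_ge0// invr_ge0 ltW.
  - by rewrite EFinM lee_wpmul2l// lee_fin invr_ge0 ltW.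
rewrite /= -EFinM lee_fin powRM ?invr_ge0 ?(ltW ba)// /B -powRrM /r mulVf ?gt_eqF//.
rewrite powRr1; last by rewrite divr_ge0 ?(ltW V0)// mulr_ge0 ?powR_ge0// ltW.
have -> : (b - a)^-1 `^ (p - 1) = (b - a) / (b - a) `^ p.
  by rewrite -[(b - a)^-1]powR_inv1 ?(ltW ba)// -powRrM mulN1r opprB powRB ?powRr1 ?(ltW ba)// (gt_eqF ba) implybT.
have lp : 0 < (b - a) `^ p by rewrite powR_gt0.
rewrite le_eqVlt; apply/orP; left; apply/eqP; field.
by rewrite !gt_eqF.
Unshelve. all: by end_near. Qed.

Lemma testing_muckenhoupt p v C : 1 <= p -> 0 < C -> (forall x, 0 <= v x) ->
  locally_integrable setT v -> testing p v C -> muckenhoupt p v.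
Proof.
rewrite le_eqVlt => /predU1P[<-|p1]; first exact: testing_muckenhoupt1.
exact: testing_muckenhouptp.
Qed.

End testing.

(** * Affine changes of variables and finite differences *)

Section affine.
Variable R : realType.
Notation mu := (@lebesgue_measure R).

Definition affine (c d x : R) : R := d + c * x.

Lemma measurable_affine c d : measurable_fun setT (affine c d).
Proof. by apply: measurable_funD => //; exact: measurable_funM. Qed.

Lemma lebesgue_measure_affine c d (A : set R) : 0 < c -> measurable A ->
  (mu A = c%:E * mu (affine c d @^-1` A))%E.
Proof.
move=> c0 mA.
unshelve refine (@eq_trans _ _ (mscale (NngNum (ltW c0)) (pushforward mu (affine c d : _ -> measurableTypeR R)) A) _ _ _) => //.
  exact: measurable_affine.
apply: lebesgue_measure_unique => // _ [[a b] _ <-]; rewrite /mscale/= /pushforward.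
pose J : interval R := `](a - d) / c, (b - d) / c].
have E : affine c d @^-1` `]a, b] = [set` J].
  apply/seteqP; split=> x /=; rewrite /affine !in_itv/= ltr_pdivrMr// ler_pdivlMr// (mulrC x).
    by rewrite ltrBlDl lerBrDl.
  by rewrite ltrBlDl lerBrDl.
transitivity (c%:E * mu [set` J])%E; last by rewrite -E.
rewrite !lebesgue_measure_itv/= !lte_fin ltr_pM2r ?invr_gt0// ltrD2r.
case: ifP => ab; last by rewrite mule0.
by rewrite -!EFinB -EFinM; congr EFin; field; rewrite gt_eqF.
Qed.

(** Reduces to the image of Lebesgue measure under an affine map
([lebesgue_measure_affine]). *)
Lemma ae_affine c d (P : R -> Prop) : 0 < c -> {ae mu, forall x, P x} ->
  {ae mu, forall x, P (affine c d x)}.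
Proof.
move=> c0 [N [mN N0 NP]]; exists (affine c d @^-1` N); split.
- by rewrite -[X in measurable X]setTI; exact: measurable_affine.
- have := lebesgue_measure_affine d c0 mN; rewrite N0 => /esym/eqP.
  by rewrite mule_eq0 eqe gt_eqF//= => /eqP.
- by move=> x /= h; apply: NP.
Qed.

Lemma ge0_integral_translate (d : R) (f : R -> \bar R) : measurable_fun setT f ->
  (forall x, (0 <= f x)%E) -> (\int[mu]_x f x = \int[mu]_x f (d + x)%R)%E.
Proof.
move=> mf f0.
rewrite [RHS](_ : _ = \int[mu]_(x in (affine 1 d : _ -> measurableTypeR R) @^-1` setT) (f \o affine 1 d) x)%E; last first.
  by rewrite preimage_setT; apply: eq_integral => x _; rewrite /= /affine mul1r.
have ma : measurable_fun [set: measurableTypeR R] (affine 1 d : _ -> measurableTypeR R).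
  exact: measurable_affine.
rewrite -(ge0_integral_pushforward ma)//.
apply: eq_measure_integral => A mA _.
by have := lebesgue_measure_affine d ltr01 mA; rewrite mul1e.
Qed.

End affine.

Section forward_difference.
Variable R : realType.
Implicit Types (f : R -> R) (h x : R).

Lemma forward_difference_recE k h f x :
  forward_difference k.+1 h f x =
  forward_difference k h f (x + h) - forward_difference k h f x.
Proof.
rewrite /forward_difference big_ord_recl /= bin0 subn0 mul0r addr0 mulr1.
rewrite [X in _ = _ - X](_ : _ = - (-1) ^+ k.+1 * f x +
   \sum_(i < k) (-1) ^+ (k - i.+1) * 'C(k, i.+1)%:R * f (x + i.+1%:R * h)); last first.
  by rewrite big_ord_recl/= bin0 subn0 mul0r addr0 mulr1 exprS mulN1r opprK.
rewrite opprD mulNr opprK [RHS]addrCA; congr (_ + _).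
rewrite (eq_bigr (fun i : 'I_k.+1 =>
   (-1) ^+ (k - i) * 'C(k, i)%:R * f (x + h + i%:R * h) +
   (-1) ^+ (k - i) * 'C(k, i.+1)%:R * f (x + i.+1%:R * h))); last first.
  move=> i _; rewrite /bump/= add1n subSS binS natrD -natr1.
  by rewrite [x + h + _](_ : _ = x + (i%:R + 1) * h); ring.
rewrite big_split/=; congr (_ + _).
rewrite big_ord_recr/= bin_small// mulr0 mul0r addr0 -sumrN.
by apply: eq_bigr => i _; rewrite -[(k - i)%N]prednK ?subn_gt0// -subnS exprS; ring.
Qed.

Lemma forward_difference_poly k h (P : {poly R}) x : (size P <= k)%N ->
  forward_difference k h (horner P) x = 0.
Proof.
elim: k P x => [|k IH] P x sP.
  move: sP; rewrite leqn0 size_poly_eq0 => /eqP->.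
  by rewrite /forward_difference big1// => i _; rewrite horner0 mulr0.
rewrite forward_difference_recE.
have fdB f g y : forward_difference k h f y - forward_difference k h g y =
    forward_difference k h (fun z => f z - g z) y.
  rewrite /forward_difference -sumrB; apply: eq_bigr => i _; ring.
have -> : forward_difference k h (horner P) (x + h) =
    forward_difference k h (horner (P \Po ('X + h%:P))) x.
  apply: eq_bigr => i _; rewrite horner_comp !hornerE.
  by congr (_ * _.[_]); ring.
rewrite fdB -(IH (P \Po ('X + h%:P) - P) x).
  by apply: eq_bigr => i _; rewrite !hornerE.
have [->|P0] := eqVneq P 0; first by rewrite comp_poly0 subr0 size_poly0.
rewrite -ltnS; apply: leq_trans sP.
have szP : size (P \Po ('X + h%:P)) = size P by rewrite size_comp_poly2// size_XaddC.
have sz0 : (0 < size P)%N by rewrite lt0n size_poly_eq0.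
rewrite -[X in (_ < X)%N](prednK sz0) ltnS; apply/leq_sizeP => j.
rewrite leq_eqVlt coefB => /predU1P[<-|].
  have := @lead_coef_comp _ P ('X + h%:P); rewrite /lead_coef szP size_XaddC => ->//.
  by rewrite coefD coefX coefC addr0 expr1n mulr1 subrr.
rewrite prednK// => Pj; rewrite !nth_default ?subr0 ?szP//.
Qed.

(** Differences of order k do not see polynomials of degree less than k; this is
what relates them to polynomial approximation. *)
Lemma forward_difference_sub_poly k h f (P : {poly R}) x : (size P <= k)%N ->
  forward_difference k h f x = forward_difference k h (fun y => f y - P.[y]) x.
Proof.
move=> sP; rewrite -[LHS]subr0 -(forward_difference_poly h x sP) /forward_difference -sumrB.
by apply: eq_bigr => j _; rewrite mulrBr.
Qed.

Lemma forward_difference_bound k h f x (A : R) :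
  (forall j, (j <= k)%N -> `|f (x + j%:R * h)| <= A) ->
  `|forward_difference k h f x| <= 2 ^+ k * A.
Proof.
move=> fA; rewrite /forward_difference (le_trans (ler_norm_sum _ _ _))//.
rewrite -[2]/(1 + 1) exprDn mulr_suml; apply: ler_sum => j _.
rewrite !expr1n mulr1 -mulr_natl mulr1 !normrM normrX normrN1 expr1n mul1r.
by rewrite ger0_norm// ler_wpM2l// fA// -ltnS.
Qed.

End forward_difference.

(** * Muckenhoupt weights and the dyadic functional *)

Section sufficiency.
Variable R : realType.
Implicit Types (p q a b s alpha lam C : R) (v f g : R -> R) (k : nat).
Notation mu := (@lebesgue_measure R).

(** The averaging inequality on the interval, combined with the lower bound for
the average of |g| given by the selection. *)
Lemma selected_itv p v C s lam alpha g i : 0 < p -> 0 < s -> 0 < C -> 0 < lam ->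
  (forall x, 0 <= v x) -> locally_integrable setT v -> averaging p v C ->
  measurable_fun setT g ->
  ((lam * (2 ^ i.1) `^ (1 + s))%:E <= \int[mu]_(x in dyadic_itv alpha i) `|g x|%:E)%E ->
  ((size_pow (p * s) i)%:E * wmeas v (dyadic_itv alpha i) <=
   (C / lam `^ p)%:E * \int[mu]_(x in dyadic_itv alpha i) (`|g x| `^ p * v x)%:E)%E.
Proof.
case: i => j m p0 s0 C0 lam0 v0 lv avg mg; rewrite !dyadic_itvE/=.
set c := grid alpha j m; set l := 2 ^ j; have l0 : 0 < l by exact: exprz2_gt0.
move=> hsel; have := avg c l g l0 mg.
have Vfin : wmeas v `[c, (c + l)%R[%classic \is a fin_num by exact: wmeas_fin.
have V0 : (0 <= wmeas v `[c, (c + l)%R[%classic)%E.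
  by apply: integral_ge0 => x _; rewrite lee_fin.
set V := wmeas _ _ in Vfin V0 *; set X := (\int[mu]_(x in _) _)%E in hsel *.
have E0 : (0 <= \int[mu]_(x in `[c, (c + l)%R[) (`|g x| `^ p * v x)%:E)%E.
  by apply: integral_ge0 => x _; rewrite lee_fin mulr_ge0 ?powR_ge0.
set E := (\int[mu]_(x in _) (_ * _)%:E)%E in E0 *.
move=> h.
have lamp : 0 < lam `^ p by exact: powR_gt0.
have lp : 0 < l `^ p by exact: powR_gt0.
have h2 : ((lam `^ p * (l `^ p * l `^ (p * s)))%:E * V <= (C * l `^ p)%:E * E)%E.
  apply: le_trans h; apply: lee_wpmul2r => //.
  have -> : ((lam `^ p * (l `^ p * l `^ (p * s)))%:E = ((lam * l `^ (1 + s))%:E) `^ p)%E.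
    rewrite /= powRM ?(ltW lam0) ?powR_ge0// -powRrM mulrDl mul1r (mulrC s) powRD//.
    by rewrite (gt_eqF l0) implybT.
  apply: gt0_ler_poweR => //; first exact: ltW.
  - by rewrite in_itv/= leey andbT lee_fin mulr_ge0 ?powR_ge0// ltW.
  - by rewrite in_itv/= leey andbT integral_ge0.
have -> : (size_pow (p * s) (j, m))%:E = ((lam `^ p * l `^ p)^-1%:E * (lam `^ p * (l `^ p * l `^ (p * s)))%:E)%E.
  rewrite -EFinM /size_pow/= -/l; congr EFin; field; by rewrite !gt_eqF.
rewrite -muleA; apply: (@le_trans _ _ ((lam `^ p * l `^ p)^-1%:E * ((C * l `^ p)%:E * E))%E).
  by apply: lee_wpmul2l => //; rewrite lee_fin invr_ge0 mulr_ge0// ltW.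
rewrite muleA -EFinM le_eqVlt; apply/orP; left; apply/eqP; congr (_%:E * _)%E.
by field; rewrite !gt_eqF.
Qed.

Lemma selected_sum p v C s lam alpha g (F : seq (int * int)) : 0 < p -> 0 < s -> 0 < C ->
  0 < lam -> alpha *+ 3 \is a Num.int ->
  (forall x, 0 <= v x) -> locally_integrable setT v -> averaging p v C ->
  measurable_fun setT g -> uniq F ->
  (forall i, i \in F ->
    ((lam * (2 ^ i.1) `^ (1 + s))%:E <= \int[mu]_(x in dyadic_itv alpha i) `|g x|%:E)%E) ->
  ((lam `^ p)%:E * \sum_(i <- F) ((size_pow (p * s) i)%:E * wmeas v (dyadic_itv alpha i)) <=
   (geo_sum (p * s) * C)%:E * energy p v g)%E.
Proof.
move=> p0 s0 C0 lam0 a3 v0 lv avg mg uF hF; have [mv _ _] := lv.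
have lamp : 0 < lam `^ p by exact: powR_gt0.
have ps0 : 0 < p * s by exact: mulr_gt0.
have mg' : measurable_fun setT (fun x => `|g x| `^ p).
  by apply: measurable_powR_comp; exact: measurableT_comp.
have h : (\sum_(i <- F) (size_pow (p * s) i)%:E * wmeas v (dyadic_itv alpha i) <=
    (geo_sum (p * s) * (C / lam `^ p))%:E * energy p v g)%E.
  apply: (@packing R alpha (p * s) (C / lam `^ p) v (fun x => `|g x| `^ p * v x)) => //.
  - by rewrite divr_ge0// ltW.
  - by move=> x; rewrite mulr_ge0 ?powR_ge0.
  - exact: measurable_funM.
  - move=> i iF; split; first exact: subsetT.
    exact: selected_itv (hF i iF).
apply: (@le_trans _ _ ((lam `^ p)%:E * ((geo_sum (p * s) * (C / lam `^ p))%:E * energy p v g))%E).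
  by apply: lee_wpmul2l => //; rewrite lee_fin ltW.
rewrite muleA -EFinM le_eqVlt; apply/orP; left; apply/eqP; congr (_%:E * _)%E.
by field; rewrite gt_eqF.
Qed.

Lemma integrable_dyadic alpha i f : locally_integrable setT f ->
  mu.-integrable (dyadic_itv alpha i) (EFin \o f).
Proof.
move=> lf; case: i => j m; rewrite dyadic_itvE; apply: (@integrableS _ _ _ mu `[grid alpha j m, grid alpha j m + 2 ^ j]%classic) => //.
  exact: subset_itv_co_cc.
exact: locally_integrable_itv.
Qed.

Lemma dyadic_taylor k f g alpha i : locally_integrable setT f ->
  is_weak_derivative k.+1 f g ->
  exists2 P : {poly R}, (size P <= k.+1)%N & {ae mu, forall x, dyadic_itv alpha i x ->
    `|f x - P.[x]| <= (2 ^ i.1) ^+ k * \int[mu]_(t in dyadic_itv alpha i) `|g t|}.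
Proof.
case: i => j m lf wfg; rewrite dyadic_itvE/=; have l0 := exprz2_gt0 R j.
set c := grid _ _ _; have cl : c < c + 2 ^ j by rewrite ltrDl.
have [P sP hP] := weak_derivative_taylor cl lf wfg; exists P => //.
have -> : \int[mu]_(t in `[c, c + 2 ^ j[) `|g t| = \int[mu]_(t in `[c, c + 2 ^ j]) `|g t|.
  apply: Rintegral_itv_bndo_bndc; have [lg _] := wfg.
  apply: integrableS (integrable_norm (locally_integrable_itv c (c + 2 ^ j) lg)) => //.
  exact: subset_itv_co_cc.
by apply: ae_co; move: hP; rewrite [c + _ - c]addrAC subrr add0r.
Qed.

Lemma poly_error_dyadic k : exists2 C : R, 0 < C & forall f g alpha i,
  locally_integrable setT f -> is_weak_derivative k.+1 f g ->
  (poly_error k.+1 f (dyadic_itv alpha i) <=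
   (C * (2 ^ i.1) ^+ k.+1 * \int[mu]_(t in dyadic_itv alpha i) `|g t|)%:E)%E.
Proof.
have [C C0 hC] := poly_error_le R k.+1; exists C => // f g alpha [j m] lf wfg.
have [P sP hP] := dyadic_taylor alpha (j, m) lf wfg.
have l0 := exprz2_gt0 R j.
have := integrable_dyadic alpha (j, m) lf.
move: hP; rewrite dyadic_itvE/=; set c := grid _ _ _; set M := \int[mu]_(t in _) _ => hP intf.
have M0 : 0 <= M by apply: Rintegral_ge0.
apply: le_trans (hC c (2 ^ j) f P ((2 ^ j) ^+ k * M) l0 _ intf sP _) _.
- by rewrite mulr_ge0// exprn_ge0// ltW.
- apply: ae_imp hP => x h /andP[cx xc]; apply: h.
  by rewrite /= in_itv/= (ltW cx).
- by rewrite lee_fin exprS le_eqVlt; apply/orP; left; apply/eqP; ring.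
Qed.

(** With beta = 2, selection says that the average of |g| over Q exceeds a multiple
of lambda |Q| and the weights are |Q|^p: this is [selected_sum] with s = 1. *)
Lemma muckenhoupt_dyadic p v k : 1 <= p -> (forall x, 0 <= v x) ->
  locally_integrable setT v -> muckenhoupt p v -> exists2 C : R, 0 < C &
  forall alpha f g, alpha *+ 3 \is a Num.int -> locally_integrable setT f ->
    is_weak_derivative k.+1 f g ->
    (dyadic_functional p 2 alpha k.+1 v f <= C%:E * energy p v g)%E.
Proof.
move=> p1 v0 lv mv; have p0 : 0 < p by rewrite (lt_le_trans ltr01).
have [C C0 avg] := muckenhoupt_average p1 v0 lv mv.
have [C1 C10 hpe] := poly_error_dyadic k.
exists (C1 `^ p * (geo_sum (p * 1) * C)).
  by rewrite !mulr_gt0 ?powR_gt0// geo_sum_gt0// mulr1.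
move=> alpha f g a3 lf wfg; have [[mg _ _] _] := wfg.
apply: ub_ereal_sup => _ [lam + <-]; rewrite /= in_itv/= andbT => lam0.
have lamp : 0 < lam `^ p by exact: powR_gt0.
have E0 : (0 <= energy p v g)%E.
  by apply: integral_ge0 => x _; rewrite lee_fin mulr_ge0 ?powR_ge0.
rewrite muleC -lee_pdivlMr//.
apply: ub_ereal_sup => _ [A [finA AS] <-].
rewrite lee_pdivlMr// muleC fsbig_finite//=.
have idx (Q : set R) : exists i, A Q -> Q = dyadic_itv alpha i.
  have [/AS[/dyadicP[i Qi] _]|nQ] := pselect (A Q); first by exists i.
  by exists (0, 0) => /nQ.
pose ix Q := projT1 (cid (idx Q)).
have ixP Q : A Q -> Q = dyadic_itv alpha (ix Q) by exact: (projT2 (cid (idx Q))).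
pose F := map ix (finmap.enum_fset (fset_set A)).
have uF : uniq F.
  rewrite map_inj_in_uniq; first exact: finmap.fset_uniq.
  move=> Q Q'.
  by rewrite !in_fset_set// !inE => /ixP QE /ixP QE' e; rewrite QE QE' e.
have -> : (\sum_(i <- finmap.enum_fset (fset_set A)) (len i `^ (p * (2 - 1)))%:E * wmeas v i =
    \sum_(i <- F) (size_pow (p * 1) i)%:E * wmeas v (dyadic_itv alpha i))%E.
  rewrite /F big_map; apply: eq_big_seq => Q; rewrite in_fset_set// inE => /ixP QE.
  by rewrite -QE {1}QE len_dyadic_itv /size_pow; congr ((_ `^ (p * _))%:E * _)%E; ring.
have h := @selected_sum p v C 1 (lam / C1) alpha g F p0 ltr01 C0 (divr_gt0 lam0 C10) a3 v0 lv avg mg uF.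
have hF i : i \in F -> ((lam / C1 * (2 ^ i.1) `^ (1 + 1))%:E <= \int[mu]_(x in dyadic_itv alpha i) `|g x|%:E)%E.
  move=> /mapP[Q]; rewrite in_fset_set// inE => AQ ->.
  have [_] := AS _ AQ; rewrite {1 2}(ixP _ AQ) len_dyadic_itv; set i' := ix Q => sel.
  have [lg _] := wfg.
  rewrite (Rintegral_EFin (measurable_dyadic_itv alpha i') (integrable_norm (integrable_dyadic alpha i' lg))) lee_fin.
  have := lt_le_trans sel (hpe f g alpha i' lf wfg); rewrite lte_fin.
  have l0 := exprz2_gt0 R i'.1; set l := 2 ^ i'.1 in l0 *; set M := \int[mu]_(x in _) _.
  have -> : l `^ (2 + k.+1%:R) = l `^ (1 + 1) * l ^+ k.+1.
    by rewrite powRD ?powR_mulrn ?(ltW l0)// (gt_eqF l0) implybT.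
  rewrite mulrA (mulrAC C1) ltr_pM2r ?exprn_gt0// => {}sel.
  by rewrite mulrAC ler_pdivrMr// [leRHS]mulrC ltW.
have {}h := h hF.
have -> : (lam `^ p = C1 `^ p * (lam / C1) `^ p)%R.
  by rewrite -powRM ?(ltW C10) ?divr_ge0 ?(ltW lam0) ?(ltW C10)// mulrC divfK// gt_eqF.
rewrite !EFinM -!muleA lee_pmul2l ?lte_fin ?powR_gt0//.
by move: h; rewrite EFinM muleA.
Qed.

End sufficiency.

(** * Muckenhoupt weights and the difference functional *)

Section difference.
Variable R : realType.
Implicit Types (p q a b s alpha lam C r : R) (v f g : R -> R) (k : nat).
Notation mu := (@lebesgue_measure R).

Definition dyadic_term alpha r (sel : pred (int * int)) (n : nat) (x : R) : R :=
  oapp (fun i => if sel i then size_pow r i * \1_(dyadic_itv alpha i) x else 0) 0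
    (pickle_inv n).

(** The sum of |Q|^r over the selected intervals Q that contain x, as a series
over an enumeration of all dyadic intervals. *)
Definition dyadic_sum alpha r sel x : \bar R :=
  (\sum_(0 <= n <oo) (dyadic_term alpha r sel n x)%:E)%E.

Lemma dyadic_term_ge0 alpha r (sel : pred (int * int)) n x : 0 <= dyadic_term alpha r sel n x.
Proof.
rewrite /dyadic_term; case: pickle_inv => //= i; case: ifP => // _.
by rewrite mulr_ge0 ?size_pow_ge0.
Qed.

Lemma measurable_dyadic_term alpha r (sel : pred (int * int)) n : measurable_fun setT (dyadic_term alpha r sel n).
Proof.
rewrite /dyadic_term; case: pickle_inv => /= [i|]; last exact: measurable_cst.
case: (sel i); last exact: measurable_cst.
apply: measurable_funM; first exact: measurable_cst.
by apply: measurable_indic; exact: measurable_dyadic_itv.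
Qed.

Lemma dyadic_sum_ge0 alpha r (sel : pred (int * int)) x : (0 <= dyadic_sum alpha r sel x)%E.
Proof. by apply: nneseries_ge0 => n _ _; rewrite lee_fin dyadic_term_ge0. Qed.

Lemma measurable_dyadic_sum alpha r (sel : pred (int * int)) : measurable_fun setT (dyadic_sum alpha r sel).
Proof.
apply: ge0_emeasurable_sum => n.
  by move=> x _ _; rewrite lee_fin dyadic_term_ge0.
by move=> _; apply/measurable_EFinP; exact: measurable_dyadic_term.
Qed.

Lemma size_pow_le_dyadic_sum alpha r (sel : pred (int * int)) i x : sel i -> dyadic_itv alpha i x ->
  ((size_pow r i)%:E <= dyadic_sum alpha r sel x)%E.
Proof.
move=> si xi; apply: le_trans (nneseries_lim_ge (pickle i).+1 _); last first.
  by move=> n _ _; rewrite lee_fin dyadic_term_ge0.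
rewrite big_nat_recr//= /dyadic_term pickleK_inv/= si indicE mem_set// mulr1.
by rewrite leeDr// sume_ge0// => n _; rewrite lee_fin dyadic_term_ge0.
Qed.

Lemma integral_dyadic_sum p v C s lam alpha g (sel : pred (int * int)) : 0 < p -> 0 < s ->
  0 < C -> 0 < lam -> alpha *+ 3 \is a Num.int ->
  (forall x, 0 <= v x) -> locally_integrable setT v -> averaging p v C ->
  measurable_fun setT g ->
  (forall i, sel i ->
    ((lam * (2 ^ i.1) `^ (1 + s))%:E <= \int[mu]_(x in dyadic_itv alpha i) `|g x|%:E)%E) ->
  ((lam `^ p)%:E * \int[mu]_x (dyadic_sum alpha (p * s) sel x * (v x)%:E) <=
   (geo_sum (p * s) * C)%:E * energy p v g)%E.
Proof.
move=> p0 s0 C0 lam0 a3 v0 lv avg mg hsel; have [mv _ _] := lv.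
have lamp : 0 < lam `^ p by exact: powR_gt0.
pose r := p * s.
have -> : (\int[mu]_x (dyadic_sum alpha r sel x * (v x)%:E) =
    \sum_(0 <= n <oo) \int[mu]_x ((v x)%:E * (dyadic_term alpha r sel n x)%:E))%E.
  rewrite -integral_nneseries//.
  - apply: eq_integral => x _; rewrite muleC /dyadic_sum nneseriesZl// => n _.
    by rewrite lee_fin dyadic_term_ge0.
  - by move=> n; apply: emeasurable_funM; apply/measurable_EFinP => //; exact: measurable_dyadic_term.
  - by move=> n x _; rewrite mule_ge0 ?lee_fin ?dyadic_term_ge0.
have int0 n : (0 <= \int[mu]_x ((v x)%:E * (dyadic_term alpha r sel n x)%:E))%E.
  by apply: integral_ge0 => x _; rewrite mule_ge0 ?lee_fin ?dyadic_term_ge0.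
rewrite muleC -lee_pdivlMr//; apply: lime_le.
  by apply: is_cvg_nneseries => n _ _.
apply: nearW => N; rewrite lee_pdivlMr// muleC.
pose F := [seq i <- pmap (pickle_inv (T := (int * int)%type)) (index_iota 0 N) | sel i].
have -> : (\sum_(0 <= n < N) \int[mu]_x ((v x)%:E * (dyadic_term alpha r sel n x)%:E) =
    \sum_(i <- F) (size_pow r i)%:E * wmeas v (dyadic_itv alpha i))%E.
  rewrite [RHS]big_filter [RHS]big_mkcond [RHS]big_pmap; apply: eq_bigr => n _.
  rewrite /dyadic_term; case: pickle_inv => [i|]/=; last first.
    by under eq_integral do rewrite mule0; rewrite integral0.
  case: ifPn => _; last by under eq_integral do rewrite mule0; rewrite integral0.
  rewrite /wmeas [X in (_ * X)%E]integral_mkcond -ge0_integralZl//.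
  - apply: eq_integral => x _; rewrite patchE indicE; case: ifPn => _.
      by rewrite mulr1 muleC.
    by rewrite mulr0 !mule0.
  - apply: measurable_EFin_patch => //; exact: measurable_dyadic_itv.
  - by move=> x _; rewrite patchE; case: ifPn; rewrite ?lee_fin.
  - by rewrite lee_fin size_pow_ge0.
apply: (@selected_sum _ p v C s) => //.
- by rewrite filter_uniq// (pmap_uniq pickle_invK)// iota_uniq.
- by move=> i; rewrite mem_filter => /andP[si _]; exact: hsel.
Qed.

Lemma measurable_forward_difference k f : measurable_fun setT f ->
  measurable_fun setT (fun z : R * R => forward_difference k z.2 f z.1).
Proof.
move=> mf; apply: measurable_sum => j; apply: measurable_funM; first exact: measurable_cst.
apply: measurableT_comp mf _; apply: measurable_funD; first exact: measurable_fst.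
by apply: measurable_funM => //; exact: measurable_snd.
Qed.

Lemma measurable_E_set lam t k f : measurable_fun setT f ->
  measurable_fun setT (\1_(E_set lam t k f) : R * R -> R).
Proof.
move=> mf.
have m2 : measurable_fun setT (fun z : R * R => `|z.2| : R).
  by apply: measurableT_comp => //; exact: measurable_snd.
have m3 : measurable_fun setT (fun z : R * R => lam * `|z.2| `^ (k%:R + t) : R).
  by apply: measurable_funM => //; exact: (measurableT_comp (measurable_powR _) m2).
have m4 : measurable_fun setT (fun z : R * R => `|forward_difference k z.2 f z.1| : R).
  by apply: measurableT_comp => //; exact: measurable_forward_difference.
have m5 := measurable_and (measurable_fun_ltr (@measurable_cst _ _ _ _ setT (0 : R)) m2) (measurable_fun_ltr m3 m4).
apply: (eq_measurable_fun _ _ (measurable_fun_ifT m5 (@measurable_cst _ _ _ _ setT (1 : R)) (@measurable_cst _ _ _ _ setT (0 : R)))).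
move=> z _ /=; rewrite indicE; case: ifPn => h.
  by rewrite mem_set//; case/andP: h; rewrite normr_gt0.
by rewrite memNset// => -[h1 h2]; move: h; rewrite normr_gt0 h1 h2.
Qed.

End difference.

Section difference_bound.
Variable R : realType.
Implicit Types (p q a b s alpha lam C r : R) (v f g : R -> R) (k : nat).
Notation mu := (@lebesgue_measure R).

Lemma ae_forall_count (T : countType) (Q : T -> R -> Prop) :
  (forall t, {ae mu, forall x, Q t x}) -> {ae mu, forall x, forall t, Q t x}.
Proof.
move=> h; pose P n x := forall t : T, unpickle n = Some t -> Q t x.
have : {ae mu, forall x, forall n, P n x}.
  apply: ae_foralln => n; rewrite /P; case: (unpickle n) => [t|].
    by apply: ae_imp (h t) => x ? t' [<-].
  by apply: aeW => x t.
by apply: ae_imp => x hx t; apply: (hx (pickle t)); rewrite pickleK.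
Qed.

(** The two shifts that occur in [dyadic_cover]. *)
Definition shift3 (b : bool) : R := if b then 1 / 3 else 0.

Lemma shift3_int (b : bool) : shift3 b *+ 3 \is a Num.int.
Proof.
case: b; rewrite /shift3 ?mul0rn//.
by have -> : (1 / 3 : R) *+ 3 = 1 by field.
Qed.

Lemma difference_cover k (x h : R) : h != 0 -> exists (b : bool) (i : int * int),
  [/\ forall j, (j <= k.+1)%N -> dyadic_itv (shift3 b) i (x + j%:R * h),
      `|h| <= 2 ^ i.1 & 2 ^ i.1 <= 6 * k.+1%:R * `|h|].
Proof.
move=> h0; pose a := Num.min x (x + k.+1%:R * h); pose c := Num.max x (x + k.+1%:R * h).
have k0 : (1 : R) <= k.+1%:R by rewrite ler1n.
have nh : 0 < `|h| by rewrite normr_gt0.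
have ca : c - a = k.+1%:R * `|h|.
  rewrite /a /c; have [hp|hn] := leP 0 h.
    rewrite max_r ?min_l ?lerDl ?mulr_ge0// ger0_norm//; ring.
  have kh : k.+1%:R * h <= 0 by rewrite mulr_ge0_le0// ltW.
  rewrite max_l ?min_r ?gerDl// ltr0_norm//; ring.
have ac : a < c by rewrite -subr_gt0 ca mulr_gt0// (lt_le_trans ltr01).
have [alpha [i [ha sub]]] := dyadic_cover ac; rewrite ca => h3 h6.
exists (alpha != 0), i; split.
- have -> : shift3 (alpha != 0) = alpha.
    case: ha => ->; first by rewrite eqxx.
    by rewrite mulf_neq0 ?invr_eq0 ?pnatr_eq0.
  move=> j jk; apply: sub; rewrite /= in_itv/= /a /c ge_min le_max.
  have jk' : (j%:R : R) <= k.+1%:R by rewrite ler_nat.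
  have [hp|hn] := leP 0 h.
    by rewrite lerDl mulr_ge0//= lerD2l ler_wpM2r// orbT.
  by rewrite lerD2l ler_wnM2r ?(ltW hn)//= ?orbT// gerDl mulr_ge0_le0// ltW.
- rewrite ltW// (le_lt_trans _ h3)// mulrA -[leLHS]mul1r ler_wpM2r//.
  by rewrite -[leLHS]mul1r ler_pM// ler1n.
- by rewrite -mulrA.
Qed.

(** The k-th difference of f equals that of f - P and is at most 2^(k+1) l^k M,
while it exceeds lam |h|^(k+1+s), which is at least a multiple of l^(k+1+s). *)
Lemma difference_selected k f (P : {poly R}) x h l lam s M : 0 < l -> 0 < lam -> 0 < s ->
  h != 0 -> (size P <= k.+1)%N -> l <= 6 * k.+1%:R * `|h| ->
  (forall j, (j <= k.+1)%N -> `|f (x + j%:R * h) - P.[x + j%:R * h]| <= l ^+ k * M) ->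
  lam * `|h| `^ (k.+1%:R + s) < `|forward_difference k.+1 h f x| ->
  lam / (2 ^+ k.+1 * (6 * k.+1%:R) `^ (k.+1%:R + s)) * l `^ (1 + s) <= M.
Proof.
move=> l0 lam0 s0 h0 sP lh fP hE.
have k0 : 0 < 6 * k.+1%:R :> R by rewrite mulr_gt0.
have e0 : 0 < k.+1%:R + s by rewrite addr_gt0.
have -> : 2 ^+ k.+1 * (6 * k.+1%:R) `^ (k.+1%:R + s) = (6 * k.+1%:R) `^ (k.+1%:R + s) * 2 ^+ k.+1 :> R by rewrite mulrC.
have w0 : 0 < (6 * k.+1%:R) `^ (k.+1%:R + s) by exact: powR_gt0.
have h1 : `|forward_difference k.+1 h f x| <= 2 ^+ k.+1 * (l ^+ k * M).
  rewrite (forward_difference_sub_poly h f x sP).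
  exact: forward_difference_bound.
have h2 : l `^ (k.+1%:R + s) <= (6 * k.+1%:R) `^ (k.+1%:R + s) * `|h| `^ (k.+1%:R + s).
  by rewrite -powRM ?(ltW k0)// ge0_ler_powR ?nnegrE ?(ltW e0) ?(ltW l0)// mulr_ge0// ltW.
have lE : l `^ (k.+1%:R + s) = l `^ (1 + s) * l ^+ k.
  have -> : k.+1%:R + s = (1 + s) + k%:R by rewrite -natr1; ring.
  by rewrite powRD ?powR_mulrn ?(ltW l0)// (gt_eqF l0) implybT.
have h3 : lam * (l `^ (1 + s) * l ^+ k) <= (6 * k.+1%:R) `^ (k.+1%:R + s) * (2 ^+ k.+1 * (l ^+ k * M)).
  rewrite -lE (@le_trans _ _ (lam * ((6 * k.+1%:R) `^ (k.+1%:R + s) * `|h| `^ (k.+1%:R + s))))//.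
    by rewrite ler_wpM2l// ltW.
  by rewrite mulrCA ler_wpM2l ?(ltW w0)// ltW// (lt_le_trans hE).
rewrite mulrAC ler_pdivrMr ?mulr_gt0 ?exprn_gt0//.
rewrite -(@ler_pM2r _ (l ^+ k)) ?exprn_gt0//.
by move: h3; set A := _ `^ (_ + s); set B := 2 ^+ _; set L := l ^+ k; lra.
Qed.

Definition selected lam s g (b : bool) : pred (int * int) := fun i =>
  lam * (2 ^ i.1) `^ (1 + s) <= \int[mu]_(t in dyadic_itv (shift3 b) i) `|g t|.

(** Sum over both grids; it dominates |h|^r for all h in the section of the level
set at x, so its integral against v bounds the functional. *)
Definition maximal_sum r lam s g x : \bar R :=
  (dyadic_sum (shift3 false) r (selected lam s g false) x +
   dyadic_sum (shift3 true) r (selected lam s g true) x)%E.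

Lemma maximal_sum_ge0 r lam s g x : (0 <= maximal_sum r lam s g x)%E.
Proof. by rewrite adde_ge0// dyadic_sum_ge0. Qed.

(** The polynomial approximation holds at almost every point only.  It holds at
almost every x and, x being fixed, at x + jh for almost every h, since affine maps
preserve null sets. *)
Lemma difference_dominated k f g lam s r : 0 < lam -> 0 < s -> 0 < r ->
  locally_integrable setT f -> is_weak_derivative k.+1 f g ->
  {ae mu, forall x, {ae mu, forall h, E_set lam s k.+1 f (x, h) ->
    ((`|h| `^ r)%:E <=
     maximal_sum r (lam / (2 ^+ k.+1 * (6 * k.+1%:R) `^ (k.+1%:R + s))) s g x)%E}}.
Proof.
move=> lam0 s0 r0 lf wfg.
set lam' := lam / _.
have hex (bi : bool * (int * int)%type) : exists Q : {poly R}, (size Q <= k.+1)%N /\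
    {ae mu, forall y, dyadic_itv (shift3 bi.1) bi.2 y ->
      `|f y - Q.[y]| <= (2 ^ bi.2.1) ^+ k * \int[mu]_(t in dyadic_itv (shift3 bi.1) bi.2) `|g t|}.
  by have [Q sQ hQ] := dyadic_taylor (shift3 bi.1) bi.2 lf wfg; exists Q.
have [P hP] := choice hex.
pose good y := forall bi : bool * (int * int)%type, dyadic_itv (shift3 bi.1) bi.2 y ->
  `|f y - (P bi).[y]| <= (2 ^ bi.2.1) ^+ k * \int[mu]_(t in dyadic_itv (shift3 bi.1) bi.2) `|g t|.
have aegood : {ae mu, forall y, good y}.
  by apply: ae_forall_count => bi; exact: (hP bi).2.
apply: ae_imp (aegood) => x gx.
have : {ae mu, forall h, forall j, good (affine j.+1%:R x h)}.
  by apply: ae_foralln => j; exact: ae_affine.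
apply: ae_imp => h gh [/= h0 hE].
have [b [i [hi hl hu]]] := difference_cover k x h0.
have si : selected lam' s g b i.
  apply: (difference_selected (exprz2_gt0 _ _) lam0 s0 h0 (hP (b, i)).1 hu _ hE).
  move=> j jk; have := hi j jk; case: j jk => [_|j _].
    by rewrite mul0r addr0; exact: gx (b, i).
  exact: gh j (b, i).
have h1 : ((`|h| `^ r)%:E <= (size_pow r i)%:E)%E.
  by rewrite lee_fin /size_pow ge0_ler_powR ?nnegrE// ltW// exprz2_gt0.
apply: (le_trans h1).
have xi : dyadic_itv (shift3 b) i x by have := hi 0 isT; rewrite mul0r addr0.
have := size_pow_le_dyadic_sum r si xi; rewrite /maximal_sum.
case: b {si xi hi} => /le_trans; apply; first by rewrite leeDr// dyadic_sum_ge0.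
by rewrite leeDl// dyadic_sum_ge0.
Qed.

(** Up to a null set, E is contained in the interval of radius T^(1/r) around 0. *)
Lemma integral_le_powR (E : set R) (T : \bar R) r : 0 < r ->
  measurable_fun setT (\1_E : R -> R) -> (0 <= T)%E ->
  {ae mu, forall h, E h -> ((`|h| `^ r)%:E <= T)%E} ->
  ((\int[mu]_h (\1_E h)%:E) `^ r <= (2 `^ r)%:E * T)%E.
Proof.
move=> r0 mE T0 hT; have r20 : 0 < 2 `^ r :> R by exact: powR_gt0.
case: T T0 hT => [t t0 hT|_ _|//]; last by rewrite gt0_muley ?lte_fin// leey.
rewrite lee_fin in t0; pose u := t `^ r^-1.
have u0 : 0 <= u by exact: powR_ge0.
have hI : (\int[mu]_h (\1_E h)%:E <= (2 * u)%:E)%E.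
  have -> : (2 * u)%:E = (\int[mu]_h (\1_(`[- u, u]) h)%:E)%E.
    rewrite integral_indic// setIT/= [RHS]lebesgue_measure_itv/= lte_fin.
    have [->|un] := eqVneq u 0; first by rewrite oppr0 ltxx mulr0.
    have u1 : 0 < u by rewrite lt_neqAle eq_sym un.
    by rewrite (lt_trans _ u1) ?oppr_lt0// -EFinB; congr EFin; ring.
  apply: ae_ge0_le_integral => //.
  - exact/measurable_EFinP.
  - by apply/measurable_EFinP; apply: measurable_indic.
  apply: ae_imp hT => h hE _; rewrite lee_fin !indicE; have [/set_mem/hE|//] := boolP (h \in E).
  rewrite lee_fin => ht; rewrite mem_set//= in_itv/= -ler_norml.
  have -> : `|h| = (`|h| `^ r) `^ r^-1 by rewrite -powRrM mulfV ?gt_eqF// powRr1.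
  by rewrite ge0_ler_powR ?nnegrE ?powR_ge0// invr_ge0 ltW.
have h0 : (0 <= \int[mu]_h (\1_E h)%:E)%E by apply: integral_ge0 => h _; rewrite lee_fin.
apply: (@le_trans _ _ ((2 * u)%:E `^ r)%E).
  by apply: gt0_ler_poweR => //; rewrite ?ltW// in_itv/= leey andbT ?lee_fin ?mulr_ge0.
by rewrite /= powRM// -powRrM mulVf ?gt_eqF// powRr1.
Qed.

End difference_bound.

Section muckenhoupt_difference.
Variable R : realType.
Implicit Types (p q s lam C : R) (b : bool) (v f g : R -> R) (k : nat).
Notation mu := (@lebesgue_measure R).

Lemma integral_maximal_sum p v C s lam g : 0 < p -> 0 < s -> 0 < C -> 0 < lam ->
  (forall x, 0 <= v x) -> locally_integrable setT v -> averaging p v C ->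
  locally_integrable setT g ->
  ((lam `^ p)%:E * \int[mu]_x (maximal_sum (p * s) lam s g x * (v x)%:E) <=
   (2 * (geo_sum (p * s) * C))%:E * energy p v g)%E.
Proof.
move=> p0 s0 C0 lam0 v0 lv avg lg; have [mv _ _] := lv; have [mg _ _] := lg.
have md b : measurable_fun setT (fun x =>
    dyadic_sum (shift3 R b) (p * s) (selected lam s g b) x * (v x)%:E)%E.
  by apply: emeasurable_funM; [exact: measurable_dyadic_sum|exact/measurable_EFinP].
have d0 b x : (0 <= dyadic_sum (shift3 R b) (p * s) (selected lam s g b) x * (v x)%:E)%E.
  by rewrite mule_ge0 ?lee_fin// dyadic_sum_ge0.
have hd b : ((lam `^ p)%:E * \int[mu]_x
      (dyadic_sum (shift3 R b) (p * s) (selected lam s g b) x * (v x)%:E) <=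
    (geo_sum (p * s) * C)%:E * energy p v g)%E.
  apply: integral_dyadic_sum => //; first exact: shift3_int.
  move=> i; rewrite /selected => si.
  by rewrite (Rintegral_EFin (measurable_dyadic_itv _ i) (integrable_norm (integrable_dyadic _ i lg))) lee_fin.
under eq_integral do rewrite /maximal_sum ge0_muleDl ?dyadic_sum_ge0//.
rewrite ge0_integralD//; [|exact: (md false)|exact: (md true)].
rewrite ge0_muleDr ?integral_ge0//.
rewrite mulrDl mul1r EFinD ge0_muleDl ?lee_fin ?mulr_ge0 ?(ltW C0) ?(ltW (geo_sum_gt0 _)) ?mulr_gt0//.
exact: leeD.
Qed.

(** With gamma = 1 the inner measure is Lebesgue measure in h, so the length of the
section of the level set to the power p/q is bounded by [maximal_sum]. *)
Lemma muckenhoupt_difference p q v k : 1 <= p -> 0 < q -> (forall x, 0 <= v x) ->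
  locally_integrable setT v -> muckenhoupt p v -> exists2 C : R, 0 < C &
  forall f g, locally_integrable setT f -> is_weak_derivative k.+1 f g ->
    (difference_functional p q 1 k.+1 v f <= C%:E * energy p v g)%E.
Proof.
move=> p1 q0 v0 lv mv; have p0 : 0 < p by rewrite (lt_le_trans ltr01).
have [mfv _ _] := lv.
have [C C0 avg] := muckenhoupt_average p1 v0 lv mv.
pose s := 1 / q; have s0 : 0 < s by rewrite divr_gt0.
pose r := p * s; have r0 : 0 < r by exact: mulr_gt0.
have rE : p / q = r by rewrite /r /s mul1r.
pose D := 2 ^+ k.+1 * (6 * k.+1%:R) `^ (k.+1%:R + s) : R.
have D0 : 0 < D by rewrite mulr_gt0 ?exprn_gt0// powR_gt0// mulr_gt0.
exists (D `^ p * 2 `^ r * (2 * (geo_sum r * C))).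
  by rewrite !mulr_gt0 ?powR_gt0// geo_sum_gt0.
move=> f g lf wfg; have [mf _ _] := lf; have [lg _] := wfg; have [mg _ _] := lg.
apply: ub_ereal_sup => _ [lam + <-]; rewrite /= in_itv/= andbT => lam0.
have lamD : 0 < lam / D by exact: divr_gt0.
rewrite rE.
pose T := maximal_sum r (lam / D) s g.
pose I x := (\int[mu]_h (\1_(E_set lam s k.+1 f) (x, h))%:E)%E.
have mE := measurable_E_set lam s k.+1 mf.
have mI : measurable_fun setT I.
  apply: (measurable_fun_fubini_tonelli_F (m2 := mu) (fun z : R * R => (\1_(E_set lam s k.+1 f) z)%:E)).
    exact/measurable_EFinP.
  by move=> z; rewrite lee_fin.
have -> : (\int[mu]_x ((\int[mu]_h (\1_(E_set lam s k.+1 f) (x, h) * `|h| `^ (1 - 1))%:E) `^ r * (v x)%:E) =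
   \int[mu]_x (I x `^ r * (v x)%:E))%E.
  apply: eq_integral => x _; congr (_ `^ _ * _)%E; apply: eq_integral => h _.
  by rewrite subrr powRr0 mulr1.
have hT : (\int[mu]_x (I x `^ r * (v x)%:E) <= (2 `^ r)%:E * \int[mu]_x (T x * (v x)%:E))%E.
  rewrite -ge0_integralZl//; last 2 first.
  - apply: emeasurable_funM; last exact/measurable_EFinP.
    by apply: emeasurable_funD; exact: measurable_dyadic_sum.
  - by move=> x _; rewrite mule_ge0 ?lee_fin// maximal_sum_ge0.
  apply: ae_ge0_le_integral => //.
  - by move=> x _; rewrite mule_ge0 ?lee_fin// poweR_ge0.
  - apply: emeasurable_funM; last exact/measurable_EFinP.
    exact: (measurableT_comp (measurable_poweR r) mI).
  - by move=> x _; rewrite !mule_ge0 ?lee_fin ?powR_ge0// maximal_sum_ge0.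
  - apply: measurable_funeM; apply: emeasurable_funM; last exact/measurable_EFinP.
    by apply: emeasurable_funD; exact: measurable_dyadic_sum.
  apply: ae_imp (difference_dominated lam0 s0 r0 lf wfg) => x hx _.
  rewrite muleA; apply: lee_wpmul2r; first by rewrite lee_fin.
  have e h : \1_(E_set lam s k.+1 f) (x, h) = \1_[set h | E_set lam s k.+1 f (x, h)] h :> R.
    by rewrite !indicE; congr (_%:R); apply/idP/idP; rewrite !inE.
  rewrite /I; under eq_integral do rewrite e.
  apply: integral_le_powR => //; last exact: maximal_sum_ge0.
  by apply: (eq_measurable_fun _ _ (measurable_fun_pair2 x mE)) => h _; exact: e.
have h2 := integral_maximal_sum p0 s0 C0 lamD v0 lv avg lg.
have -> : (lam `^ p = D `^ p * (lam / D) `^ p)%R.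
  by rewrite -powRM ?(ltW D0) ?(ltW lamD)// mulrC divfK// gt_eqF.
apply: (@le_trans _ _ ((D `^ p * (lam / D) `^ p)%:E * ((2 `^ r)%:E * \int[mu]_x (T x * (v x)%:E)))%E).
  by apply: lee_wpmul2l => //; rewrite lee_fin mulr_ge0 ?powR_ge0.
have -> : ((D `^ p * (lam / D) `^ p)%:E * ((2 `^ r)%:E * \int[mu]_x (T x * (v x)%:E)) =
    (D `^ p * 2 `^ r)%:E * (((lam / D) `^ p)%:E * \int[mu]_x (T x * (v x)%:E)))%E.
  by rewrite !muleA -!EFinM; congr (_%:E * _)%E; ring.
rewrite [X in (_ <= X * _)%E]EFinM -[X in (_ <= X)%E]muleA; apply: lee_wpmul2l => //.
by rewrite lee_fin mulr_ge0 ?powR_ge0.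
Qed.

End muckenhoupt_difference.

(** * Lower bounds for the functionals of an iterated primitive *)

Section test_functions.
Variable R : realType.
Implicit Types (p q a b l h x : R) (v f g : R -> R) (k : nat).
Notation mu := (@lebesgue_measure R).

Lemma norm_difference_first k h f x : (forall j, (0 < j <= k.+1)%N -> f (x + j%:R * h) = 0) ->
  `|forward_difference k.+1 h f x| = `|f x|.
Proof.
move=> f0; rewrite /forward_difference big_ord_recl big1 ?addr0; last first.
  by move=> j _; rewrite f0 ?mulr0// lift0 ltn_ord.
by rewrite /= bin0 mulr1 subn0 mul0r addr0 normrM normrX normrN1 expr1n mul1r.
Qed.

(** All the points x + jh with j > 0 are to the right of b, where f vanishes. *)
Lemma norm_difference_left k a b g l h x : a < b -> mu.-integrable `[a, b] (EFin \o g) ->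
  (forall t, 0 <= g t) -> 0 < l -> x <= a - l -> b <= x + h ->
  l ^+ k / k`!%:R * \int[mu]_(t in `[a, b]) g t <=
  `|forward_difference k.+1 h (tail_primitive k a b g) x|.
Proof.
move=> ab ig g0 l0 xa bx; have h0 : 0 < h by lra.
rewrite norm_difference_first.
  by rewrite (le_trans _ (ler_norm _))// tail_primitive_left_ge.
move=> [//|j] _; apply: tail_primitive_right => //.
by rewrite (le_trans bx)// lerD2l -[leLHS]mul1r ler_wpM2r ?(ltW h0)// ler1n.
Qed.

(** All the points x + jh with j > 0 are to the left of a, where f coincides with
a polynomial P of degree at most k; and f(x) = 0, so the difference of f - P
reduces to the single term P(x). *)
Lemma norm_difference_right k a b g l h x : a < b -> mu.-integrable `[a, b] (EFin \o g) ->
  (forall t, 0 <= g t) -> 0 < l -> b + l <= x -> x + h < a ->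
  l ^+ k / k`!%:R * \int[mu]_(t in `[a, b]) g t <=
  `|forward_difference k.+1 h (tail_primitive k a b g) x|.
Proof.
move=> ab ig g0 l0 bx xa; have h0 : h < 0 by lra.
have [P sP hP] := tail_poly k ab ig.
rewrite (forward_difference_sub_poly h _ x sP).
rewrite norm_difference_first; last first.
  move=> [//|j] _; rewrite hP; apply/eqP; rewrite subr_eq0; apply/eqP.
  have xja : x + j.+1%:R * h < a.
    by rewrite (le_lt_trans _ xa)// lerD2l -[leRHS]mul1r ler_wnM2r ?(ltW h0)// ler1n.
  apply: eq_Rintegral => t; rewrite inE/= in_itv/= => /andP[at_ _].
  by rewrite /tail_power (lt_le_trans xja at_).
rewrite tail_primitive_right//; last by lra.
rewrite sub0r normrN hP.
have -> : \int[mu]_(t in `[a, b]) (g t * ((t - x) ^+ k / k`!%:R)) =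
    \int[mu]_(t in `[a, b]) ((-1) ^+ k * (g t * ((x - t) ^+ k / k`!%:R))).
  apply: eq_Rintegral => t _; rewrite (_ : (t - x) ^+ k = (-1) ^+ k * (x - t) ^+ k); [by rewrite -mulrA mulrCA|by rewrite -exprNn opprB].
have ix : mu.-integrable `[a, b] (EFin \o (fun t => g t * ((x - t) ^+ k / k`!%:R))).
  apply: (@integrable_mul _ _ _ _ ((Num.max `|a - x| `|b - x|) ^+ k / k`!%:R)) => //.
    by apply: measurable_funM => //; apply: measurable_funX; apply: measurable_funB.
  move=> t; rewrite /= in_itv/= => tab.
  rewrite normrM [X in _ * X]ger0_norm ?invr_ge0// ler_wpM2r ?invr_ge0// normrX distrC.
  by rewrite lerXn2r ?nnegrE ?le_max ?normr_ge0// -le_max ler_dist_itv.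
rewrite RintegralZl// normrM normrX normrN1 expr1n mul1r (le_trans _ (ler_norm _))//.
rewrite -RintegralZl//; apply: le_Rintegral => //.
  exact: (@integrableZl _ _ _ mu _ (measurable_itv _) _ (EFin \o g)).
move=> t; rewrite /= in_itv/= => /andP[at_ tb].
have lty : l <= x - t by lra.
rewrite mulrC ler_wpM2l//.
by rewrite ler_wpM2r ?invr_ge0// lerXn2r ?nnegrE ?(ltW l0)// (le_trans _ lty)// ltW.
Qed.

Lemma integrable_powR_weight p v a b g : 1 <= p -> locally_integrable setT v ->
  measurable_fun setT g -> (forall x, 0 <= g x) -> (exists M, forall x, g x <= M) ->
  mu.-integrable `[a, b] (EFin \o (fun x => g x `^ p * v x)).
Proof.
move=> p1 lv mg g0 [M gM]; have p0 : 0 <= p by rewrite (le_trans ler01).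
have := @integrable_mul R `[a, b] v (fun x => g x `^ p) (M `^ p) (measurable_itv _) (locally_integrable_itv a b lv).
have -> : (fun x => v x * g x `^ p) = (fun x => g x `^ p * v x).
  by apply/funext => x; rewrite mulrC.
apply; first by apply: measurable_powR_comp; exact: measurable_funTS.
move=> x _; rewrite ger0_norm ?powR_ge0//.
by apply: ge0_ler_powR; rewrite ?nnegrE ?g0 ?(le_trans (g0 x) (gM x)).
Qed.

Lemma energy_patch p v a b g (s : R) : 1 <= p -> locally_integrable setT v ->
  `|s| = 1 -> measurable_fun setT g -> (forall x, 0 <= g x) -> (exists M, forall x, g x <= M) ->
  energy p v (fun x => s * (g \_ `[a, b]) x) = ((\int[mu]_(x in `[a, b]) (g x `^ p * v x))%:E)%E.
Proof.
move=> p1 lv s1 mg g0 gM; have p0 : p != 0 by rewrite gt_eqF// (lt_le_trans ltr01).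
rewrite -(Rintegral_EFin (measurable_itv _) (integrable_powR_weight a b p1 lv mg g0 gM)).
rewrite [RHS]integral_mkcond; apply: eq_integral => x _.
rewrite !patchE normrM s1 mul1r; case: ifPn => _; first by rewrite ger0_norm.
by rewrite normr0 powR0// mul0r.
Qed.

End test_functions.

Section necessity_difference.
Variable R : realType.
Implicit Types (p q gamma a b c l h x A C : R) (v f g : R -> R) (k : nat).
Notation mu := (@lebesgue_measure R).

(** The outcome of choosing lambda as half the level at which the k-th difference
is known to be large, when |h| ranges over [4l, 5l]; the minimum and the sum of
powers of 4 and 5 cover exponents of either sign. *)
Definition level_const q gamma k : R :=
  Num.min (4 `^ (gamma - 1)) (5 `^ (gamma - 1)) `^ q^-1 /
  (2 * (4 `^ (k%:R + gamma / q) + 5 `^ (k%:R + gamma / q))).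

Lemma level_const_gt0 q gamma k : 0 < level_const q gamma k.
Proof.
apply: divr_gt0; first by rewrite powR_gt0// lt_min !powR_gt0.
by rewrite mulr_gt0// addr_gt0// powR_gt0.
Qed.

Lemma powR_between l h e : 0 < l -> 4 * l <= `|h| <= 5 * l ->
  Num.min (4 `^ e) (5 `^ e) * l `^ e <= `|h| `^ e <= (4 `^ e + 5 `^ e) * l `^ e.
Proof.
move=> l0 /andP[h4 h5].
have h0 : 0 < `|h| by rewrite (lt_le_trans _ h4)// mulr_gt0.
have e4 : (4 * l) `^ e = 4 `^ e * l `^ e by rewrite powRM// ltW.
have e5 : (5 * l) `^ e = 5 `^ e * l `^ e by rewrite powRM// ltW.
have p4 := powR_ge0 4 e; have p5 := powR_ge0 5 e; have pl := powR_ge0 l e.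
have [e0|e0] := leP 0 e.
  have h1 : (4 * l) `^ e <= `|h| `^ e.
    by rewrite ge0_ler_powR ?nnegrE ?mulr_ge0 ?(ltW l0) ?(ltW h0)//.
  have h2 : `|h| `^ e <= (5 * l) `^ e.
    by rewrite ge0_ler_powR ?nnegrE ?mulr_ge0 ?(ltW l0) ?(ltW h0)//.
  apply/andP; split.
    by rewrite (le_trans _ h1)// e4 ler_wpM2r// ge_min lexx.
  by rewrite (le_trans h2)// e5 ler_wpM2r// lerDr.
have ne y z : 0 < y -> y <= z -> z `^ e <= y `^ e.
  move=> y0 yz; have -> : e = - (- e) by rewrite opprK.
  have {}e0 : 0 <= - e by rewrite oppr_ge0 ltW.
  move: (- e) e0 => d d0; rewrite !powRN lef_pV2 ?posrE ?powR_gt0 ?(lt_le_trans y0)//.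
  by rewrite ge0_ler_powR ?nnegrE// ?(ltW y0)// (le_trans (ltW y0) yz).
have h1 := ne _ _ h0 h5; have h2 := ne (4 * l) _ (mulr_gt0 (ltr0n R 4) l0) h4.
apply/andP; split.
  by rewrite (le_trans _ h1)// e5 ler_wpM2r// ge_min lexx orbT.
by rewrite (le_trans h2)// e4 ler_wpM2r// lerDl.
Qed.

(** The level set contains the product of J and H for the chosen lambda, and the
powers of l combine to l^(-k). *)
Lemma difference_functional_lower p q gamma k v f (J H : set R) l A :
  0 < p -> 0 < q -> 0 < l -> 0 < A -> (forall x, 0 <= v x) ->
  measurable_fun setT v -> measurable_fun setT f -> measurable J -> measurable H ->
  (l%:E <= mu H)%E -> (forall h, H h -> 4 * l <= `|h| <= 5 * l) ->
  (forall x h, J x -> H h -> A <= `|forward_difference k h f x|) ->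
  (((level_const q gamma k * A / l ^+ k) `^ p)%:E * wmeas v J <=
   difference_functional p q gamma k v f)%E.
Proof.
move=> p0 q0 l0 A0 v0 mv mf mJ mH lH Hl hA.
set e := k%:R + gamma / q.
set w := 4 `^ e + 5 `^ e; set m := Num.min (4 `^ (gamma - 1)) (5 `^ (gamma - 1)) : R.
have w0 : 0 < w by rewrite addr_gt0 ?powR_gt0.
have m0 : 0 < m by rewrite lt_min !powR_gt0.
(* On H the level lam |h|^e is at most A/2. *)
pose lam := A / (2 * (w * l `^ e)).
have lam0 : 0 < lam by rewrite divr_gt0// !mulr_gt0 ?powR_gt0.
pose Eh x h : R := \1_(E_set lam (gamma / q) k f) (x, h) * `|h| `^ (gamma - 1).
pose I x := (\int[mu]_h (Eh x h)%:E)%E.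
have Eh0 x h : 0 <= Eh x h by rewrite mulr_ge0 ?powR_ge0.
have mE := measurable_E_set lam (gamma / q) k mf.
have mEh : measurable_fun setT (fun z : R * R => (Eh z.1 z.2)%:E).
  apply/measurable_EFinP; apply: measurable_funM.
    by apply: (eq_measurable_fun _ _ mE) => -[].
  apply: (measurableT_comp (measurable_powR _)).
  by apply: measurableT_comp => //; exact: measurable_snd.
have mI : measurable_fun setT I.
  apply: (measurable_fun_fubini_tonelli_F (m2 := mu) (fun z : R * R => (Eh z.1 z.2)%:E)) => //.
  by move=> z; rewrite lee_fin.
have IJ x : J x -> ((m * l `^ gamma)%:E <= I x)%E.
  move=> Jx; apply: (@le_trans _ _ (\int[mu]_(h in H) (m * l `^ (gamma - 1))%:E)%E).
    rewrite integral_cst//= (_ : l `^ gamma = l `^ (gamma - 1) * l); last first.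
      by rewrite -[X in _ * X]powRr1 ?ltW// -powRD ?subrK// (gt_eqF l0) implybT.
    by rewrite mulrA EFinM lee_pmul2l// lte_fin mulr_gt0// powR_gt0.
  apply: (@le_trans _ _ (\int[mu]_(h in H) (Eh x h)%:E)%E); last first.
    apply: ge0_subset_integral => //.
      exact: (measurable_fun_pair2 x mEh).
    by move=> h _; rewrite lee_fin.
  apply: ge0_le_integral => //.
  - by move=> h _; rewrite lee_fin mulr_ge0 ?powR_ge0// ltW.
  - by apply: measurable_funTS; exact: (measurable_fun_pair2 x mEh).
  move=> h Hh; rewrite lee_fin /Eh.
  have /andP[h1 _] := powR_between (gamma - 1) l0 (Hl h Hh).
  have /andP[_ h2] := powR_between e l0 (Hl h Hh).
  rewrite indicE mem_set ?mul1r// /E_set/=; split.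
    have /andP[h4 _] := Hl h Hh; rewrite -normr_gt0 (lt_le_trans _ h4)// mulr_gt0//.
  apply: lt_le_trans (hA x h Jx Hh); apply: (@le_lt_trans _ _ (lam * (w * l `^ e))).
    by rewrite ler_wpM2l// ltW.
  have -> : lam * (w * l `^ e) = A * 2^-1.
    by rewrite /lam; field; rewrite !gt_eqF// powR_gt0.
  by rewrite gtr_pMr// invf_lt1// ltr1n.
apply: (@le_trans _ _ ((lam `^ p)%:E * \int[mu]_x (I x `^ (p / q) * (v x)%:E))%E); last first.
  apply: ereal_sup_ubound; exists lam => //.
  by rewrite /= in_itv/= lam0.
apply: (@le_trans _ _ ((lam `^ p)%:E * \int[mu]_(x in J) (((m * l `^ gamma) `^ (p / q))%:E * (v x)%:E))%E); last first.
  apply: lee_wpmul2l; first by rewrite lee_fin powR_ge0.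
  have mIv : measurable_fun setT (fun x => (I x `^ (p / q) * (v x)%:E)%E).
    apply: emeasurable_funM; last exact/measurable_EFinP.
    exact: (measurableT_comp (measurable_poweR _) mI).
  apply: (@le_trans _ _ (\int[mu]_(x in J) (I x `^ (p / q) * (v x)%:E))%E); last first.
    apply: ge0_subset_integral => //.
    by move=> x _; rewrite mule_ge0 ?lee_fin// poweR_ge0.
  apply: ge0_le_integral => //.
  - by move=> x _; rewrite mule_ge0 ?lee_fin// powR_ge0.
  - apply: measurable_funeM; apply: measurable_funTS; exact/measurable_EFinP.
  - exact: measurable_funTS.
  move=> x Jx; apply: lee_wpmul2r; first by rewrite lee_fin.
  rewrite -poweR_EFin; apply: gt0_ler_poweR; rewrite ?in_itv/= ?leey ?andbT ?lee_fin.
  - by rewrite divr_ge0// ltW.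
  - by rewrite mulr_ge0 ?powR_ge0// ltW.
  - by apply: integral_ge0 => h _; rewrite lee_fin.
  - exact: IJ.
rewrite ge0_integralZl//; last 3 first.
- by apply: measurable_funTS; exact/measurable_EFinP.
- by move=> x _; rewrite lee_fin.
- by rewrite lee_fin powR_ge0.
rewrite muleA -EFinM le_eqVlt; apply/orP; left; apply/eqP; congr (_%:E * _)%E.
have -> : p / q = q^-1 * p by rewrite mulrC.
rewrite powRrM -powRM ?powR_ge0 ?(ltW lam0)//; congr (_ `^ _).
rewrite powRM ?powR_ge0 ?(ltW m0)// -powRrM /lam /level_const -/m -/e -/w.
have -> : l `^ e = l ^+ k * l `^ (gamma * q^-1).
  by rewrite -powR_mulrn ?(ltW l0)// -powRD// (gt_eqF l0) implybT.
field; rewrite !gt_eqF ?exprn_gt0 ?powR_gt0//.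
Qed.

End necessity_difference.

Section necessity.
Variable R : realType.
Implicit Types (p q gamma a b c l h x A C : R) (v f g : R -> R) (k : nat).
Notation mu := (@lebesgue_measure R).

Lemma tail_primitive_sobolev k p v a b g : 1 <= p -> locally_integrable setT v -> a < b ->
  measurable_fun setT g -> (forall x, 0 <= g x) -> (exists M, forall x, g x <= M) ->
  exists G, [/\ homogeneous_sobolev k.+1 p v (tail_primitive k a b g),
    is_weak_derivative k.+1 (tail_primitive k a b g) G &
    energy p v G = (\int[mu]_(x in `[a, b]) (g x `^ p * v x))%:E].
Proof.
move=> p1 lv ab mg g0 gM; have ig := integrable_bounded a b mg g0 gM.
exists (fun x => (-1) ^+ k.+1 * (g \_ `[a, b]) x).
have wG := weak_derivative_tail_primitive k ab ig.
have eG : energy p v (fun x => (-1) ^+ k.+1 * (g \_ `[a, b]) x) =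
    (\int[mu]_(x in `[a, b]) (g x `^ p * v x))%:E.
  by apply: energy_patch => //; rewrite normrX normrN1 expr1n.
split=> //; split; first exact: locally_integrable_tail_primitive.
exists (fun x => (-1) ^+ k.+1 * (g \_ `[a, b]) x); split=> //.
by rewrite eG ltry.
Qed.

(** The possible positions of the left endpoint c are those for which a gap of
length b - a separates [c, c+(b-a)] from [a, b]. *)
Definition shifted_testing p v C := forall a b g c, a < b ->
  measurable_fun setT g -> (forall x, 0 <= g x) -> (exists M, forall x, g x <= M) ->
  c = a - 2 * (b - a) \/ c = b + (b - a) ->
  (\int[mu]_(x in `[a, b]) g x) `^ p * \int[mu]_(x in `[c, c + (b - a)]) v x <=
  C * (b - a) `^ p * \int[mu]_(x in `[a, b]) (g x `^ p * v x).

(** Test g against the interval J shifted to the left, then the indicator of J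
against [a, b], which is J shifted to the right: v([a, b]) <= C v(J). *)
Lemma shifted_testing_testing p v C : 1 <= p -> 0 < C -> (forall x, 0 <= v x) ->
  locally_integrable setT v -> shifted_testing p v C -> testing p v (C ^+ 2).
Proof.
move=> p1 C0 v0 lv st a b g ab mg g0 gM _.
have p0 : 0 < p by rewrite (lt_le_trans ltr01).
have ba : 0 < b - a by rewrite subr_gt0.
have lp : 0 < (b - a) `^ p by rewrite powR_gt0.
pose c := a - 2 * (b - a).
have cc : c < c + (b - a) by rewrite ltrDl.
have bc : c + (b - a) - c = b - a by rewrite addrAC subrr add0r.
have hl := st a b g c ab mg g0 gM (or_introl erefl).
have one_le : exists M : R, forall x : R, 1 <= M by exists 1.
have ac : a = c + (b - a) + (b - a) by rewrite /c; ring.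
have := st c (c + (b - a)) (cst 1) a cc (measurable_cst _) (fun=> ler01) one_le.
rewrite bc => /(_ (or_intror ac)).
under [in leRHS]eq_Rintegral do rewrite powR1 mul1r.
rewrite Rintegral_cst//= lebesgue_measure_itv/= lte_fin cc -EFinB bc/= mul1r.
have -> : a + (b - a) = b by rewrite addrC subrK.
rewrite (mulrC C) -[X in _ <= X -> _]mulrA ler_pM2l// => hr.
move: hl hr; set W := \int[mu]_(x in `[c, _]) v x; set V := \int[mu]_(x in `[a, b]) v x.
set I := _ `^ p; set E := \int[mu]_(x in _) (_ * _); set L := (b - a) `^ p => hl hr.
rewrite (@le_trans _ _ (I * (C * W)))//; first by rewrite ler_wpM2l// powR_ge0.
by rewrite mulrCA expr2 -!mulrA ler_pM2l// mulrA.
Qed.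

(** Steps h in [4l, 5l] from the interval shifted to the left jump over [a, b], and
so do steps in [-5l, -4l] from the interval shifted to the right. *)
Lemma difference_testing p q gamma v k C0 : 1 <= p -> 0 < q -> (forall x, 0 <= v x) ->
  locally_integrable setT v -> 0 < C0 ->
  (forall f, homogeneous_sobolev k.+1 p v f -> forall g, is_weak_derivative k.+1 f g ->
    (difference_functional p q gamma k.+1 v f <= C0%:E * energy p v g)%E) ->
  shifted_testing p v (C0 * (k`!%:R / level_const q gamma k.+1) `^ p).
Proof.
move=> p1 q0 v0 lv C00 hf a b g c ab mg g0 gM hc; have [mv _ _] := lv.
have p0 : 0 < p by rewrite (lt_le_trans ltr01).
have l0 : 0 < b - a by rewrite subr_gt0.
have ig := integrable_bounded a b mg g0 gM.
set l := b - a in l0 hc *; set X := \int[mu]_(x in `[a, b]) g x.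
have X0 : 0 <= X by apply: Rintegral_ge0.
have k0 : 0 < (k`!%:R : R) by rewrite ltr0n fact_gt0.
have w0 := level_const_gt0 q gamma k.+1; set w := level_const q gamma k.+1 in w0 *.
set E := \int[mu]_(x in `[a, b]) _.
have E0 : 0 <= E by apply: Rintegral_ge0 => x _; rewrite mulr_ge0 ?powR_ge0.
have [X0'|Xn] := eqVneq X 0.
  by rewrite X0' powR0 ?gt_eqF// mul0r !mulr_ge0 ?powR_ge0// ltW.
have Xp : 0 < X by rewrite lt_neqAle eq_sym Xn.
set A := l ^+ k / k`!%:R * X.
have A0 : 0 < A by rewrite mulr_gt0// divr_gt0// exprn_gt0.
have [G [sf wG eG]] := tail_primitive_sobolev k p1 lv ab mg g0 gM.
have [mf _ _] := sf.1.
have key : (((w * A / l ^+ k.+1) `^ p)%:E * wmeas v `[c, (c + l)%R] <= (C0 * E)%:E)%E.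
  rewrite EFinM -eG; apply: le_trans (hf _ sf _ wG).
  have [cl|cr] := hc.
    apply: (@difference_functional_lower _ p q gamma k.+1 v _ _ `[4 * l, 5 * l]%classic) => //.
    - rewrite lebesgue_measure_itv/= lte_fin ltr_pM2r ?ltr_nat//.
      by rewrite -EFinB lee_fin; lra.
    - move=> h; rewrite /= in_itv/= => /andP[h4 h5].
      by rewrite ger0_norm ?h4// (le_trans _ h4)// mulr_ge0// ltW.
    move=> x h; rewrite /= !in_itv/= => /andP[x1 x2] /andP[h4 h5].
    by apply: norm_difference_left => //; rewrite /l in l0 cl x1 x2 h4 h5 *; lra.
  apply: (@difference_functional_lower _ p q gamma k.+1 v _ _ `[- (5 * l), - (4 * l)]%classic) => //.
  - rewrite lebesgue_measure_itv/= lte_fin ltrN2 ltr_pM2r ?ltr_nat//.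
    by rewrite -EFinB lee_fin; lra.
  - move=> h; rewrite /= in_itv/= => /andP[h4 h5].
    rewrite ler0_norm; last by lra.
    by apply/andP; split; lra.
  move=> x h; rewrite /= !in_itv/= => /andP[x1 x2] /andP[h4 h5].
  by apply: norm_difference_right => //; rewrite /l in l0 cr x1 x2 h4 h5 *; lra.
move: key; rewrite /wmeas (Rintegral_EFin (measurable_itv _) (locally_integrable_itv _ _ lv)).
rewrite -EFinM lee_fin; set V := \int[mu]_(x in _) v x => key.
set Y := w * A / l ^+ k.+1 in key.
have Y0 : 0 <= Y by exact: (divr_ge0 (mulr_ge0 (ltW w0) (ltW A0)) (exprn_ge0 _ (ltW l0))).
have -> : X = Y * (k`!%:R / w) * l.
  by rewrite /Y /A exprS; field; rewrite !gt_eqF ?exprn_gt0.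
have kw : 0 <= k`!%:R / w by rewrite divr_ge0 ?ltW.
rewrite (powRM p (mulr_ge0 Y0 kw) (ltW l0)) (powRM p Y0 kw).
set a1 := Y `^ p in key *; set a2 := (_ / _) `^ p; set a3 := l `^ p.
have a23 : 0 <= a2 * a3 by rewrite mulr_ge0 ?powR_ge0.
by have := ler_wpM2l a23 key; lra.
Qed.

End necessity.

Section necessity_dyadic.
Variable R : realType.
Implicit Types (p q beta alpha a b c l h x A C : R) (v f g : R -> R) (k : nat) (i : int * int).
Notation mu := (@lebesgue_measure R).

(** The difference of f is that of f - P, a combination with binomial coefficients
of translates of f - P; integrate over J. *)
Lemma poly_error_difference k f alpha i (J : set R) h A : 0 <= A ->
  locally_integrable setT f -> measurable J ->
  (forall x j, J x -> (j <= k)%N -> dyadic_itv alpha i (x + j%:R * h)) ->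
  (forall x, J x -> A <= `|forward_difference k h f x|) ->
  (A%:E * mu J <= (2 ^+ k)%:E * poly_error k f (dyadic_itv alpha i))%E.
Proof.
move=> A0 lf mJ JQ hA; have [mf _ _] := lf; have mQ := measurable_dyadic_itv alpha i.
rewrite /poly_error; set P := poly_projection _ _ _.
have sP : (size P <= k)%N.
  have := integrable_dyadic alpha i lf; rewrite /P; case: i {JQ mQ P} => j m.
  by rewrite dyadic_itvE => intf; have [] := poly_projection_spec k (exprz2_gt0 R j) intf.
pose d x := `|f x - P.[x]|.
have md : measurable_fun setT d.
  apply: measurableT_comp => //; apply: measurable_funB => //; exact: measurable_poly.
pose e : R -> \bar R := (fun x => (d x)%:E) \_ (dyadic_itv alpha i).
have me : measurable_fun setT e by exact: measurable_EFin_patch.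
have e0 x : (0 <= e x)%E by rewrite /e patchE; case: ifP => // _; rewrite lee_fin /d.
(* An upper bound on J for the absolute value of the difference of f - P. *)
pose S x := (\sum_(j < k.+1) ('C(k, j)%:R)%:E * e (j%:R * h + x)%R)%E.
have mS (j : nat) : measurable_fun setT (fun x => ('C(k, j)%:R)%:E * e (j%:R * h + x)%R)%E.
  apply: measurable_funeM; apply: (measurableT_comp me).
  exact: measurable_funD.
have S0 (j : nat) x : (0 <= ('C(k, j)%:R)%:E * e (j%:R * h + x)%R)%E.
  by rewrite mule_ge0// lee_fin.
have -> : ((2 ^+ k)%:E * \int[mu]_(x in dyadic_itv alpha i) (d x)%:E = \int[mu]_x S x)%E.
  rewrite ge0_integral_sum//; last by move=> j; exact: mS.
  under eq_bigr => j _.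
    rewrite ge0_integralZl//; last first.
      apply: (measurableT_comp me); exact: measurable_funD.
    rewrite -(ge0_integral_translate (j%:R * h) me e0).
    over.
  rewrite -ge0_sume_distrl; last by move=> j _; rewrite lee_fin.
  rewrite [in RHS]/e -integral_mkcond sumEFin; congr (_%:E * _)%E.
  rewrite -[2]/(1 + 1) exprDn; apply: eq_bigr => j _.
  by rewrite !expr1n mulr1.
rewrite (_ : (A%:E * mu J = \int[mu]_(x in J) A%:E)%E); last by rewrite integral_cst.
rewrite integral_mkcond; apply: ge0_le_integral => //.
- by move=> x _; rewrite patchE; case: ifP => // _; rewrite lee_fin.
- exact: (@measurable_EFin_patch _ J (cst A)).
- by apply: emeasurable_sum => j; exact: mS.
move=> x _; rewrite patchE; case: ifPn => [/set_mem Jx|_]; last first.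
  by apply: sume_ge0 => j _; exact: S0.
rewrite /S (eq_bigr (fun j : 'I_k.+1 => ('C(k, j)%:R * d (j%:R * h + x))%:E)); last first.
  move=> j _; rewrite /e patchE mem_set//= addrC.
  by apply: JQ => //; rewrite -ltnS.
rewrite sumEFin lee_fin (le_trans (hA x Jx))//.
rewrite (forward_difference_sub_poly h f x sP) (le_trans (ler_norm_sum _ _ _))//.
apply: ler_sum => j _.
by rewrite !normrM normrX normrN1 expr1n mul1r normr_nat /d [j%:R * h + x]addrC.
Qed.

(** Keep a single interval in the sum. *)
Lemma dyadic_functional_ge p beta alpha k v f i lam : 0 < lam ->
  ((lam * (2 ^ i.1) `^ (beta + k%:R))%:E < poly_error k f (dyadic_itv alpha i))%E ->
  ((lam `^ p)%:E * (((2 ^ i.1) `^ (p * (beta - 1)))%:E * wmeas v (dyadic_itv alpha i)) <=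
   dyadic_functional p beta alpha k v f)%E.
Proof.
move=> lam0 sel.
apply: (@le_trans _ _ ((lam `^ p)%:E * \esum_(Q in dyadic_sel alpha lam beta k f)
      ((len Q `^ (p * (beta - 1)))%:E * wmeas v Q))%E); last first.
  by apply: ereal_sup_ubound; exists lam => //=; rewrite in_itv/= lam0.
apply: lee_wpmul2l; first by rewrite lee_fin powR_ge0.
apply: ereal_sup_ubound; exists [set dyadic_itv alpha i].
  split; first exact: finite_set1.
  move=> _ ->; split; last by rewrite len_dyadic_itv.
  by apply/dyadicP; exists i.
by rewrite fsbig_set1 len_dyadic_itv.
Qed.

(** The covering interval has length at most 6 (3 (k+1) + 2) l. *)
Definition dyadic_const k : R := k`!%:R * (2 * (6 * (3 * k.+1%:R + 2))) ^+ k.+2.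

Lemma dyadic_const_gt0 k : 0 < dyadic_const k.
Proof. by rewrite mulr_gt0 ?ltr0n ?fact_gt0// exprn_gt0// !mulr_gt0// addr_gt0// mulr_gt0. Qed.

(** Cover the interval J = [a-2l, a-l] and its translates by j 3l, j <= k+1, by one
dyadic interval Q of comparable length.  The steps of length 3l jump over [a, b],
so the error of approximation on Q is at least a multiple of l^(k+1) \int g and
a suitable lambda selects Q; finally v([a, b]) <= v(Q). *)
Lemma dyadic_testing p beta v k C0 : 1 <= p -> (forall x, 0 <= v x) ->
  locally_integrable setT v -> 0 < C0 ->
  (forall alpha, alpha = 0 \/ alpha = 1 / 3 ->
   forall f, homogeneous_sobolev k.+1 p v f -> forall g, is_weak_derivative k.+1 f g ->
    (dyadic_functional p beta alpha k.+1 v f <= C0%:E * energy p v g)%E) ->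
  testing p v (C0 * dyadic_const k `^ p).
Proof.
move=> p1 v0 lv C00 hf a b g ab mg g0 gM _; have [mv _ _] := lv.
have p0 : 0 < p by rewrite (lt_le_trans ltr01).
have l0 : 0 < b - a by rewrite subr_gt0.
have ig := integrable_bounded a b mg g0 gM.
have bE : b = a + (b - a) by rewrite addrC subrK.
set l := b - a in l0 bE *; set X := \int[mu]_(x in `[a, b]) g x.
have X0 : 0 <= X by apply: Rintegral_ge0.
have k0 : 0 < (k`!%:R : R) by rewrite ltr0n fact_gt0.
have D0 := dyadic_const_gt0 k.
set E := \int[mu]_(x in `[a, b]) (_ * _).
have E0 : 0 <= E by apply: Rintegral_ge0 => x _; rewrite mulr_ge0 ?powR_ge0.
have [X0'|Xn] := eqVneq X 0.
  by rewrite X0' powR0 ?gt_eqF// mul0r !mulr_ge0 ?powR_ge0// ltW.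
have Xp : 0 < X by rewrite lt_neqAle eq_sym Xn.
set A := l ^+ k / k`!%:R * X.
have A0 : 0 < A by rewrite mulr_gt0// divr_gt0// exprn_gt0.
have [G [sf wG eG]] := tail_primitive_sobolev k p1 lv ab mg g0 gM.
have kl : 0 < 3 * k.+1%:R * l by rewrite !mulr_gt0.
have [|alpha [i [ha sub _ Lu]]] := @dyadic_cover R (a - 2 * l) (a + 3 * k.+1%:R * l); first by lra.
have L0 := exprz2_gt0 R i.1; set L : R := 2 ^ i.1 in L0 Lu.
have subx x : a - 2 * l <= x <= a + 3 * k.+1%:R * l -> dyadic_itv alpha i x.
  by move=> hx; apply: sub; rewrite /= in_itv.
have hE : ((A * l)%:E <= (2 ^+ k.+1)%:E * poly_error k.+1 (tail_primitive k a b g) (dyadic_itv alpha i))%E.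
  have := @poly_error_difference k.+1 (tail_primitive k a b g) alpha i `[a - 2 * l, a - l]%classic (3 * l) A (ltW A0) sf.1 (measurable_itv _).
  rewrite lebesgue_measure_itv/= lte_fin ifT; last by lra.
  rewrite -EFinB (_ : a - l - (a - 2 * l) = l); last by ring.
  rewrite -EFinM; apply.
    move=> x j; rewrite /= in_itv/= => /andP[x1 x2] jk; apply: subx.
    have j0 : 0 <= j%:R * (3 * l) by rewrite mulr_ge0// mulr_ge0// ltW.
    have jl : j%:R * (3 * l) <= 3 * k.+1%:R * l.
      by rewrite mulrCA mulrA ler_pM2r// ler_pM2l// ler_nat.
    by apply/andP; split; lra.
  move=> x; rewrite /= in_itv/= => /andP[x1 x2].
  by apply: norm_difference_left => //; lra.
(* Half of the lower bound hE for the error, divided by the power of the length. *)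
pose lam := A * l / (2 ^+ k.+2 * L `^ (beta + k.+1%:R)).
have pL r : 0 < L `^ r by exact: powR_gt0.
have lam0 : 0 < lam by apply: divr_gt0; [exact: mulr_gt0|rewrite mulr_gt0 ?exprn_gt0].
have sel : ((lam * L `^ (beta + k.+1%:R))%:E < poly_error k.+1 (tail_primitive k a b g) (dyadic_itv alpha i))%E.
  have -> : lam * L `^ (beta + k.+1%:R) = (2 ^+ k.+1)^-1 * (A * l * 2^-1).
    by rewrite /lam (exprS _ k.+1); field; rewrite !gt_eqF ?exprn_gt0.
  have c2 : 0 < (2 : R) ^+ k.+1 by rewrite exprn_gt0.
  rewrite mulrC EFinM lte_pdivrMr//; apply: lt_le_trans (_ : (A * l)%:E <= _)%E; last by rewrite muleC.
  by rewrite lte_fin; have := mulr_gt0 A0 l0; lra.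
have key := le_trans (dyadic_functional_ge p v lam0 sel) (hf _ ha _ sf _ wG).
move: key; rewrite eG -/L -EFinM muleA -EFinM.
rewrite (mulrC p) powRrM -powRM ?(ltW lam0) ?(ltW (pL _))//.
set Y := lam * _ => key.
have YE : Y = A * l / (2 ^+ k.+2 * L ^+ k.+2).
  rewrite /Y /lam; have -> : L `^ (beta + k.+1%:R) = L `^ (beta - 1) * L ^+ k.+2.
    rewrite -powR_mulrn ?(ltW L0)// -powRD ?(gt_eqF L0) ?implybT//.
    by congr (_ `^ _); rewrite -[in RHS]natr1; ring.
  by field; rewrite !gt_eqF ?exprn_gt0.
have Yge : X / (dyadic_const k * l) <= Y.
  rewrite YE (_ : X / (dyadic_const k * l) = A * l / (2 ^+ k.+2 * (6 * (3 * k.+1%:R + 2) * l) ^+ k.+2)); last first.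
    have m0 : 0 < 6 * (3 * k.+1%:R + 2) :> R by rewrite mulr_gt0// addr_gt0// mulr_gt0.
    rewrite /dyadic_const /A [in LHS]exprMn [(_ * l) ^+ _]exprMn (exprS l k.+1) (exprS l k).
    by field; rewrite !gt_eqF ?exprn_gt0.
  have LM : L <= 6 * (3 * k.+1%:R + 2) * l by rewrite (le_trans Lu)//; lra.
  have M0 := lt_le_trans L0 LM; move: (6 * _ * l) LM M0 => M LM M0.
  have c2 : 0 < (2 : R) ^+ k.+2 by rewrite exprn_gt0.
  rewrite (ler_pM2l (mulr_gt0 A0 l0)).
  rewrite lef_pV2 ?posrE ?(mulr_gt0 c2 (exprn_gt0 _ L0)) ?(mulr_gt0 c2 (exprn_gt0 _ M0))//.
  by rewrite (ler_pM2l c2) lerXn2r ?nnegrE ?(ltW L0) ?(ltW M0).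
have {}key : ((X / (dyadic_const k * l)) `^ p * \int[mu]_(x in `[a, b]) v x <= C0 * E).
  rewrite -lee_fin EFinM -(Rintegral_EFin (measurable_itv _) (locally_integrable_itv _ _ lv)).
  apply: le_trans key; apply: lee_pmul.
  - by rewrite lee_fin powR_ge0.
  - by apply: integral_ge0 => x _; rewrite lee_fin.
  - rewrite lee_fin ge0_ler_powR ?nnegrE ?(ltW p0)//.
      by rewrite divr_ge0// mulr_ge0 ?ltW.
    by rewrite (le_trans _ Yge)// divr_ge0// mulr_ge0 ?ltW.
  apply: ge0_subset_integral => //.
  - exact: measurable_dyadic_itv.
  - by apply: measurable_funTS; exact/measurable_EFinP.
  - by move=> x _; rewrite lee_fin.
  move=> x; rewrite /= in_itv/= => /andP[x1 x2]; apply: subx; apply/andP; split; first by lra.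
  have : (1 : R) <= k.+1%:R by rewrite ler1n.
  by move=> k1; have : l <= 3 * k.+1%:R * l; [rewrite -[leLHS]mul1r ler_pM2r//; lra|lra].
set V := \int[mu]_(x in _) v x in key *; set Z := X / _ in key.
have Z0 : 0 <= Z by rewrite divr_ge0// mulr_ge0 ?ltW.
have -> : X = Z * dyadic_const k * l by rewrite /Z; field; rewrite !gt_eqF.
rewrite (powRM p (mulr_ge0 Z0 (ltW D0)) (ltW l0)) (powRM p Z0 (ltW D0)).
move: key; set a1 := Z `^ p; set a2 := dyadic_const k `^ p; set a3 := l `^ p => key.
have a23 : 0 <= a2 * a3 by rewrite mulr_ge0 ?powR_ge0.
by have := ler_wpM2l a23 key; lra.
Qed.

End necessity_dyadic.

(** * The equivalences *)

Theorem corollary3p5 (R : realType) (v : R -> R) (k : nat) (p q : R)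
    (v_ge0 : forall x, 0 <= v x) (v_loc : locally_integrable setT v)
    (k_gt0 : (0 < k)%N) (p_ge1 : 1 <= p) (q_gt0 : 0 < q)
    (qk : 1 - q^-1 < k%:R) :
  [<-> muckenhoupt p v;
    exists gamma C : R, [/\ Gamma p q gamma, 0 < C &
      forall f, homogeneous_sobolev k p v f ->
      forall g, is_weak_derivative k f g ->
      (difference_functional p q gamma k v f <= C%:E * energy p v g)%E];
    exists beta C : R,
      [/\ (if p == 1 then beta < 0 \/ 1 < beta else beta != 1), 0 < C &
      forall alpha, [set 0; 1 / 3; 2 / 3] alpha ->
      forall f, homogeneous_sobolev k p v f ->
      forall g, is_weak_derivative k f g ->
      (dyadic_functional p beta alpha k v f <= C%:E * energy p v g)%E]].
Proof.
case: k k_gt0 qk => // k _ _.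
have p0 : 0 < p by rewrite (lt_le_trans ltr01).
have difference_of_Ap : muckenhoupt p v -> exists gamma C : R, [/\ Gamma p q gamma, 0 < C &
    forall f, homogeneous_sobolev k.+1 p v f -> forall g, is_weak_derivative k.+1 f g ->
    (difference_functional p q gamma k.+1 v f <= C%:E * energy p v g)%E].
  move=> Ap; have [C C0 hC] := muckenhoupt_difference k p_ge1 q_gt0 v_ge0 v_loc Ap.
  exists 1, C; split=> // [|f [lf _] g wg]; last exact: hC.
  rewrite /Gamma; case: ifP => _; last by apply/eqP; rewrite oner_eq0.
  by right; rewrite /= in_itv/= ltr01.
have dyadic_of_Ap : muckenhoupt p v -> exists beta C : R,
    [/\ (if p == 1 then beta < 0 \/ 1 < beta else beta != 1), 0 < C &
    forall alpha, [set 0; 1 / 3; 2 / 3] alpha ->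
    forall f, homogeneous_sobolev k.+1 p v f -> forall g, is_weak_derivative k.+1 f g ->
    (dyadic_functional p beta alpha k.+1 v f <= C%:E * energy p v g)%E].
  move=> Ap; have [C C0 hC] := muckenhoupt_dyadic k p_ge1 v_ge0 v_loc Ap.
  exists 2, C; split=> //.
    by case: ifP => _; [right; rewrite ltr1n|rewrite (eqr_nat R 2 1)].
  move=> alpha ha f [lf _] g wg; apply: hC => //.
  case: ha => [[->|->]|->]; first by rewrite mul0rn.
    by have -> : (1 / 3 : R) *+ 3 = 1 by field.
  by have -> : (2 / 3 : R) *+ 3 = 2%:~R by field.
have Ap_of_difference : (exists gamma C : R, [/\ Gamma p q gamma, 0 < C &
    forall f, homogeneous_sobolev k.+1 p v f -> forall g, is_weak_derivative k.+1 f g ->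
    (difference_functional p q gamma k.+1 v f <= C%:E * energy p v g)%E]) -> muckenhoupt p v.
  move=> [gamma [C [_ C0 hC]]].
  have := difference_testing p_ge1 q_gt0 v_ge0 v_loc C0 hC.
  set D := C * _; have D0 : 0 < D.
    by rewrite mulr_gt0// powR_gt0// divr_gt0 ?level_const_gt0// ltr0n fact_gt0.
  move=> /(shifted_testing_testing p_ge1 D0 v_ge0 v_loc).
  by apply: testing_muckenhoupt => //; rewrite exprn_gt0.
have Ap_of_dyadic : (exists beta C : R,
    [/\ (if p == 1 then beta < 0 \/ 1 < beta else beta != 1), 0 < C &
    forall alpha, [set 0; 1 / 3; 2 / 3] alpha ->
    forall f, homogeneous_sobolev k.+1 p v f -> forall g, is_weak_derivative k.+1 f g ->
    (dyadic_functional p beta alpha k.+1 v f <= C%:E * energy p v g)%E]) -> muckenhoupt p v.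
  move=> [beta [C [_ C0 hC]]].
  have := @dyadic_testing _ p beta v k C p_ge1 v_ge0 v_loc C0 (fun alpha ha => hC alpha (or_introl ha)).
  by apply: testing_muckenhoupt => //; rewrite mulr_gt0// powR_gt0// dyadic_const_gt0.
by split=> [//|]; split=> [/Ap_of_difference/dyadic_of_Ap|].
Qed.
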